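(* Fix a field $\mathbb{k}$. For all integers $d \geq 2$ and all $0 \leq k \leq d-1$ there exists a Buchsbaum (over $\mathbb{k}$) simplicial poset $X = X(k,d)$ of rank $d$ with the following properties: (1) for all $0 \le i \le d-1$, $\tilde{\beta}_i(X) = 1$ if $i=k$ and $\tilde{\beta}_i(X)=0$ if $i \ne k$; and for all $0 \le j \le d$, $h'_j(X) = \binom{d}{j}$ if $j \in \{0, k+1\}$ and $h'_j(X) = 0$ otherwise; (2) for each atom $v$ of $X$, the link $\mathrm{lk}_X(v)$ is shellable; (3) for each atom $v$ of $X$, $h_j(\mathrm{lk}_X(v)) = \binom{d-1}{j}$ if $j \in \{0,k\}$ and $h_j(\mathrm{lk}_X(v)) = 0$ otherwise (for $0 \le j \le d-1$).
   Context: A (finite) simplicial poset is a finite poset $P$ with a unique minimal element $\hat{0}$ such that every interval $[\hat{0},\tau]$ is a Boolean lattice; $\mathrm{rk}(\tau)$ is the rank of $[\hat 0,\tau]$, the rank of $P$ is the maximal rank, atoms are elements of rank 1, and $f_{i-1}(P)$ is the number of elements of rank $i$. There is a regular CW-complex $|P|$ (closed cells are simplices) with face poset $P$; $\tilde{\beta}_i(P)=\dim_{\mathbb{k}}\tilde H_i(|P|;\mathbb{k})$. For $P$ of rank $d$: $h_j(P)=\sum_{i=0}^j(-1)^{j-i}\binom{d-i}{d-j}f_{i-1}(P)$ and $h'_j(P)=h_j(P)+\binom{d}{j}\sum_{i=0}^{j-1}(-1)^{j-i-1}\tilde\beta_{i-1}(P)$. The link of $\sigma\in P$ is $\mathrm{lk}_P(\sigma)=\{\tau\in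 P:\tau\ge\sigma\}$, a simplicial poset with minimal element $\sigma$ (ranks measured relative to $\sigma$); for an atom $v$ of a rank-$d$ poset, $\mathrm{lk}_P(v)$ has rank $d-1$ and its $h$-numbers are computed by the same formula with $d-1$ in place of $d$. The order complex $\Delta(P)$ is the simplicial complex of chains in $P\setminus\{\hat0\}$. A simplicial complex $\Delta$ is Cohen–Macaulay over $\mathbb{k}$ if $\tilde H_i(\mathrm{lk}_\Delta(\tau);\mathbb{k})=0$ for all faces $\tau$ (including $\emptyset$) and $i<\dim\mathrm{lk}_\Delta(\tau)$; Buchsbaum if pure and every vertex link is Cohen–Macaulay. A simplicial poset is Buchsbaum if its order complex is. Shellability of a simplicial poset means shellability of the regular CW complex $|P|$: a pure $(d-1)$-dimensional regular CW complex is shellable if $d=1$, or $d>1$ and there is a linear order $\sigma_1,\dots,\sigma_r$ of its maximal cells such that (i) for $2\le j\le r$, $(\bigcup_{i<j}\partial\sigma_i)\cap\partial\sigma_j$ is pure of dimension $d-2$, (ii) for $2\le j\le r$ there is a shelling of $\partial\sigma_j$ in which the $(d-2)$-cells of $(\bigcup_{i<j}\partial\sigma_i)\cap\partial\sigma_j$ come first, and (iii) $\partial\sigma_1$ is shellable; here $\partial\sigma$ is the subcomplex of proper faces of $\sigma$. *)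

(* Defs.v *)
From HB Require Import structures.
From mathcomp Require Import all_boot all_order all_algebra.

Set Implicit Arguments.
Unset Strict Implicit.
Unset Printing Implicit Defensive.

Import Order.TTheory GRing.Theory Num.Theory.
Local Open Scope ring_scope.

(* The chain complex spanned by a finite set A of cells, with given dimensions
   and incidence coefficients inc s t = [s : t].  A cell of dimension -1 is
   included, so the homology is reduced. *)
Section CellularHomology.
Variables (K : fieldType) (T : finType) (A : {set T}).
Variables (dim : T -> int) (inc : T -> T -> K).

Definition cell (i : int) := {x : T | (x \in A) && (dim x == i)}.
Definition chain_space (i : int) := {ffun cell i -> K^o}.

Definition boundary_fun (i j : int) (c : chain_space i) : chain_space j :=
  [ffun t : cell j => \sum_(s : cell i) inc (val s) (val t) *: c s].

Fact boundary_fun_linear (i j : int) : linear (@boundary_fun i j).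
Proof.
move=> a c c'; apply/ffunP => t; rewrite !ffunE scaler_sumr -big_split /=.
by apply: eq_bigr => s _; rewrite !ffunE scalerDr !scalerA mulrC.
Qed.

HB.instance Definition _ (i j : int) :=
  GRing.isLinear.Build K (chain_space i) (chain_space j) _
    (@boundary_fun i j) (@boundary_fun_linear i j).

Definition boundary (i j : int) : 'Hom(chain_space i, chain_space j) :=
  linfun (@boundary_fun i j).

Definition betti (i : int) : nat :=
  (\dim (lker (boundary i (i - 1))) - \dim (limg (boundary (i + 1) i)))%N.
End CellularHomology.

(* Oriented simplicial incidence numbers, for the vertex order enum_rank:
   (-1)^p if G is F with its p-th vertex (counting from 0) removed, and 0 if
   G is not obtained from F by removing one vertex. *)
Definition simplex_inc (K : fieldType) (V : finType) (F G : {set V}) : K :=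
  \sum_(v in F | G == F :\ v)
     (-1) ^+ #|[set u in F | (enum_rank u < enum_rank v)%N]|.

(* A simplicial complex is given by its set of faces, including set0; its
   vertices are the v such that [set v] is a face, so V may be larger. *)
Section SimplicialComplex.
Variables (K : fieldType) (V : finType).
Implicit Types (D : {set {set V}}) (F G : {set V}).

Definition simplex_dim F : int := #|F|%:Z - 1.

Definition complex_dim D : int := (\max_(F in D) #|F|)%:Z - 1.

Definition complex_betti D (i : int) : nat :=
  betti D simplex_dim (@simplex_inc K V) i.

Definition complex_link D F : {set {set V}} :=
  [set G : {set V} | [disjoint F & G] && (F :|: G \in D)].

Definition cohen_macaulay D : Prop :=
  forall F, F \in D ->
  forall i : int, i < complex_dim (complex_link D F) ->
    complex_betti (complex_link D F) i = 0%N.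

Definition complex_pure D : Prop :=
  forall F, F \in D -> (forall G, G \in D -> F \subset G -> G = F) ->
    simplex_dim F = complex_dim D.

Definition buchsbaum_complex D : Prop :=
  complex_pure D /\
  forall v : V, [set v] \in D -> cohen_macaulay (complex_link D [set v]).
End SimplicialComplex.

Section Poset.
Variables (disp : Order.disp_t) (P : finBPOrderType disp).
Implicit Types (s t : P) (A C : {set P}).

Definition is_chain C : bool := [forall x in C, forall y in C, (x >=< y)%O].

(* The length of a longest chain in the interval [\bot, t]. *)
Definition rk t : nat :=
  \max_(C : {set P} | is_chain C && [forall x in C, (\bot < x <= t)%O]) #|C|.

Definition rank : nat := \max_(t : P) rk t.

Definition atom t : bool := rk t == 1%N.

Definition boolean_interval t : Prop :=
  exists (n : nat) (f : P -> {set 'I_n}),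
    (forall x y, (x <= t)%O -> (y <= t)%O -> (x <= y)%O = (f x \subset f y)) /\
    (forall B : {set 'I_n}, exists2 x, (x <= t)%O & f x = B).

Definition simplicial_poset : Prop := forall t, boolean_interval t.

Definition cell_dim t : int := (rk t)%:Z - 1.

Definition f_number (i : int) : nat := #|[set t | cell_dim t == i]|.

Definition h_number (j : nat) : int :=
  \sum_(i < j.+1)
     (-1) ^+ (j - i) * ('C(rank - i, rank - j) * f_number (i%:Z - 1))%N%:Z.

Definition atoms_below s : {set P} := [set v | atom v && (v <= s)%O].

(* A cell s of |P| is a simplex with vertex set atoms_below s.  Distinct cells
   can have the same vertices, hence the condition t <= s. *)
Definition poset_inc (K : fieldType) s t : K :=
  if (t <= s)%O then simplex_inc K (atoms_below s) (atoms_below t) else 0.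

Definition poset_betti (K : fieldType) (i : int) : nat :=
  betti [set: P] cell_dim (poset_inc K) i.

Definition h'_number (K : fieldType) (j : nat) : int :=
  h_number j +
  'C(rank, j)%:Z *
    \sum_(i < j) (-1) ^+ (j - i - 1) * (poset_betti K (i%:Z - 1))%:Z.

Definition order_complex : {set {set P}} :=
  [set C : {set P} | (\bot%O \notin C) && is_chain C].

Definition buchsbaum_poset (K : fieldType) : Prop :=
  buchsbaum_complex K order_complex.

(* Subcomplexes of |P| are lower sets A of P; they contain \bot, which stands
   for the empty cell. *)
Definition maximal_cells A : {set P} :=
  [set s in A | [forall t in A, (s <= t)%O ==> (t == s)]].

Definition pure_of_rank (r : nat) A : Prop :=
  A != set0 /\ forall s, s \in maximal_cells A -> rk s = r.

Definition bd s : {set P} := [set t | (t < s)%O].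

Definition old_bd (w : seq P) (j : nat) : {set P} :=
  (\bigcup_(i < j) bd (nth \bot%O w i)) :&: bd (nth \bot%O w j).

(* w is a shelling of the pure subcomplex A of rank d (dimension d - 1); the
   cells of w are numbered from 0.  There is no shelling for d = 0. *)
Fixpoint shelling (d : nat) A (w : seq P) {struct d} : Prop :=
  if d is e.+1 then
    [/\ pure_of_rank e.+1 A, uniq w, w =i maximal_cells A &
        e = 0%N \/
        [/\ forall j, (0 < j < size w)%N -> pure_of_rank e (old_bd w j),
            forall j, (0 < j < size w)%N ->
              exists u : seq P, shelling e (bd (nth \bot%O w j)) u /\
              exists m : nat,
                take m u =i [set t in old_bd w j | rk t == e] &
            exists u : seq P, shelling e (bd (nth \bot%O w 0)) u]]
  else False.

Definition shellable : Prop := exists w : seq P, shelling rank [set: P] w.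

Definition link (s : P) : Type := {t : P | (s <= t)%O}.

Section Link.
Variable s : P.

HB.instance Definition _ := Finite.on (link s).
HB.instance Definition _ := SubType.on (link s).
HB.instance Definition _ := [SubChoice_isSubPOrder of link s by <: with disp].

Definition link_bottom : link s := exist _ s (lexx s).

Fact link_le0x (x : link s) : (link_bottom <= x)%O.
Proof. exact: (valP x). Qed.

HB.instance Definition _ :=
  Order.hasBottom.Build disp (link s) link_le0x.
End Link.
End Poset.

(* Main.v *)
Require Import Defs.
From HB Require Import structures.
From mathcomp Require Import all_boot all_order all_algebra.
From mathcomp Require Import zify ring.
Import Order.TTheory GRing.Theory Num.Theory.
Local Open Scope ring_scope.

Set Implicit Arguments.
Unset Strict Implicit.
Unset Printing Implicit Defensive.

(* X(k, d) is the product, fibred over nonempty vertex sets, of the simplex on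
   d vertices with the simplicial sphere S^k = Delta^k / boundary: a face is a
   vertex set A with an order-preserving map from A onto {0, ..., k}, or with
   the basepoint, which stands for all the maps that are not onto.  There are
   C(#|A| - 1, k) such maps, which gives the face numbers.
   Homology: relative to the simplex of basepoint faces, matching A with A + t
   for t = d-1, d-2, ... in turn leaves the single face on the last k+1
   vertices, of dimension k.
   Local structure: given a vertex v, sort the facets f : {0, ..., d-1} ->
   {0, ..., k} by the total distance from f v to the values of f.  A face of
   the facet f that contains v is new exactly when it contains every vertex at
   which f changes value when moving away from v.  This shells the link of v.
   The same partition into intervals, applied to the part of the order complex
   above the top of a chain, reduces the homology of the links in the order
   complex to cones, so that no theory of joins is required. *)

(** * Homology of cellular chain complexes *)

(** A vertex set does not determine a face, so no argument may treat faces as sets. What survives is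
    that below one fixed face they are subsets; the record [vertexed] keeps exactly this, passes to
    links, and carries the local arguments. The numbers: f-numbers of the form C(d,i) p(i) turn h_j
    into C(d,j) times the j-th finite difference of p at 0. Here p(i) = 1 + C(i-1,k) for i > 0 and
    p(0) = 1; the truncation at 0 leaves an alternating tail for j > k, which the one nonzero Betti
    number cancels except at j = k+1. In the link of an atom the index moves by one: for k > 0, p(i)
    = 1 + C(i,k), whose differences live at 0 and k only. For k = 0 the poset is two disjoint
    simplices, so that case is treated apart. Two obstacles come from the definitions. Incidence
    numbers use the enumeration of the atoms, unrelated to the order of the vertices; reorienting
    the cells reconciles them. The Buchsbaum property concerns all links of chains, while facet
    orders only describe stars of faces; an induction on the codimension of the chain bridges
    this. *)

Section BettiCriteria.
Variables (K : fieldType) (T : finType) (A : {set T}).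
Variables (dim : T -> int) (inc : T -> T -> K).

(** Chains become functions on all of [T], so that every degree shares one type; values outside
    degree [i] are ignored. *)
Definition cellular_boundary (i : int) (c : T -> K) (t : T) : K :=
  \sum_(s in A | dim s == i) inc s t * c s.

Let restrict_chain (i : int) (c : T -> K) : chain_space K A dim i :=
  [ffun x => c (val x)].

Let extend_chain (i : int) (c : chain_space K A dim i) (x : T) : K :=
  if insub x is Some y then c y else 0.

Let extend_chainE i (c : chain_space K A dim i) (x : cell A dim i) :
  extend_chain c (val x) = c x.
Proof. by rewrite /extend_chain valK. Qed.

Let boundaryE i j (c : T -> K) (t : cell A dim j) :
  boundary A dim inc i j (restrict_chain i c) t =
  cellular_boundary i c (val t).
Proof.
rewrite lfunE /= ffunE /cellular_boundary.
transitivity (\sum_(s : cell A dim i) inc (val s) (val t) * c (val s)).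
  by apply: eq_bigr => s _; rewrite ffunE.
symmetry.
exact: (big_sub [pred x | (x \in A) && (dim x == i)]
  (fun s => inc s (val t) * c s)).
Qed.

Let restrict_extend i (c : chain_space K A dim i) :
  restrict_chain i (extend_chain c) = c.
Proof. by apply/ffunP => x; rewrite ffunE extend_chainE. Qed.

Let mem_lker i j (c : T -> K) :
  reflect (forall t, t \in A -> dim t = j -> cellular_boundary i c t = 0)
    (restrict_chain i c \in lker (boundary A dim inc i j)).
Proof.
rewrite memv_ker; apply: (iffP eqP) => [c0 t tA tj|c0].
  have tP : (t \in A) && (dim t == j) by rewrite tA tj eqxx.
  by rewrite -(boundaryE i c (exist _ t tP : cell A dim j)) c0 ffunE.
by apply/ffunP => t; rewrite boundaryE ffunE; case/andP: (valP t) => tA /eqP;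
  apply: c0.
Qed.

Let mem_limg i j (c : T -> K) :
  (exists b, forall t, t \in A -> dim t = j -> cellular_boundary i b t = c t)
    <-> restrict_chain j c \in limg (boundary A dim inc i j).
Proof.
split=> [[b bc]|/memv_imgP[b _ bc]].
  suff ->: restrict_chain j c = boundary A dim inc i j (restrict_chain i b).
    exact/memv_img/memvf.
  apply/ffunP => t; rewrite boundaryE ffunE.
  by case/andP: (valP t) => tA /eqP tj; rewrite bc.
exists (extend_chain b) => t tA tj.
have tP : (t \in A) && (dim t == j) by rewrite tA tj eqxx.
rewrite -(boundaryE i _ (exist _ t tP : cell A dim j)) restrict_extend -bc.
by rewrite ffunE.
Qed.

Lemma betti_eq0 (i : int) :
  (forall c, (forall t, t \in A -> dim t = i - 1 ->
                cellular_boundary i c t = 0) ->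
     exists b, forall t, t \in A -> dim t = i ->
       cellular_boundary (i + 1) b t = c t) ->
  betti A dim inc i = 0%N.
Proof.
move=> exact_i; apply/eqP; rewrite subn_eq0; apply: dimvS.
apply/subvP => c; rewrite -[c]restrict_extend => /mem_lker/exact_i.
by move/mem_limg.
Qed.

(** The cycles are the direct sum of the boundaries and the line through [z]; the last hypothesis
    puts the boundaries among the cycles. *)
Lemma betti_eq1 (i : int) (z : T -> K) :
  (forall t, t \in A -> dim t = i - 1 -> cellular_boundary i z t = 0) ->
  (forall c, (forall t, t \in A -> dim t = i - 1 ->
                cellular_boundary i c t = 0) ->
     exists b l, forall t, t \in A -> dim t = i ->
       cellular_boundary (i + 1) b t = c t - l * z t) ->
  (forall b, ~ forall t, t \in A -> dim t = i ->
       cellular_boundary (i + 1) b t = z t) ->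
  (forall b t, t \in A -> dim t = i - 1 ->
     cellular_boundary i (cellular_boundary (i + 1) b) t = 0) ->
  betti A dim inc i = 1%N.
Proof.
move=> z_cycle gen_i z_nbd bd2; rewrite /betti.
set Z := lker _; set B := limg _; pose v := restrict_chain i z.
have vZ : v \in Z by apply/mem_lker.
have vB : v \notin B by apply/negP => /mem_limg[b /z_nbd].
have BZ : (B <= Z)%VS.
  apply/subvP => _ /memv_imgP[b _ ->].
  suff ->: boundary A dim inc (i + 1) i b =
      restrict_chain i (cellular_boundary (i + 1) (extend_chain b)).
    by apply/mem_lker => t; apply: bd2.
  apply/ffunP => t; rewrite [RHS]ffunE.
  by rewrite -{1}[b]restrict_extend boundaryE.
have -> : Z = (B + <[v]>)%VS.
  apply/eqP; rewrite eqEsubv subv_add BZ -memvE vZ !andbT.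
  apply/subvP => c; rewrite -[c]restrict_extend => /mem_lker/gen_i[b [l bl]].
  have [u uB ->]: exists2 u, u \in B &
      restrict_chain i (extend_chain c) = u + l *: v.
    exists (restrict_chain i (fun t => extend_chain c t - l * z t)).
      by apply/mem_limg; exists b.
    by apply/ffunP => t; rewrite !ffunE /GRing.scale /= subrK.
  by rewrite memv_add // memvZ // memv_line.
rewrite dimv_disjoint_sum; last first.
  apply/eqP; rewrite -subv0; apply/subvP => u.
  rewrite memv_cap => /andP[uB /vlineP[l ul]]; move: uB; rewrite {}ul.
  have [->|l0] := eqVneq l 0; first by rewrite scale0r memv0.
  by move=> /(memvZ l^-1); rewrite scalerA mulVf // scale1r (negPf vB).
rewrite dim_vline addKn; case: eqP => // v0.
by rewrite v0 mem0v in vB.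
Qed.
End BettiCriteria.

(** * Deletion and link of a vertex *)

Section VertexSign.
Variables (K : fieldType) (V : finType) (key : V -> nat).
Hypothesis key_inj : injective key.
Implicit Types (G : {set V}) (u v : V).

(** The sign is indexed by the smaller face and the inserted vertex, not by the larger face as in
    [simplex_inc]. With the enumeration order as [key] and [v] outside [G], the two agree. *)
Definition vertex_sign G v : K := (-1) ^+ #|[set u in G | (key u < key v)%N]|.

Lemma vertex_sign_sqr G v : vertex_sign G v * vertex_sign G v = 1.
Proof. by rewrite -expr2 sqrr_sign. Qed.

Lemma card_before_setU1 G u v : v \notin G ->
  #|[set w in v |: G | (key w < key u)%N]| =
  ((key v < key u) + #|[set w in G | (key w < key u)%N]|)%N.
Proof.
move=> vG; rewrite (cardsD1 v) !inE eqxx /=; congr (_ + _)%N.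
apply: eq_card => w; rewrite !inE.
by case: (eqVneq w v) => //= ->; rewrite (negPf vG).
Qed.

(** Exactly one of the two vertices precedes the other, so exactly one count grows by one. This is
    the cancellation behind the vanishing of the squared boundary. *)
Lemma vertex_sign_anti G u v : u != v -> u \notin G -> v \notin G ->
  vertex_sign G v * vertex_sign (v |: G) u =
  - (vertex_sign G u * vertex_sign (u |: G) v).
Proof.
move=> uv uG vG; rewrite /vertex_sign !card_before_setU1 // !exprD.
have : key u != key v by rewrite (inj_eq key_inj).
by case: ltngtP => //= _ _; ring.
Qed.

(** The same exchange, solved for the product that cone homotopies produce. *)
Lemma vertex_sign_flip G u v : u != v -> u \notin G -> v \notin G ->
  vertex_sign (v |: G) u * vertex_sign (u |: G) v =
  - (vertex_sign G u * vertex_sign G v).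
Proof.
move=> uv uG vG; rewrite /vertex_sign !card_before_setU1 // !exprD.
have : key u != key v by rewrite (inj_eq key_inj).
by case: ltngtP => //= _ _; ring.
Qed.
End VertexSign.

Section SimplicialBoundary.
Variables (K : fieldType) (V : finType).
Implicit Types (D : {set {set V}}) (F G : {set V}) (c : {set V} -> K).

Let sg := @vertex_sign K V (fun v => enum_rank v).

Let sg_anti G u v : u != v -> u \notin G -> v \notin G ->
  sg G v * sg (v |: G) u = - (sg G u * sg (u |: G) v).
Proof. by apply: vertex_sign_anti => x y /val_inj/enum_rank_inj. Qed.

Let sg_flip G u v : u != v -> u \notin G -> v \notin G ->
  sg (v |: G) u * sg (u |: G) v = - (sg G u * sg G v).
Proof. by apply: vertex_sign_flip => x y /val_inj/enum_rank_inj. Qed.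

Let sg_sqr G v : sg G v * sg G v = 1.
Proof. exact: vertex_sign_sqr. Qed.

(** The coefficient of the boundary at [G], as a sum over the vertices that may be added; no degree
    appears, so chains need not be homogeneous. *)
Definition simplicial_boundary D c G : K :=
  \sum_(v | (v \notin G) && (v |: G \in D)) sg G v * c (v |: G).

Local Notation sbd := simplicial_boundary.

Lemma cellular_boundary_simplicial D c G (i : int) : simplex_dim G = i - 1 ->
  cellular_boundary D (@simplex_dim V) (@simplex_inc K V) i c G = sbd D c G.
Proof.
move=> Gi; rewrite /cellular_boundary.
transitivity (\sum_(F in D | simplex_dim F == i) \sum_(v in F | G == F :\ v)
    (-1) ^+ #|[set u in F | (enum_rank u < enum_rank v)%N]| * c F).
  by apply: eq_bigr => F _; rewrite mulr_suml.
rewrite (exchange_big_dep predT) //= (bigID (fun v => v \in G)) /=.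
rewrite big1 ?add0r => [|v vG]; last first.
  by rewrite big_pred0 // => F; apply/negP => /and3P[_ _ /eqP GF];
    rewrite GF !inE eqxx in vG.
rewrite [RHS]big_mkcondr; apply: eq_bigr => v vG.
case: ifP => vGD; last first.
  rewrite big_pred0 // => F; apply/negP => /and3P[/andP[FD _] vF /eqP GF].
  by rewrite GF setD1K // FD in vGD.
rewrite (big_pred1 (v |: G)) => [|F /=].
  congr (_ ^+ _ * _); apply: eq_card => u; rewrite !inE.
  by case: (eqVneq u v) => //= ->; rewrite ltnn andbF.
apply/and3P/eqP => [[_ vF /eqP ->]|->]; first by rewrite setD1K.
rewrite setU11 setU1K // eqxx vGD; split=> //=.
by move: Gi; rewrite /simplex_dim cardsU1 vG; lia.
Qed.

(* Exactness in dimension m - 1: the index m counts vertices. *)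
Definition acyclic_at D m : Prop :=
  forall c, (forall G, G \in D -> #|G|.+1 = m -> sbd D c G = 0) ->
  exists b, forall G, G \in D -> #|G| = m -> sbd D b G = c G.

Lemma acyclic_at_betti D m : acyclic_at D m -> complex_betti K D (m%:Z - 1) = 0%N.
Proof.
move=> Dm; apply: betti_eq0 => c c_cycle.
have [G GD Gm|b bP] := Dm c.
  rewrite -(cellular_boundary_simplicial D c (i := m%:Z - 1)).
    by apply: c_cycle; rewrite // /simplex_dim; lia.
  by rewrite /simplex_dim; lia.
exists b => G GD; rewrite /simplex_dim => Gm.
by rewrite cellular_boundary_simplicial ?bP // /simplex_dim; lia.
Qed.

Lemma complex_betti_neg D (i : int) : i < -1 -> complex_betti K D i = 0%N.
Proof.
move=> i_neg; apply: betti_eq0 => c _; exists (fun=> 0) => G _.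
by rewrite /simplex_dim; lia.
Qed.

Definition down_closed D : Prop :=
  forall F G, F \in D -> G \subset F -> G \in D.

Lemma simplicial_boundary2 D c G : down_closed D -> sbd D (sbd D c) G = 0.
Proof.
move=> Dd; pose s u v := sg G v * (sg (v |: G) u * c (u |: (v |: G))).
pose P u v := [&& u != v, u \notin G, v \notin G & u |: (v |: G) \in D].
pose S := \sum_v \sum_(u | P u v) s u v.
have bd2S : sbd D (sbd D c) G = S.
  rewrite /S (bigID (fun v => (v \notin G) && (v |: G \in D))) /=.
  rewrite [X in _ = _ + X]big1 ?addr0; last first.
    move=> v vP; rewrite big_pred0 // => u; apply: contraNF vP.
    by case/and4P=> _ _ -> /Dd; apply; rewrite subsetUr.
  apply: eq_bigr => v /andP[vG vGD]; rewrite /sbd big_distrr /=.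
  by apply: eq_bigl => u; rewrite !inE negb_or -andbA /P vG.
rewrite bd2S; pose lt (u v : V) := (enum_rank u < enum_rank v)%N.
have -> : S = \sum_v \sum_(u | P u v && lt u v) s u v
            + \sum_v \sum_(u | P u v && ~~ lt u v) s u v.
  by rewrite -big_split; apply: eq_bigr => v _; rewrite (bigID (lt^~ v)).
rewrite [X in _ + X](exchange_big_dep predT) //=.
rewrite -big_split big1 //= => v _.
apply/eqP; rewrite addr_eq0 -sumrN; apply/eqP.
rewrite [RHS](eq_bigl (fun u => P u v && lt u v)); last first.
  move=> u; rewrite /P (eq_sym v u) setUCA /lt.
  case: (eqVneq u v) => //= uv.
  have : enum_rank u != enum_rank v by rewrite (inj_eq enum_rank_inj).
  rewrite -val_eqE /= -leqNgt [in RHS]ltn_neqAle => -> /=.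
  by case: (u \notin G); rewrite ?andbF.
apply: eq_bigr => u /andP[/and4P[uv uG vG _] _].
by rewrite /s !mulrA sg_anti // mulNr setUCA.
Qed.

(** [D] is a cone with apex [p], and inserting [p] is the contracting homotopy. On faces through [p]
    the cycle condition at the opposite face supplies the missing terms. *)
Lemma acyclic_cone D p m :
  (forall G, G \in D -> p |: G \in D) -> down_closed D -> acyclic_at D m.
Proof.
move=> coneD Dd c c_cycle.
pose b F := if p \in F then sg (F :\ p) p * c (F :\ p) else 0.
exists b => G GD Gm; case: (boolP (p \in G)) => pG.
  have [H pH GE] : exists2 H : {set V}, p \notin H & G = p |: H.
    by exists (G :\ p); rewrite ?setD1K // !inE eqxx.
  move: GD Gm; rewrite {G pG}GE cardsU1 pH add1n => GD Gm.
  have HD : H \in D by apply: Dd GD _; rewrite subsetUr.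
  have := c_cycle H HD Gm.
  rewrite /sbd (bigD1 p) ?pH //= => /eqP; rewrite addr_eq0 => /eqP cG.
  transitivity (sg H p * (sg H p * c (p |: H))); last first.
    by rewrite mulrA sg_sqr mul1r.
  rewrite cG mulrN mulr_sumr -sumrN; apply: eq_big => v.
    rewrite !inE negb_or setUCA; case: eqVneq => [->|vp]; first by rewrite andbF.
    rewrite /= andbT; case: (boolP (v \in H)) => //= vH.
    apply/idP/idP => [vD|vD]; last exact: coneD.
    by apply: Dd vD _; rewrite subsetUr.
  rewrite !inE negb_or => /andP[/andP[vp vH] _]; rewrite /b !inE eqxx orbT.
  have -> : (v |: (p |: H)) :\ p = v |: H.
    by rewrite setUCA setU1K // !inE negb_or eq_sym vp.
  by rewrite !mulrA sg_flip // mulNr [sg H v * _]mulrC.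
rewrite /sbd (bigD1 p) ?pG ?coneD //= big1 ?addr0 => [|v /andP[_ vp]].
  by rewrite /b setU11 setU1K // mulrA sg_sqr mul1r.
by rewrite /b !inE (negPf pG) eq_sym (negPf vp) mulr0.
Qed.

Definition vertex_deletion D x : {set {set V}} := [set F in D | x \notin F].
Definition vertex_link D x : {set {set V}} :=
  [set G : {set V} | (x \notin G) && (x |: G \in D)].

(** Index 0 concerns the empty face alone, so the deletion decides; a chain is extended by zero to
    the faces through [x]. *)
Lemma acyclic_vertex0 D x : acyclic_at (vertex_deletion D x) 0 -> acyclic_at D 0.
Proof.
move=> del0 c _; have [G _|b bP] := del0 c; first by [].
exists (fun F => if x \in F then 0 else b F) => G GD G0.
have xG : x \notin G by move/cards0_eq: G0 => ->; rewrite inE.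
rewrite -bP ?inE ?GD // /sbd [RHS]big_mkcond [LHS]big_mkcond.
apply: eq_bigr => v _; rewrite !inE negb_or xG andbT.
by case: (v \notin G); case: (_ \in D); case: (x == v); rewrite /= ?(negPf xG) ?mulr0.
Qed.

(** The exact sequence of [D] and its deletion, whose relative homology is that of the link shifted
    by one, on the level of chains: the part of [c] through [x] is a cycle [c2] of the link; a chain
    [b2] bounding it, joined with [x], gives [b1]. *)
Lemma acyclic_vertex D x m : down_closed D ->
  acyclic_at (vertex_deletion D x) m.+1 -> acyclic_at (vertex_link D x) m ->
  acyclic_at D m.+1.
Proof.
move=> Dd del lk c c_cycle.
have idx G v : x \notin G -> (v \notin x |: G) && (v |: (x |: G) \in D) =
    (v \notin G) && (v |: G \in vertex_link D x).
  move=> xG; rewrite !inE !negb_or setUCA xG andbT [x == v]eq_sym.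
  by case: (v == x); case: (v \in G).
pose c2 G := sg G x * c (x |: G).
have [G|b2 b2P] := lk c2.
  rewrite inE => /andP[xG xGD] Gm.
  transitivity (- (sg G x * sbd D c (x |: G))); last first.
    by rewrite c_cycle ?mulr0 ?oppr0 // cardsU1 xG add1n Gm.
  rewrite /sbd mulr_sumr -sumrN; apply: eq_big => [v|v]; first by rewrite idx.
  rewrite -idx // !inE !negb_or => /andP[/andP[vx vG] _].
  by rewrite /c2 mulrA sg_anti 1?eq_sym // mulNr -mulrA setUCA.
pose b1 F := if x \in F then sg (F :\ x) x * b2 (F :\ x) else 0.
have b1P G : x \notin G -> x |: G \in D -> #|G| = m ->
    sbd D b1 (x |: G) = - c (x |: G).
  move=> xG xGD Gm; transitivity (- (sg G x * c2 G)); last first.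
    by rewrite /c2 mulrA sg_sqr mul1r.
  rewrite -b2P ?inE ?xG // /sbd mulr_sumr -sumrN.
  apply: eq_big => [v|v]; first by rewrite idx.
  rewrite !inE !negb_or => /andP[/andP[vx vG] _].
  rewrite /b1 !inE eqxx orbT.
  have -> : (v |: (x |: G)) :\ x = v |: G.
    by rewrite setUCA setU1K // !inE negb_or eq_sym vx.
  by rewrite mulrA sg_flip // mulNr [sg G v * _]mulrC mulrA.
(* The corrected cycle vanishes on the faces through [x], hence is a cycle of the deletion. *)
pose c' F := c F + sbd D b1 F.
have [G|b3 b3P] := del c'.
  rewrite inE => /andP[GD xG] Gm.
  transitivity (sbd D c' G).
    rewrite /sbd big_mkcond [RHS]big_mkcond; apply: eq_bigr => v _.
    rewrite !inE negb_or xG andbT; case: (eqVneq x v) => [<-|_]; last first.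
      by rewrite andbT.
    rewrite !andbF xG /=; case: ifP => // xGD.
    by rewrite /c' b1P ?subrr ?mulr0 //; case: Gm.
  transitivity (sbd D c G + sbd D (sbd D b1) G).
    by rewrite /sbd -big_split; apply: eq_bigr => v _; rewrite mulrDr.
  by rewrite simplicial_boundary2 // addr0 c_cycle.
exists (fun F => (if x \in F then 0 else b3 F) - b1 F) => G GD Gm.
transitivity (sbd D (fun F => if x \in F then 0 else b3 F) G - sbd D b1 G).
  by rewrite /sbd -sumrN -big_split; apply: eq_bigr => v _; rewrite mulrBr.
case: (boolP (x \in G)) => xG.
  rewrite {1}/sbd big1 ?sub0r => [|v _]; last by rewrite !inE xG orbT mulr0.
  rewrite -(setD1K xG) b1P ?opprK ?setD1K // ?inE ?eqxx //.
  by move: Gm; rewrite (cardsD1 x G) xG => -[].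
apply/eqP; rewrite subr_eq -/(c' G) -b3P ?inE ?GD //; apply/eqP.
rewrite /sbd big_mkcond [RHS]big_mkcond; apply: eq_bigr => v _.
rewrite !inE negb_or xG andbT.
by case: (v \notin G); case: (_ \in D); case: (x == v); rewrite /= ?(negPf xG) ?mulr0.
Qed.
End SimplicialBoundary.

(** * Order complexes *)

Section OrderComplexAcyclicity.
Variables (K : fieldType) (disp : Order.disp_t) (P : finBPOrderType disp).
Implicit Types (x y z p : P) (C Q : {set P}) (n m : nat).

Lemma is_chainP C :
  reflect {in C &, forall x y, (x >=< y)%O} (is_chain C).
Proof.
apply: (iffP forall_inP) => [CC x y xC yC|CC x xC].
  by have /forall_inP := CC x xC; apply.
by apply/forall_inP => y; apply: CC.
Qed.

Lemma is_chainS C C' : C \subset C' -> is_chain C' -> is_chain C.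
Proof.
by move=> /subsetP CC' /is_chainP h; apply/is_chainP => x y /CC' ? /CC' ?; apply: h.
Qed.

Lemma is_chainU1 x C :
  is_chain (x |: C) = is_chain C && [forall y in C, (x >=< y)%O].
Proof.
apply/is_chainP/andP => [xC|[/is_chainP CC /forall_inP xC]].
  split; first by apply/is_chainP => y z yC zC; apply: xC; rewrite setU1r.
  by apply/forall_inP => y yC; apply: xC; rewrite ?setU11 ?setU1r.
move=> y z /setU1P[->|yC] /setU1P[->|zC]; last exact: CC.
- exact: comparablexx.
- exact: xC.
- by rewrite comparable_sym; apply: xC.
Qed.

Definition chains Q : {set {set P}} :=
  [set C : {set P} | (C \subset Q) && is_chain C].

Lemma chains_down_closed Q : down_closed (chains Q).
Proof.
move=> F G; rewrite !inE => /andP[FQ Fc] GF.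
by rewrite (subset_trans GF) //= (is_chainS GF).
Qed.

(** Indices count vertices: reduced homology vanishes in dimensions below [n - 1]. *)
Definition acyclic_below n Q : Prop :=
  forall m, (m < n)%N -> acyclic_at K (chains Q) m.

Definition comparable_set Q x := [set y in Q | (y != x) && (x >=< y)%O].

Lemma acyclic_below_add n Q x : x \in Q ->
  acyclic_below n.+1 (Q :\ x) -> acyclic_below n (comparable_set Q x) ->
  acyclic_below n.+1 Q.
Proof.
move=> xQ del lk m mn.
have delE : vertex_deletion (chains Q) x = chains (Q :\ x).
  by apply/setP => C; rewrite !inE subsetD1 andbAC.
have lkE : vertex_link (chains Q) x = chains (comparable_set Q x).
  apply/setP => C; rewrite !inE is_chainU1 subUset sub1set xQ /=.
  apply/and3P/andP => [[xC CQ /andP[Cc /forall_inP xcC]]|[/subsetP CQ Cc]].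
    split=> //; apply/subsetP => y yC; rewrite inE (subsetP CQ) // xcC // andbT.
    by apply: contraNneq xC => <-.
  split.
  - by apply/negP => /CQ; rewrite inE eqxx andbF.
  - by apply/subsetP => y /CQ; rewrite inE => /andP[].
  - by rewrite Cc; apply/forall_inP => y /CQ; rewrite inE => /and3P[].
case: m mn => [|m] mn; first by apply: (acyclic_vertex0 (x := x)); rewrite delE; apply: del.
apply: (acyclic_vertex (x := x)); first exact: chains_down_closed.
  by rewrite delE; apply: del.
by rewrite lkE; apply: lk.
Qed.

Lemma acyclic_below_cone n Q p : p \in Q -> {in Q, forall y, (p >=< y)%O} ->
  acyclic_below n Q.
Proof.
move=> pQ pcQ m _; apply: (acyclic_cone (p := p)); last exact: chains_down_closed.
move=> C; rewrite !inE is_chainU1 subUset sub1set pQ => /andP[CQ ->]; rewrite CQ /=.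
by apply/forall_inP => y yC; apply/pcQ/(subsetP CQ).
Qed.

(** The closure operator [e] retracts [Q] onto its fixed points, which form a cone with apex [p].
    Elements that are not fixed are removed one by one, a maximal one [y] first: whatever lies above
    [y] is then fixed, hence above [e y], and the link of [y] is a cone with apex [e y]. *)
Lemma acyclic_below_retract n Q p (e : P -> P) :
  p \in Q -> e p = p ->
  {in Q, forall y, e y \in Q} -> {in Q, forall y, (y <= e y)%O} ->
  {in Q &, {homo e : y z / (y <= z)%O}} -> {in Q, forall y, e (e y) = e y} ->
  {in Q, forall y, (p >=< e y)%O} -> acyclic_below n Q.
Proof.
move=> pQ ep; have [N] := ubnP #|[set y in Q | e y != y]|.
elim: N Q pQ => // N IHN Q pQ QN eQ le_e homo_e ee pe.
have [Q0|[y0 y0B]] := set_0Vmem [set y in Q | e y != y].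
  apply: (acyclic_below_cone pQ) => y yQ.
  move/setP/(_ y): Q0; rewrite !inE yQ /= => /negbFE/eqP <-; exact: pe.
case: n IHN => [//|n] IHN.
rewrite inE in y0B.
have [y /andP[yQ ey] ymax] := @arg_maxnP _ y0
  (fun y => (y \in Q) && (e y != y)) (fun y => #|[set z | (z <= y)%O]|) y0B.
have stable z : z \in Q -> (y < z)%O -> e z = z.
  move=> zQ yz; apply/eqP/negPn/negP => ez.
  have := ymax z; rewrite /= zQ ez => /(_ isT); apply/negP; rewrite -ltnNge.
  apply: proper_card; apply/properP; split.
    by apply/subsetP => w; rewrite !inE => /le_lt_trans/(_ yz)/ltW.
  by exists z; rewrite inE ?lexx // lt_geF.
apply: (acyclic_below_add yQ).
  have yNe z : z \in Q -> e z != y by move=> zQ; apply: contraNneq ey => <-; rewrite ee.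
  apply: IHN.
  - by rewrite !inE pQ andbT -ep yNe.
  - rewrite -ltnS; apply: leq_trans QN; rewrite ltnS; apply: proper_card.
    apply/properP; split.
      by apply/subsetP => z; rewrite !inE => /andP[/andP[_ ->]].
    by exists y; rewrite !inE ?eqxx // yQ.
  - by move=> z; rewrite !inE => /andP[_ zQ]; rewrite yNe // eQ.
  - by move=> z; rewrite !inE => /andP[_ zQ]; apply: le_e.
  - by move=> z t; rewrite !inE => /andP[_ zQ] /andP[_ tQ]; apply: homo_e.
  - by move=> z; rewrite !inE => /andP[_ zQ]; apply: ee.
  - by move=> z; rewrite !inE => /andP[_ zQ]; apply: pe.
apply: (acyclic_below_cone (p := e y)).
  by rewrite !inE eQ // ey comparable_sym ge_comparable // le_e.
move=> z; rewrite !inE => /and3P[zQ zy]; case: (comparableP y z) => // [yz|zy'|yz] _.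
- by rewrite comparable_sym ge_comparable // -(stable z) // homo_e // ltW.
- by rewrite ge_comparable //; apply: le_trans (ltW zy') (le_e _ yQ).
- by rewrite yz eqxx in zy.
Qed.

(** The link of each added element is a cone with apex [t], so adding it changes no homology. *)
Lemma acyclic_below_adds n Q0 Q t : Q0 \subset Q -> t \in Q0 ->
  {in Q :\: Q0, forall y, (t >=< y)%O} ->
  (forall y z, y \in Q :\: Q0 -> z \in Q -> (y >=< z)%O -> (t >=< z)%O) ->
  acyclic_below n Q0 -> acyclic_below n Q.
Proof.
move=> Q0Q tQ0 ty tz Q0n; have [N] := ubnP #|Q :\: Q0|.
elim: N Q Q0Q ty tz => // N IHN Q Q0Q ty tz QN.
have [Q0E|[y yQ]] := set_0Vmem (Q :\: Q0).
  suff -> : Q = Q0 by [].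
  by apply/eqP; rewrite eqEsubset Q0Q -setD_eq0 Q0E eqxx.
move: (yQ); rewrite inE => /andP[yQ0 yQ'].
have tQ : t \in Q by apply: (subsetP Q0Q).
case: n Q0n IHN => [//|n] Q0n IHN; apply: (acyclic_below_add yQ').
  apply: IHN.
  - by rewrite subsetD1 Q0Q.
  - by move=> z; rewrite !inE => /and3P[zQ0 _ zQ]; apply: ty; rewrite inE zQ0.
  - move=> z w; rewrite !inE => /and3P[zQ0 _ zQ] /andP[_ wQ].
    by apply: tz; rewrite // inE zQ0.
  - rewrite -ltnS; apply: leq_trans QN; rewrite ltnS; apply: proper_card.
    apply/properP; split; first by apply: setSD; rewrite subsetDl.
    by exists y; rewrite // !inE eqxx andbF.
apply: (acyclic_below_cone (p := t)).
  rewrite !inE tQ comparable_sym ty // andbT.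
  by apply: contraNneq yQ0 => <-.
by move=> z; rewrite !inE => /and3P[zQ zy yz]; apply: (tz y).
Qed.
End OrderComplexAcyclicity.

(** * Posets of faces with vertex sets *)

(* A coherent choice of vertex sets: the faces below y correspond to the
   subsets A of vert y, the face with vertex set A being res y A. *)
Record vertexed (disp : Order.disp_t) (P : finBPOrderType disp) (V : finType)
    (vert : P -> {set V}) (res : P -> {set V} -> P) : Prop := Vertexed {
  vertexed_le : forall x y,
    (x <= y)%O = (vert x \subset vert y) && (res y (vert x) == x);
  vertexed_vert : forall y (A : {set V}), A \subset vert y -> vert (res y A) = A
}.

Section Vertexed.
Variables (disp : Order.disp_t) (P : finBPOrderType disp) (V : finType).
Variables (vert : P -> {set V}) (res : P -> {set V} -> P).
Hypothesis Pv : vertexed vert res.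
Implicit Types (x y z : P) (A B : {set V}) (F : {set P}).

Lemma vert_res y A : A \subset vert y -> vert (res y A) = A.
Proof. exact: (vertexed_vert Pv). Qed.

Lemma vert_le x y : (x <= y)%O -> vert x \subset vert y.
Proof. by rewrite (vertexed_le Pv) => /andP[]. Qed.

Lemma res_vert x y : (x <= y)%O -> res y (vert x) = x.
Proof. by rewrite (vertexed_le Pv) => /andP[_ /eqP]. Qed.

Lemma res_le y A : A \subset vert y -> (res y A <= y)%O.
Proof. by move=> Ay; rewrite (vertexed_le Pv) vert_res // Ay eqxx. Qed.

Lemma le_vert x x' y : (x <= y)%O -> (x' <= y)%O ->
  (x <= x')%O = (vert x \subset vert x').
Proof.
move=> xy x'y; apply/idP/idP => [/vert_le //|xx'].
have rx' : (res x' (vert x) <= x')%O by apply: res_le.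
suff -> : x = res x' (vert x) by [].
by rewrite -(res_vert (le_trans rx' x'y)) vert_res // res_vert.
Qed.

Lemma vert_inj x x' y : (x <= y)%O -> (x' <= y)%O -> vert x = vert x' -> x = x'.
Proof.
by move=> xy x'y xx'; apply/le_anti; rewrite (le_vert xy x'y) (le_vert x'y xy) xx' subxx.
Qed.

Lemma res_mono y A B : A \subset B -> B \subset vert y -> (res y A <= res y B)%O.
Proof.
move=> AB By; have Ay := subset_trans AB By.
by rewrite (@le_vert _ _ y) ?res_le // !vert_res.
Qed.

Lemma le_resP x y A : A \subset vert y -> (x <= y)%O ->
  (x <= res y A)%O = (vert x \subset A).
Proof. by move=> Ay xy; rewrite (@le_vert _ _ y) ?res_le // vert_res. Qed.

Lemma res_res y A B : B \subset A -> A \subset vert y -> res (res y A) B = res y B.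
Proof.
move=> BA Ay; have By := subset_trans BA Ay.
apply: (@vert_inj _ _ y); rewrite ?res_le //.
  by apply: le_trans (res_le Ay); apply: res_le; rewrite vert_res.
by rewrite !vert_res // vert_res.
Qed.

Lemma vert_lt x y : (x < y)%O -> vert x \proper vert y.
Proof.
move=> xy; rewrite properEneq vert_le ?ltW // andbT.
by apply/eqP => /(vert_inj (ltW xy) (lexx y)) xE; rewrite xE ltxx in xy.
Qed.

Lemma card_vert_lt x y : (x < y)%O -> (#|vert x| < #|vert y|)%N.
Proof. by move=> /vert_lt/proper_card. Qed.

Lemma card_vert_le x y : (x >=< y)%O -> (#|vert x| <= #|vert y|)%N -> (x <= y)%O.
Proof.
by move=> /comparable_leNgt -> xy; apply/negP => /card_vert_lt; rewrite ltnNge xy.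
Qed.

Lemma vert_bot : vert \bot%O = set0.
Proof.
have := res_le (sub0set (vert \bot%O)); rewrite lex0 => /eqP <-.
by rewrite vert_res // sub0set.
Qed.

Lemma vert_eq0 x : (vert x == set0) = (x == \bot%O).
Proof.
apply/eqP/eqP => [x0|->]; last exact: vert_bot.
by apply: (@vert_inj _ _ x); rewrite ?le0x ?vert_bot.
Qed.

Lemma card_vert_gt0 x : (0 < #|vert x|)%N = (x != \bot%O).
Proof. by rewrite card_gt0 vert_eq0. Qed.

Lemma comparable_card_inj x y : (x >=< y)%O -> #|vert x| = #|vert y| -> x = y.
Proof.
by move=> xy c; apply/le_anti; rewrite !card_vert_le ?c // comparable_sym.
Qed.

Lemma chain_card_le F d : is_chain F -> (forall x, x \in F -> (0 < #|vert x| <= d)%N) ->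
  (#|F| <= d)%N.
Proof.
move=> /is_chainP Fc Fd; rewrite cardE -(size_map (fun x => #|vert x|)).
rewrite -[d in (_ <= d)%N](size_iota 1); apply: uniq_leq_size.
  rewrite map_inj_in_uniq ?enum_uniq // => x y; rewrite !mem_enum => xF yF.
  by apply/comparable_card_inj/Fc.
by move=> _ /mapP[x xF ->]; rewrite mem_enum in xF; rewrite mem_iota add1n Fd.
Qed.

Lemma rk_vert x : rk x = #|vert x|.
Proof.
apply/eqP; rewrite eqn_leq; apply/andP; split.
  apply/bigmax_leqP => C /andP[Cc /forall_inP Cx]; apply: chain_card_le => // y.
  move=> /Cx/andP[y0 yx]; rewrite card_vert_gt0 -lt0x y0.
  exact/subset_leq_card/vert_le.
move En : #|vert x| => n; elim: n x En => [//|n IHn] x xn.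
have [a ax] : exists a, a \in vert x by apply/card_gt0P; rewrite xn.
have sub : vert x :\ a \subset vert x by apply: subsetDl.
pose y := res x (vert x :\ a).
have yn : #|vert y| = n by rewrite vert_res //; move: xn; rewrite (cardsD1 a) ax => -[].
have yx : (y < x)%O.
  rewrite lt_neqAle res_le // andbT; apply/eqP => yx.
  by move: yn; rewrite yx xn; lia.
have [C /andP[Cc /forall_inP Cy] CE] :
    {C : {set P} | is_chain C && [forall z in C, (\bot < z <= y)%O] & rk y = #|C|}.
  apply: eq_bigmax_cond; apply/card_gt0P; exists set0; rewrite unfold_in.
  by apply/andP; split; [apply/is_chainP => z w|apply/forall_inP => z]; rewrite inE.
have xC : x \notin C by apply/negP => /Cy; rewrite lt_geF // andbF.
apply: leq_trans (_ : #|x |: C| <= _)%N.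
  by rewrite cardsU1 xC add1n ltnS -CE IHn.
apply: (@leq_bigmax_cond _ (fun C : {set P} => is_chain C &&
  [forall z in C, (\bot < z <= x)%O]) (fun C => #|C|)).
rewrite is_chainU1 Cc /=; apply/andP; split.
  apply/forall_inP => z /Cy/andP[_ zy].
  by rewrite comparable_sym; apply/le_comparable/(le_trans zy)/ltW.
apply/forall_inP => z /setU1P[->|/Cy/andP[-> zy]]; last by rewrite (le_trans zy) // ltW.
by rewrite lexx lt0x -card_vert_gt0 xn.
Qed.

Lemma vertexed_simplicial : simplicial_poset P.
Proof.
move=> t; exists #|vert t|, (fun x => [set i | enum_val i \in vert x]).
split=> [x y xt yt|B].
  rewrite (le_vert xt yt); apply/subsetP/subsetP => xy; first by move=> i; rewrite !inE => /xy.
  move=> v vx; have vt : v \in vert t by apply: (subsetP (vert_le xt)).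
  by have := xy (enum_rank_in vt v); rewrite !inE enum_rankK_in //; apply.
have Bt : [set enum_val i | i in B] \subset vert t.
  by apply/subsetP => _ /imsetP[i _ ->]; apply: enum_valP.
exists (res t [set enum_val i | i in B]); first exact: res_le.
by apply/setP => i; rewrite inE vert_res // mem_imset //; apply: enum_val_inj.
Qed.

Lemma acyclic_below_interval (K : fieldType) n (Q : {set P}) lo hi a :
  (lo <= hi)%O -> a \in vert hi -> a \notin vert lo ->
  {in Q, forall y, [|| y <= lo, lo <= y <= hi | hi <= y]%O} ->
  {in Q, forall y, (lo <= y <= hi)%O -> res hi (a |: vert y) \in Q} ->
  res hi (a |: vert lo) \in Q -> acyclic_below K n Q.
Proof.
move=> lohi ahi alo tri clo pQ.
pose e y := if (lo <= y <= hi)%O then res hi (a |: vert y) else y.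
have sub y : (y <= hi)%O -> a |: vert y \subset vert hi.
  by move=> yhi; rewrite subUset sub1set ahi vert_le.
have res_in y : (lo <= y <= hi)%O -> (lo <= res hi (a |: vert y) <= hi)%O.
  case/andP=> loy yhi; rewrite res_le ?sub // andbT le_resP ?sub //.
  by rewrite subsetU // vert_le ?orbT.
have le_e y : (y <= e y)%O.
  rewrite /e; case: ifP => // /andP[loy yhi].
  by rewrite le_resP ?sub // subsetUr.
have ee y : e (e y) = e y.
  rewrite {2 3}/e; case: ifP => yin; last by rewrite /e yin.
  rewrite /e res_in //; case/andP: yin => _ yhi.
  by rewrite vert_res ?sub // setUA setUid.
set p := res hi _ in pQ.
have loin : (lo <= lo <= hi)%O by rewrite lexx.
have pE : p = e lo by rewrite /e loin.
apply: (acyclic_below_retract (e := e) pQ).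
- by rewrite pE ee.
- by move=> y yQ; rewrite /e; case: ifP => // /clo; apply.
- by move=> y _; apply: le_e.
- move=> y z yQ zQ yz; rewrite {1}/e; case: ifP => yin; last first.
    exact: le_trans yz (le_e z).
  case/andP: (yin) => loy yhi.
  rewrite /e; case: ifP => zin.
    case/andP: zin => _ zhi; apply: res_mono; last exact: sub.
    by apply: setUS; apply: vert_le.
  case/andP: (res_in y yin) => _ ehi.
  case/or3P: (tri z zQ) => [zlo| |/(le_trans ehi) //]; last by rewrite zin.
  by rewrite (le_trans loy yz) (le_trans zlo lohi) in zin.
- by move=> y _; apply: ee.
- move=> y yQ; rewrite /e; case: ifP => [/andP[loy yhi]|yin].
    by apply/le_comparable/res_mono; [apply/setUS/vert_le|apply: sub].
  have /andP[lop phi] : (lo <= p <= hi)%O by rewrite res_in.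
  case/or3P: (tri y yQ) => [ylo| |hiy]; last exact/le_comparable/(le_trans phi).
    by rewrite comparable_sym; apply/le_comparable/(le_trans ylo).
  by rewrite yin.
Qed.
End Vertexed.

(** * Facet orders and the Buchsbaum property *)

Section Buchsbaum.
Variables (K : fieldType) (disp : Order.disp_t) (P : finBPOrderType disp).
Variables (V : finType) (vert : P -> {set V}) (res : P -> {set V} -> P).
Hypothesis Pv : vertexed vert res.
Variable d : nat.
Implicit Types (s t x y z : P) (F : {set P}) (w : seq P).

(* The faces of star s are partitioned into intervals [R_j, w_j]: R_j is the
   unique minimal new face when the facet w_j is added to its predecessors. *)
Definition facet_order s w : Prop :=
  [/\ uniq w, w =i [pred t | (s <= t)%O & #|vert t| == d] &
      forall j, (j < size w)%N ->
        exists2 R : {set V}, R \subset vert (nth \bot%O w j) &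
        forall y, (s <= y)%O -> (y <= nth \bot%O w j)%O ->
          has (>= y)%O (take j w) = ~~ (R \subset vert y)].

Hypothesis d_gt0 : (0 < d)%N.
Hypothesis vert_d : forall x, exists2 t, (x <= t)%O & #|vert t| = d.
Hypothesis le_d : forall x, (#|vert x| <= d)%N.
Hypothesis ordered : forall s, s != \bot%O -> exists w, facet_order s w.

(** The vertices of the link of the chain [F] in the order complex. *)
Definition around F : {set P} :=
  [set y | [&& y != \bot%O, y \notin F & [forall x in F, (x >=< y)%O]]].

Lemma aroundP F y :
  reflect [/\ y != \bot%O, y \notin F & {in F, forall x, (x >=< y)%O}]
    (y \in around F).
Proof.
by rewrite inE; apply: (iffP and3P) => -[? ? /forall_inP].
Qed.

Lemma around_setU1 F x : x \in around F ->
  comparable_set (around F) x = around (x |: F).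
Proof.
move=> /aroundP[x0 xF xcF]; apply/setP => y; rewrite inE.
apply/and3P/aroundP => [[/aroundP[y0 yF ycF] yx xy]|[y0 yxF ycF]].
  by split=> //; [rewrite !inE negb_or yx|move=> z /setU1P[->|/ycF]].
move: yxF; rewrite !inE negb_or => /andP[yx yF]; split=> //; last first.
  by apply: ycF; rewrite setU11.
by rewrite y0 yF; apply/forall_inP => z zF; apply: ycF; rewrite setU1r.
Qed.

Lemma chain_max F : is_chain F -> F != set0 ->
  exists2 s, s \in F & {in F, forall x, (x <= s)%O}.
Proof.
move=> /is_chainP Fc /set0Pn[x0 x0F].
have [s sF smax] := @arg_maxnP _ x0 (fun x => x \in F) (fun x => #|vert x|) x0F.
by exists s => // x xF; apply: (card_vert_le Pv); [apply: Fc|apply: smax].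
Qed.

Lemma facet_max t y : #|vert t| = d -> (t <= y)%O -> y = t.
Proof.
move=> td ty; apply/eqP; rewrite eq_le ty andbT.
by apply: (card_vert_le Pv); rewrite ?td // comparable_sym le_comparable.
Qed.

Lemma acyclic_top n F s : is_chain F -> \bot%O \notin F -> s \in F ->
  {in F, forall x, (x <= s)%O} -> (#|vert s| < d)%N ->
  (forall t, t \in around F -> acyclic_below K n (around (t |: F))) ->
  acyclic_below K n.+1 (around F).
Proof.
move=> Fc F0 sF smax sd IH.
have s0 : s != \bot%O by apply: contraNneq F0 => <-.
have [w [w_uniq wE wR]] := ordered s0.
have w_facet t : t \in w -> (s < t)%O /\ #|vert t| = d.
  rewrite wE inE => /andP[st /eqP td]; split=> //; rewrite lt_neqAle st andbT.
  by apply: contraTneq sd => ->; rewrite td ltnn.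
have above y : (s < y)%O -> y \in around F.
  move=> sy; apply/aroundP; split.
  - by apply: contraTneq sy => ->; rewrite ltx0.
  - by apply: contraTN sy => /smax/le_gtF ->.
  - by move=> x /smax xs; apply/le_comparable/(le_trans xs)/ltW.
(* The elements below [s] are present from the start; [W 1] is a cone whose apex is the first
   facet. *)
pose W j := [set y in around F | (y < s)%O || has (>= y)%O (take j w)].
have split_s y : y \in around F -> (y < s)%O || (s < y)%O.
  case/aroundP => _ yF /(_ s sF); case: comparableP => // ys.
  by rewrite -ys sF in yF.
have wWE : W (size w) = around F.
  apply/setP => y; rewrite inE take_size; apply: andb_idr => /split_s/orP[->//|sy].
  have [t yt td] := vert_d y; apply/orP; right; apply/hasP; exists t => //.
  by rewrite wE inE td eqxx andbT (le_trans (ltW sy)).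
have w_gt0 : (0 < size w)%N.
  have [t st td] := vert_d s; have : t \in w by rewrite wE inE st td eqxx.
  by case: (w).
suff acW j : (0 < j <= size w)%N -> acyclic_below K n.+1 (W j).
  by rewrite -wWE; apply: acW; rewrite w_gt0 leqnn.
elim: j => // -[_ _|j IHj /andP[_ jw]].
  have w0 : nth \bot%O w 0 \in w by apply: mem_nth.
  have [sw0 _] := w_facet _ w0.
  apply: (acyclic_below_cone (p := nth \bot%O w 0)).
    by rewrite inE above // (take_nth \bot%O) // has_rcons lexx orbT.
  move=> y; rewrite inE (take_nth \bot%O) // take0 /= orbF => /andP[_ yw].
  rewrite ge_comparable //; case/orP: yw => // ys.
  exact: ltW (lt_trans ys sw0).
pose t := nth \bot%O w j.+1; have tw : t \in w by apply: mem_nth.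
have [st td] := w_facet _ tw; have taround := above _ st.
have [R Rt RE] := wR _ jw; rewrite -/t in Rt RE.
have Rs : ~~ (R \subset vert s).
  rewrite -RE ?lexx ?(ltW st) //; apply/hasP; exists (nth \bot%O w 0).
    by rewrite -(nth_take (n0 := j.+1)) // mem_nth // size_takel // ltnW.
  by have [/ltW] := w_facet _ (mem_nth \bot%O w_gt0).
have takeS : take j.+2 w = rcons (take j.+1 w) t by rewrite (take_nth \bot%O).
have t_new : t \notin W j.+1.
  rewrite inE taround (lt_gtF st) /=; apply/hasPn => u utake.
  apply/negP => /(facet_max td) uE.
  have : uniq (take j.+2 w) by apply: take_uniq.
  by rewrite takeS rcons_uniq -uE utake.
have WS : W j.+2 = W j.+1 :|: [set y in around F | (y <= t)%O].
  apply/setP => y; rewrite in_setU [LHS]inE takeS has_rcons.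
  rewrite [y \in W _]inE [y \in [set _ in _ | _]]inE -andb_orr.
  by rewrite -orbA [_ || (y <= t)%O]orbC.
have mid y : (s < y)%O -> (y <= t)%O -> (y \in W j.+1) = ~~ (R \subset vert y).
  by move=> sy yt; rewrite inE above // lt_gtF //= RE // ltW.
have acT : acyclic_below K n.+1 (t |: W j.+1).
  apply: (acyclic_below_add (x := t)); first by rewrite setU11.
    by rewrite setU1K //; apply: IHj; apply: ltnW.
  (* If [R] and [s] span [t], then every face strictly between [s] and [t] is old, so the link of
     [t] is the link of a longer chain. Otherwise a vertex [b] outside both can be added to a face
     without making it contain [R], which gives a cone. *)
  have [sub|/subsetPn[b bt]] := boolP (vert t \subset R :|: vert s).
    suff -> : comparable_set (t |: W j.+1) t = around (t |: F) by apply: IH.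
    rewrite -around_setU1 //; apply/setP => y; rewrite [LHS]inE [RHS]inE in_setU1.
    case: (eqVneq y t) => [->|yt]; first by rewrite !andbF.
    rewrite [y \in W _]inE /=; case: (boolP (t >=< y)%O) => [ty|_]; rewrite ?andbF // !andbT.
    apply: andb_idr => yar.
    have yt' : (y < t)%O.
      rewrite lt_neqAle yt /= (card_vert_le Pv) ?td //.
      by rewrite comparable_sym.
    case/orP: (split_s y yar) => [->//|sy].
    have := mid y sy (ltW yt'); rewrite inE yar /= => ->; apply/negP => Ry; have := vert_lt Pv yt'.
    rewrite properE => /andP[_ /negP]; apply; apply: subset_trans sub _.
    by rewrite subUset Ry (vert_le Pv) // ltW.
  rewrite inE negb_or => /andP[bR bs].
  have grow y : (s <= y)%O -> (y <= t)%O -> ~~ (R \subset vert y) ->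
      res t (b |: vert y) \in comparable_set (t |: W j.+1) t.
    move=> sy yt Ry; have sub : b |: vert y \subset vert t.
      by rewrite subUset sub1set bt (vert_le Pv).
    have rt : (res t (b |: vert y) <= t)%O by apply: (res_le Pv).
    have Rr : ~~ (R \subset vert (res t (b |: vert y))).
      rewrite (vert_res Pv) //; apply: contra Ry => /subsetP Rb.
      apply/subsetP => v vR; case/setU1P: (Rb v vR) => // vb.
      by rewrite -vb vR in bR.
    have sr : (s < res t (b |: vert y))%O.
      rewrite lt_neqAle (le_resP Pv) ?(ltW st) // subsetU ?(vert_le Pv) ?orbT // andbT.
      by apply: contraNneq bs => ->; rewrite (vert_res Pv) // setU11.
    rewrite inE inE mid // Rr orbT comparable_sym le_comparable // andbT.
    by apply: contraNneq Rr => ->.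
  apply: (@acyclic_below_interval _ _ _ _ _ Pv _ _ _ s t b) => //; first exact: ltW.
  - move=> y; rewrite !inE => /and3P[yQ yt ty].
    have yar : y \in around F.
      by move: yQ; rewrite (negPf yt) /= inE => /andP[].
    case/orP: (split_s y yar) => /ltW sy; first by rewrite sy.
    by rewrite sy /=; case/orP: ty => ->; rewrite ?orbT.
  - move=> y; rewrite inE in_setU1 => /and3P[/predU1P[->|yW] yt _] /andP[sy yt'].
      by rewrite eqxx in yt.
    apply: grow => //; rewrite -mid // lt_neqAle sy andbT.
    by apply: contraTneq yW => <-; rewrite !inE sF andbF.
  - exact: grow (lexx s) (ltW st) Rs.
(* Whatever lies above a new face [y] in [W j.+2] is also below [t], since no earlier facet contains
   [y]; so [t] is an apex for the link of [y]. *)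
have newP y : y \in W j.+2 :\: (t |: W j.+1) -> (s < y)%O /\ (y <= t)%O.
  rewrite WS in_setD in_setU in_setU1 negb_or => /andP[/andP[yt yW]].
  rewrite (negPf yW) /= inE => /andP[yar yt']; split=> //.
  by case/orP: (split_s y yar) => // ys; rewrite inE yar ys in yW.
apply: (acyclic_below_adds (t := t) _ _ _ _ acT).
- by rewrite WS subUset sub1set subsetUl andbT in_setU [X in _ || X]inE taround lexx orbT.
- exact: setU11.
- by move=> y /newP[_ yt]; rewrite ge_comparable.
- move=> y z ynew; have [sy yt] := newP y ynew.
  rewrite WS in_setU => zW /orP[yz|zy]; last by rewrite ge_comparable // (le_trans zy).
  move: ynew; rewrite in_setD in_setU1 negb_or => /andP[/andP[_ yW] _].
  case/orP: zW => [|]; rewrite inE; last by case/andP=> _ zt; rewrite ge_comparable.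
  case/andP=> _ /orP[zs|/hasP[u uw zu]]; first by have := le_lt_trans yz zs; rewrite lt_gtF.
  by case/negP: yW; rewrite inE above //; apply/orP; right; apply/hasP; exists u => //; apply: le_trans zu.
Qed.

(* A chain whose top is a facet but that misses some rank r: lo and hi are the
   chain members around the gap; removing the coatom x0 = hi - a of [lo, hi]
   leaves a cone over lo + a. *)
Lemma acyclic_gap n F s : is_chain F -> \bot%O \notin F -> s \in F ->
  #|vert s| = d -> (#|F| < d)%N ->
  (forall t, t \in around F -> acyclic_below K n (around (t |: F))) ->
  acyclic_below K n.+1 (around F).
Proof.
move=> /is_chainP Fc F0 sF sd Fd IH.
have [r r_d rF] : exists2 r, (0 < r <= d)%N & forall x, x \in F -> #|vert x| != r.
  have [all_r|/allPn[r]] := boolP (all [in [seq #|vert x| | x in F]] (iota 1 d)).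
    have := uniq_leq_size (iota_uniq 1 d) (allP all_r).
    by rewrite size_iota size_image leqNgt Fd.
  rewrite mem_iota add1n ltnS => r_d rF; exists r => // x xF.
  by apply: contraNneq rF => <-; exact: image_f.
have rs : (r < #|vert s|)%N by rewrite ltn_neqAle eq_sym rF // sd; case/andP: r_d.
have [hi /andP[hiF rhi] hi_min] := @arg_minnP _ s
  (fun x => (x \in F) && (r < #|vert x|)%N) (fun x => #|vert x|)
  (introT andP (conj sF rs)).
have r0 : (#|vert \bot%O| < r)%N by rewrite (vert_bot Pv) cards0; case/andP: r_d.
have [lo /andP[loF lor] lo_max] := @arg_maxnP _ \bot%O
  (fun x => (x \in \bot%O |: F) && (#|vert x| < r)%N) (fun x => #|vert x|)
  (introT andP (conj (setU11 _ _) r0)).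
have lo_cmp y : {in F, forall x, (x >=< y)%O} -> (lo >=< y)%O.
  move=> ycF; case/setU1P: loF => [->|/ycF //].
  by apply/le_comparable/le0x.
have cover x : x \in F -> (x <= lo)%O || (hi <= x)%O.
  move=> xF; have := rF x xF; rewrite neq_ltn => /orP[xr|rx].
    rewrite (card_vert_le Pv) //; last by apply: lo_max; rewrite !inE xF orbT.
    by rewrite comparable_sym; apply: lo_cmp => y yF; apply: Fc.
  by rewrite (card_vert_le Pv (Fc _ _ hiF xF)) ?orbT //; apply: hi_min; rewrite xF.
have lohi : (lo < hi)%O.
  rewrite lt_neqAle (card_vert_le Pv) ?andbT.
  - by apply: contraTneq lor => ->; rewrite -leqNgt ltnW.
  - by apply: lo_cmp => x xF; apply: Fc.
  - by rewrite ltnW // (ltn_trans lor).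
have /properP[lohi_sub [a ahi alo]] := vert_lt Pv lohi.
have mid y : (lo < y)%O -> (y < hi)%O -> y \in around F.
  move=> loy yhi; apply/aroundP; split.
  - by apply: contraTneq loy => ->; rewrite ltx0.
  - by apply/negP => /cover/orP[/le_gtF|/le_gtF]; rewrite ?loy ?yhi.
  - move=> x /cover/orP[xlo|hix]; first exact/le_comparable/(le_trans xlo)/ltW.
    by rewrite ge_comparable //; apply: le_trans hix; apply: ltW.
pose x0 := res hi (vert hi :\ a).
have sub0 : vert hi :\ a \subset vert hi by apply: subsetDl.
have vx0 : vert x0 = vert hi :\ a by apply: (vert_res Pv).
have x0hi : (x0 < hi)%O.
  rewrite lt_neqAle (res_le Pv) // andbT.
  by apply: contraTneq ahi => <-; rewrite vx0 !inE eqxx.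
have lox0 : (lo < x0)%O.
  rewrite lt_neqAle (le_resP Pv) ?(ltW lohi) // subsetD1 lohi_sub alo !andbT.
  apply: contraTneq lor => ->; rewrite vx0.
  by move: rhi; rewrite (cardsD1 a (vert hi)) ahi -leqNgt.
have x0F := mid _ lox0 x0hi.
(* Adding [a] to [x0] would give [hi], which belongs to [F]; it is the only face of the open
   interval with this defect. So [x0] is removed, and the hypothesis for [x0 |: F] puts it back. *)
apply: (acyclic_below_add x0F); last by rewrite around_setU1 //; apply: IH.
have sub y : (y <= hi)%O -> a |: vert y \subset vert hi.
  by move=> yhi; rewrite subUset sub1set ahi (vert_le Pv).
have grow y : (lo <= y)%O -> (y <= hi)%O -> a |: vert y != vert hi ->
    res hi (a |: vert y) \in around F :\ x0.
  move=> loy yhi ay; have rhi' := res_le Pv (sub y yhi).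
  have vr := vert_res Pv (sub y yhi).
  rewrite in_setD1 mid ?andbT.
  - apply/eqP => rE; have : a \in vert x0 by rewrite -rE vr setU11.
    by rewrite vx0 !inE eqxx.
  - rewrite lt_neqAle (le_resP Pv) ?sub // ?(le_trans loy) //.
    rewrite subsetU ?(vert_le Pv) ?orbT // andbT.
    by apply: contraNneq alo => ->; rewrite vr setU11.
  - by rewrite lt_neqAle rhi' andbT; apply: contraNneq ay => rE; rewrite -vr rE.
apply: (@acyclic_below_interval _ _ _ _ _ Pv _ _ _ lo hi a) => //; first exact: ltW.
- move=> y; rewrite in_setD1 => /andP[_ /aroundP[_ _ ycF]].
  have := lo_cmp y ycF; rewrite /Order.comparable => /orP[loy|->//].
  have := ycF hi hiF; rewrite /Order.comparable => /orP[->|yhi]; rewrite ?orbT //.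
  by rewrite loy yhi orbT.
- move=> y; rewrite in_setD1 => /andP[yx0 /aroundP[y0 yF _]] /andP[loy yhi].
  apply: grow => //; apply/eqP => ay.
  have yhi' : (y < hi)%O by rewrite lt_neqAle yhi andbT; apply: contraNneq yF => ->.
  case/negP: yx0; apply/eqP; apply: (vert_inj Pv yhi (ltW x0hi)).
  rewrite vx0 -ay setU1K //.
  apply/negP => ya; have := card_vert_lt Pv yhi'.
  by rewrite -ay cardsU1 ya ltnn.
- apply: grow; rewrite ?lexx ?ltW //; apply/eqP => ay.
  by move: rhi; rewrite -ay cardsU1 alo ltnNge add1n lor.
Qed.

(** The link of [F] has dimension at most [n - 1] and is exact below [n - 1]. The chain must be
    nonempty because facet orders exist only for stars of nonempty faces: this is the gap between
    Buchsbaum and Cohen-Macaulay. *)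
Lemma acyclic_around n F : is_chain F -> \bot%O \notin F -> F != set0 ->
  (#|F| + n)%N = d -> acyclic_below K n (around F).
Proof.
elim: n F => [//|n IHn] F Fc F0 Fn0 Fd.
have [s sF smax] := chain_max Fc Fn0.
have IH t : t \in around F -> acyclic_below K n (around (t |: F)).
  case/aroundP => t0 tF tcF; apply: IHn.
  - by rewrite is_chainU1 Fc; apply/forall_inP => x xF; rewrite comparable_sym tcF.
  - by rewrite !inE negb_or eq_sym t0.
  - by apply/set0Pn; exists t; rewrite setU11.
  - by rewrite cardsU1 tF -Fd addnS.
have [sd|] := ltnP #|vert s| d; first exact: acyclic_top smax sd IH.
by move=> ds; apply: (acyclic_gap (s := s)) => //; have := le_d s; lia.
Qed.

Lemma order_complex_le F : F \in order_complex P -> (#|F| <= d)%N.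
Proof.
rewrite inE => /andP[F0 Fc]; apply: (chain_card_le Pv Fc) => x xF.
by rewrite (card_vert_gt0 Pv) le_d andbT; apply: contraNneq F0 => <-.
Qed.

(** Purity follows from exactness at index 0: if a short chain had no extension, the constant chain
    1 on the empty face would have to be a boundary in a complex without vertices. *)
Lemma order_complex_max F : F \in order_complex P ->
  (forall G, G \in order_complex P -> F \subset G -> G = F) -> #|F| = d.
Proof.
move=> FD Fmax; apply/eqP; rewrite eqn_leq order_complex_le //= leqNgt.
apply/negP => Fd; move: (FD); rewrite inE => /andP[F0 Fc].
have no_more : around F = set0.
  apply/setP => t; rewrite in_set0; apply/negP => /aroundP[t0 tF tcF].
  have : t |: F \in order_complex P.
    rewrite inE !inE negb_or eq_sym t0 F0 is_chainU1 Fc.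
    by apply/forall_inP => x xF; rewrite comparable_sym tcF.
  by move/Fmax => /(_ (subsetUr _ _))/setP/(_ t); rewrite setU11 (negPf tF).
have [FE|Fn0] := eqVneq F set0.
  have [t _ td] := vert_d \bot%O.
  have : t \in around F.
    apply/aroundP; rewrite FE; split; rewrite ?inE //; last by move=> x; rewrite inE.
    by rewrite -(card_vert_gt0 Pv) td.
  by rewrite no_more inE.
have := @acyclic_around (d - #|F|) F Fc F0 Fn0; rewrite subnKC ?(ltnW Fd) //.
move=> /(_ erefl 0%N); rewrite subn_gt0 no_more => /(_ Fd (fun=> 1))[//|b].
have E0 : set0 \in chains (set0 : {set P}).
  by rewrite inE sub0set; apply/is_chainP => x y; rewrite inE.
move/(_ set0 E0); rewrite cards0 => /(_ erefl).
rewrite /simplicial_boundary big_pred0 => [/esym/eqP|t].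
  by rewrite oner_eq0.
by rewrite !inE subUset sub1set inE !andbF.
Qed.

Lemma complex_dim_le (D : {set {set P}}) m :
  (forall G, G \in D -> (#|G| <= m)%N) -> complex_dim D <= m%:Z - 1.
Proof.
move=> Dm; rewrite /complex_dim lerD2r lez_nat.
exact/bigmax_leqP.
Qed.

Lemma around_disjoint F (G : {set P}) : G \subset around F -> [disjoint F & G].
Proof.
move=> /subsetP GF; rewrite disjoint_sym; apply/pred0P => x /=; apply/negP => /andP[/GF].
by case/aroundP => _ /negP.
Qed.

Lemma order_complexU F (G : {set P}) : F \in order_complex P ->
  [disjoint F & G] && (F :|: G \in order_complex P) = (G \in chains (around F)).
Proof.
rewrite inE => /andP[F0 Fc]; rewrite !inE negb_or F0 /=.
apply/and3P/andP => [[FG G0 /is_chainP FGc]|[GF /is_chainP Gc]].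
  split; last by apply/is_chainP => x y xG yG; apply: FGc; rewrite inE ?xG ?yG orbT.
  apply/subsetP => y yG; apply/aroundP; split.
  - by apply: contraNneq G0 => <-.
  - by apply/negP => yF; have /pred0P/(_ y) := FG; rewrite /= yF yG.
  - by move=> x xF; apply: FGc; rewrite inE ?xF ?yG ?orbT.
have GP x : x \in G -> x \in around F by apply/subsetP.
split; first exact: around_disjoint.
  by apply/negP => /GP/aroundP[]; rewrite eqxx.
apply/is_chainP => x y /setUP[xF|xG] /setUP[yF|yG].
- by move/is_chainP: Fc; apply.
- by have /aroundP[_ _] := GP y yG; apply.
- by rewrite comparable_sym; have /aroundP[_ _] := GP x xG; apply.
- exact: Gc.
Qed.

Lemma vertexed_buchsbaum : buchsbaum_poset P K.
Proof.
split=> [F FD Fmax|v vD F].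
  rewrite /simplex_dim (order_complex_max FD Fmax) /complex_dim; congr (_%:Z - 1).
  apply/eqP; rewrite eqn_leq; apply/andP; split.
    by rewrite -[X in (X <= _)%N](order_complex_max FD Fmax); apply: leq_bigmax_cond.
  by apply/bigmax_leqP => G; apply: order_complex_le.
rewrite [F \in _]inE => /andP[vF vFD] i.
(* A link inside a vertex link is the link of a longer chain, never of the empty one. *)
have linkE : complex_link (complex_link (order_complex P) [set v]) F =
    chains (around (v |: F)).
  apply/setP => G; rewrite -(order_complexU G vFD) !in_set setUA.
  have vF0 : [set v] :&: F = set0 by apply/eqP; rewrite setI_eq0.
  rewrite -!setI_eq0 setIUl setIUr !setU_eq0 vF0 eqxx /=.
  by rewrite [in RHS](andbC (_ == _)) -!andbA orbA.
rewrite linkE => iD.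
have Fd := order_complex_le vFD.
have : i < (d - #|v |: F|)%N%:Z - 1.
  apply: lt_le_trans iD _; apply: complex_dim_le => G.
  rewrite -(order_complexU G vFD) => /andP[dis /order_complex_le].
  by rewrite cardsU (disjoint_setI0 dis) cards0; lia.
have [i_neg|i_ge] := ltrP i (-1) => i_lt; first exact: complex_betti_neg.
have [m iE] : exists m : nat, i = m%:Z - 1 by exists (absz (i + 1)); lia.
rewrite iE; apply: acyclic_at_betti.
apply: (@acyclic_around (d - #|v |: F|)); last by rewrite iE in i_lt; lia.
- by move: vFD; rewrite inE => /andP[].
- by move: vFD; rewrite inE => /andP[].
- by apply/set0Pn; exists v; rewrite setU11.
- by rewrite subnKC.
Qed.
End Buchsbaum.

(** * Shellings of links *)

Section Shelling.
Variables (disp : Order.disp_t) (P : finBPOrderType disp) (V : finType).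
Variables (vert : P -> {set V}) (res : P -> {set V} -> P).
Hypothesis Pv : vertexed vert res.
Implicit Types (s t x y z : P) (w : seq P).

Lemma rank_vert d : (forall x, (#|vert x| <= d)%N) -> (exists t, #|vert t| = d) ->
  rank P = d.
Proof.
move=> le_d [t td]; apply/eqP; rewrite eqn_leq; apply/andP; split.
  by apply/bigmax_leqP => x _; rewrite (rk_vert Pv).
by rewrite -td -(rk_vert Pv); apply: (leq_bigmax t).
Qed.

Lemma res_lt y a : a \in vert y -> (res y (vert y :\ a) < y)%O.
Proof.
move=> ay; rewrite lt_neqAle (res_le Pv) ?subsetDl // andbT.
by apply: contraTneq ay => <-; rewrite (vert_res Pv) ?subsetDl // !inE eqxx.
Qed.

Lemma le_resD1 x y a : (x <= y)%O -> a \notin vert x ->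
  (x <= res y (vert y :\ a))%O.
Proof.
by move=> xy ax; rewrite (le_resP Pv) ?subsetDl // subsetD1 (vert_le Pv).
Qed.

Lemma card_res_lt y a : a \in vert y -> #|vert y| = #|vert (res y (vert y :\ a))|.+1.
Proof. by move=> ay; rewrite (vert_res Pv) ?subsetDl // (cardsD1 a) ay. Qed.

Lemma bd_maximal e s : #|vert s| = e.+1 ->
  maximal_cells (bd s) = [set t | (t < s)%O & #|vert t| == e].
Proof.
move=> se; apply/setP => t; rewrite !inE; case: (boolP (t < s)%O) => //= ts.
apply/forall_inP/eqP => [tmax|te z].
  have /properP[_ [a sa ta]] := vert_lt Pv ts.
  have := tmax (res s (vert s :\ a)); rewrite inE res_lt // => /(_ isT)/implyP.
  rewrite le_resD1 ?(ltW ts) // => /(_ isT)/eqP <-.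
  by move: se; rewrite (card_res_lt sa) => -[].
rewrite inE => zs; apply/implyP => tz; rewrite eq_le tz andbT.
rewrite (card_vert_le Pv) ?ge_comparable // te.
by have := card_vert_lt Pv zs; rewrite se.
Qed.

Lemma mem_old_bd w j t : (t \in old_bd w j) =
  (t < nth \bot%O w j)%O && [exists i : 'I_j, (t < nth \bot%O w i)%O].
Proof.
rewrite !inE andbC; congr (_ && _).
apply/bigcupP/existsP => [[i _]|[i ti]]; first by rewrite inE; exists i.
by exists i; rewrite ?inE.
Qed.

(** Every order of the facets of the boundary of a simplex is a shelling, since any two of them meet
    in a common facet. *)
Lemma bd_shelling e s u : (0 < e)%N -> #|vert s| = e.+1 -> uniq u ->
  u =i [set t | (t < s)%O & #|vert t| == e] -> shelling e (bd s) u.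
Proof.
elim: e s u => // e IHe s u _ se u_uniq uE; split => //.
- split; first by apply/set0Pn; exists \bot%O; rewrite inE lt0x -(card_vert_gt0 Pv) se.
  by move=> t; rewrite (bd_maximal se) inE (rk_vert Pv) => /andP[_ /eqP].
- by move=> t; rewrite uE (bd_maximal se).
case: (posnP e) => [->|e_gt0]; [by left|right].
have nthP j : (j < size u)%N ->
    (nth \bot%O u j < s)%O /\ #|vert (nth \bot%O u j)| = e.+1.
  by move=> ju; have := mem_nth \bot%O ju; rewrite uE inE => /andP[-> /eqP].
(* As the order is free, any prescribed set of cells can come first, which is condition (ii). *)
have first_cells j (A : {set P}) : (j < size u)%N ->
    A \subset [set t | (t < nth \bot%O u j)%O & #|vert t| == e] ->
    exists u', shelling e (bd (nth \bot%O u j)) u' /\ exists m, take m u' =i A.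
  move=> ju; set B := [set _ | _ & _] => AB.
  exists (enum A ++ enum (B :\: A)); split; last first.
    by exists #|A|; rewrite cardE take_size_cat // => t; rewrite mem_enum.
  apply: IHe => //; first by have [] := nthP j ju.
    rewrite cat_uniq !enum_uniq andbT; apply/hasPn => t.
    by rewrite !mem_enum inE => /andP[].
  move=> t; rewrite mem_cat !mem_enum inE.
  by case: (boolP (t \in A)) => //= tA; rewrite (subsetP AB).
split.
- move=> j /andP[j_gt0 ju]; have [uj_s uj] := nthP j ju; split.
    apply/set0Pn; exists \bot%O; rewrite mem_old_bd lt0x -(card_vert_gt0 Pv) uj /=.
    apply/existsP; exists (Ordinal j_gt0).
    by rewrite lt0x -(card_vert_gt0 Pv); case: (nthP 0%N (ltn_trans j_gt0 ju)) => _ ->.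
  move=> t; rewrite inE mem_old_bd => /andP[/andP[tj /existsP[i ti]]].
  have iu : (i < size u)%N by apply: ltn_trans (ltn_ord i) ju.
  have [ui_s ui] := nthP i iu.
  have uij : nth \bot%O u i != nth \bot%O u j.
    by rewrite nth_uniq // ltn_eqF.
  have /subsetPn[a aj ai] : ~~ (vert (nth \bot%O u j) \subset vert (nth \bot%O u i)).
    apply: contra uij => sub; apply/eqP/(vert_inj Pv (ltW ui_s) (ltW uj_s))/eqP.
    by rewrite eq_sym eqEcard sub ui uj leqnn.
  have at_ : a \notin vert t by apply: contra ai; apply/subsetP/(vert_le Pv)/ltW.
  pose z := res (nth \bot%O u j) (vert (nth \bot%O u j) :\ a).
  have zj : (z < nth \bot%O u j)%O by apply: res_lt.
  have zi : (z <= nth \bot%O u i)%O.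
    rewrite (le_vert Pv (y := s)) ?ltW // ?(lt_trans zj) //.
    rewrite (vert_res Pv) ?subsetDl //; apply/subsetP => b /setD1P[ba bj].
    suff -> : vert (nth \bot%O u i) = vert s :\ a.
      by rewrite !inE ba (subsetP (vert_le Pv (ltW uj_s))).
    have sa : a \in vert s by apply: (subsetP (vert_le Pv (ltW uj_s))).
    apply/eqP; rewrite eqEcard subsetD1 ai (vert_le Pv) ?(ltW ui_s) // ui /=.
    by move: se; rewrite (cardsD1 a) sa add1n => -[->].
  have cz : #|vert z| = e by move: uj; rewrite (card_res_lt aj) => -[].
  have zi' : (z < nth \bot%O u i)%O.
    by rewrite lt_neqAle zi andbT; apply/eqP => zE; move: cz; rewrite zE ui; lia.
  move=> /forall_inP/(_ z); rewrite mem_old_bd zj /=.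
  have -> : [exists i : 'I_j, (z < nth \bot%O u i)%O] by apply/existsP; exists i.
  by rewrite le_resD1 ?(ltW tj) // => /(_ isT)/eqP <-; rewrite (rk_vert Pv).
- move=> j /andP[_ ju]; have [|u' [u'P [m mP]]] :=
    first_cells j [set t in old_bd u j | rk t == e] ju.
    by apply/subsetP => t; rewrite in_set mem_old_bd (rk_vert Pv) in_set => /andP[/andP[->]].
  by exists u'; split => //; exists m.
- have u0 : (0 < size u)%N.
    have [a sa] : exists a, a \in vert s by apply/card_gt0P; rewrite se.
    have : res s (vert s :\ a) \in u.
      by rewrite uE inE res_lt //= -eqSS -(card_res_lt sa) se eqxx.
    by case: (u).
  have [u' [u'P _]] := first_cells 0%N set0 u0 (sub0set _).
  by exists u'.
Qed.

(** A proper face of a facet is old exactly when it omits some vertex [r] of [R]; the facet minus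
    [r] is then old as well and contains it. This is purity of the old boundary. *)
Lemma facet_order_shelling d w : (0 < d)%N ->
  (forall x, exists2 t, (x <= t)%O & #|vert t| = d) ->
  (forall x, (#|vert x| <= d)%N) -> facet_order vert d \bot%O w ->
  shelling d [set: P] w.
Proof.
case: d => // e _ vert_d le_d [w_uniq wE wR].
have maxE : maximal_cells [set: P] = [set t | #|vert t| == e.+1].
  apply/setP => t; rewrite !inE /=; apply/forall_inP/eqP => [tmax|te z _].
    have [u tu ue] := vert_d t; have := tmax u (in_setT _).
    by rewrite tu /= => /eqP <-.
  by apply/implyP => tz; rewrite (facet_max Pv le_d te tz).
have wP j : (j < size w)%N -> #|vert (nth \bot%O w j)| = e.+1.
  by move=> jw; have := mem_nth \bot%O jw; rewrite wE inE => /andP[_ /eqP].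
split => //.
- split; first by apply/set0Pn; exists \bot%O; rewrite inE.
  by move=> t; rewrite maxE inE (rk_vert Pv) => /eqP.
- by move=> t; rewrite wE maxE !inE le0x.
case: (posnP e) => [->|e_gt0]; [by left|right].
have coatoms j (A : {set P}) : (j < size w)%N ->
    A \subset [set t | (t < nth \bot%O w j)%O & #|vert t| == e] ->
    exists u', shelling e (bd (nth \bot%O w j)) u' /\ exists m, take m u' =i A.
  move=> jw; set B := [set _ | _ & _] => AB.
  exists (enum A ++ enum (B :\: A)); split; last first.
    by exists #|A|; rewrite cardE take_size_cat // => t; rewrite mem_enum.
  apply: bd_shelling => //; first exact: wP.
    rewrite cat_uniq !enum_uniq andbT; apply/hasPn => t.
    by rewrite !mem_enum inE => /andP[].
  move=> t; rewrite mem_cat !mem_enum inE.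
  by case: (boolP (t \in A)) => //= tA; rewrite (subsetP AB).
split.
- move=> j /andP[j_gt0 jw]; have [R Rj RE] := wR j jw.
  have oldE t : (t < nth \bot%O w j)%O -> (t \in old_bd w j) = ~~ (R \subset vert t).
    move=> tj; rewrite mem_old_bd tj /= -RE ?le0x // ?(ltW tj) //.
    apply/existsP/hasP => [[i ti]|[u]].
      exists (nth \bot%O w i); last exact: ltW.
      by rewrite -(nth_take (n0 := j)) // mem_nth // size_takel // ltnW.
    move=> utake tu; have [i iw uE] := nthP \bot%O utake.
    have ij : (i < j)%N by rewrite size_takel // ltnW in iw.
    exists (Ordinal ij) => /=; rewrite -(nth_take (n0 := j)) // uE.
    rewrite lt_neqAle tu andbT; apply: contraTneq tj => ->.
    rewrite -uE nth_take //; apply/negP => /(card_vert_lt Pv).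
    by rewrite !wP ?ltnn // (ltn_trans ij).
  split.
    apply/set0Pn; exists \bot%O; rewrite mem_old_bd lt0x -(card_vert_gt0 Pv) wP //=.
    apply/existsP; exists (Ordinal j_gt0).
    by rewrite lt0x -(card_vert_gt0 Pv) wP // (ltn_trans j_gt0).
  move=> t; rewrite inE => /andP[told].
  have tj : (t < nth \bot%O w j)%O by move: told; rewrite mem_old_bd => /andP[].
  move: (told); rewrite oldE // => /subsetPn[r rR rt].
  have rj : r \in vert (nth \bot%O w j) by apply: (subsetP Rj).
  move=> /forall_inP/(_ (res (nth \bot%O w j) (vert (nth \bot%O w j) :\ r))) tmax.
  have /tmax/implyP : res (nth \bot%O w j) (vert (nth \bot%O w j) :\ r) \in old_bd w j.
    rewrite oldE ?res_lt // (vert_res Pv) ?subsetDl //.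
    by apply/negP => /subsetP/(_ r rR); rewrite !inE eqxx.
  rewrite le_resD1 ?(ltW tj) // => /(_ isT)/eqP <-.
  by rewrite (rk_vert Pv); move: (wP j jw); rewrite (card_res_lt rj) => -[].
- move=> j /andP[_ jw]; have [|u' [u'P [m mP]]] :=
    coatoms j [set t in old_bd w j | rk t == e] jw.
    by apply/subsetP => t; rewrite in_set mem_old_bd (rk_vert Pv) in_set => /andP[/andP[->]].
  by exists u'; split => //; exists m.
- have w0 : (0 < size w)%N.
    have [t _ te] := vert_d \bot%O.
    by have : t \in w; [rewrite wE inE le0x te eqxx|case: (w)].
  have [u' [u'P _]] := coatoms 0%N set0 w0 (sub0set _).
  by exists u'.
Qed.
End Shelling.

(** * Links of faces *)

Section Link.
Variables (disp : Order.disp_t) (P : finBPOrderType disp) (V : finType).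
Variables (vert : P -> {set V}) (res : P -> {set V} -> P).
Hypothesis Pv : vertexed vert res.
Variables (d : nat) (v : P).
Hypothesis vert_d : forall x, exists2 t, (x <= t)%O & #|vert t| = d.
Hypothesis le_d : forall x, (#|vert x| <= d)%N.

Definition link_vert (y : link v) : {set V} := vert (val y) :\: vert v.
Definition link_res (y : link v) (A : {set V}) : link v :=
  insubd (link_bottom v) (res (val y) (vert v :|: A)).

Lemma val_link_res (y : link v) (A : {set V}) : A \subset link_vert y ->
  val (link_res y A) = res (val y) (vert v :|: A).
Proof.
move=> Ay; rewrite val_insubd (le_resP Pv) ?(valP y) //.
  by rewrite subsetUl.
rewrite subUset (vert_le Pv (valP y)) /=.
by apply: subset_trans Ay _; apply: subsetDl.
Qed.

Lemma link_vertU (y : link v) : vert v :|: link_vert y = vert (val y).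
Proof.
apply/setP => a; rewrite !inE; case: (boolP (a \in vert v)) => //= va.
by rewrite (subsetP (vert_le Pv (valP y))).
Qed.

Lemma link_vertexed : vertexed link_vert link_res.
Proof.
split=> [x y|y A Ay].
  have -> : (x <= y)%O = (val x <= val y)%O by [].
  apply/idP/andP => [xy|[xy /eqP]].
    have sub : link_vert x \subset link_vert y by apply/setSD/(vert_le Pv).
    by rewrite sub -val_eqE val_link_res // link_vertU (res_vert Pv xy).
  move/(congr1 val); rewrite val_link_res // => <-; apply: (res_le Pv).
  by rewrite -(link_vertU y) setUS.
rewrite /link_vert val_link_res // (vert_res Pv).
  rewrite setDUl setDv set0U; apply/setDidPl; rewrite -setI_eq0 -subset0.
  apply/subsetP => a; rewrite inE => /andP[/(subsetP Ay)].
  by rewrite inE => /andP[/negPf ->].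
by rewrite -(link_vertU y) setUS.
Qed.

Lemma card_link_vert (y : link v) : #|link_vert y| = (#|vert (val y)| - #|vert v|)%N.
Proof. by rewrite cardsD (setIidPr _) // (vert_le Pv (valP y)). Qed.

Lemma link_facet (x : link v) :
  exists2 t : link v, (x <= t)%O & #|link_vert t| = (d - #|vert v|)%N.
Proof.
have [t xt td] := vert_d (val x).
have vt : (v <= t)%O := le_trans (valP x) xt.
by exists (exist _ t vt : link v); rewrite // card_link_vert td.
Qed.

Lemma card_link_vert_le (x : link v) : (#|link_vert x| <= d - #|vert v|)%N.
Proof. by rewrite card_link_vert leq_sub2r. Qed.

Lemma rank_link : rank (link v) = (d - #|vert v|)%N.
Proof.
apply: (rank_vert link_vertexed card_link_vert_le).
by have [t _ td] := link_facet (link_bottom v); exists t.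
Qed.

(** The faces of the link are the faces of the star of [v], so the order is reused; each [R] only
    loses the vertices of [v], which all these faces contain. *)
Lemma link_facet_order w : facet_order vert d v w ->
  facet_order link_vert (d - #|vert v|) \bot%O (map (insubd (link_bottom v)) w).
Proof.
case=> w_uniq wE wR; pose f := insubd (link_bottom v).
have fK t : t \in w -> val (f t) = t by rewrite wE inE => /andP[vt _]; rewrite insubdK.
have nthE j : (j < size w)%N -> val (nth \bot%O (map f w) j) = nth \bot%O w j.
  by move=> jw; rewrite (nth_map \bot%O) // fK // mem_nth.
split.
- rewrite map_inj_in_uniq // => t u tw uw /(congr1 val).
  by rewrite !fK.
- move=> t; rewrite inE le0x /= card_link_vert.
  have v_le := subset_leq_card (vert_le Pv (valP t)).
  have -> : (#|vert (val t)| - #|vert v| == d - #|vert v|)%N = (#|vert (val t)| == d).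
    by have := le_d (val t); lia.
  rewrite -[RHS]andTb -(valP t) -[RHS](wE (val t)); apply/mapP/idP => [[u uw ->]|tw].
    by rewrite fK.
  by exists (val t) => //; apply: val_inj; rewrite fK.
move=> j; rewrite size_map => jw; have [R Rj RE] := wR j jw.
exists (R :\: vert v); first by rewrite /link_vert nthE // setSD.
move=> y _ yj; have yj' : (val y <= nth \bot%O w j)%O by rewrite -nthE.
have -> : (R :\: vert v \subset link_vert y) = (R \subset vert (val y)).
  by rewrite subDset link_vertU.
rewrite -RE ?(valP y) // -map_take has_map; apply: eq_in_has => t /mem_take tw.
by rewrite /= -[t in RHS]fK.
Qed.

Lemma link_shellable w : (#|vert v| < d)%N -> facet_order vert d v w ->
  shellable (link v).
Proof.
move=> vd /link_facet_order wo; exists (map (insubd (link_bottom v)) w).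
rewrite rank_link; apply: (facet_order_shelling link_vertexed) => //.
- by rewrite subn_gt0.
- exact: link_facet.
- exact: card_link_vert_le.
Qed.
End Link.

(** * The poset of faces *)

Section Faces.
Variables (d k : nat).
Implicit Types (h f g : {ffun 'I_d -> 'I_k.+1}) (A B : {set 'I_d}).
Implicit Types (o : option {ffun 'I_d -> 'I_k.+1}).

Definition onto h A : bool := [forall i, exists t in A, h t == i].

Definition mono h A : bool :=
  [forall s in A, forall t in A, (s <= t)%N ==> (h s <= h t)%N].

Definition omono o A : bool := if o is Some h then mono h A else true.

(** A normal form: with values off [A] set to 0, maps that agree on [A] become equal. *)
Definition cut h A : {ffun 'I_d -> 'I_k.+1} :=
  [ffun t => if t \in A then h t else ord0].

(* None is the basepoint of the simplicial sphere, i.e. the class of all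
   order-preserving maps that are not onto. *)
Definition restrict o A : option {ffun 'I_d -> 'I_k.+1} :=
  if o is Some h then if onto h A then Some (cut h A) else None else None.

(** Being fixed by [restrict] says at once that the map is onto on the vertex set and in normal
    form. *)
Definition valid (x : {set 'I_d} * option {ffun 'I_d -> 'I_k.+1}) : bool :=
  if x.2 is Some h then mono h x.1 && (restrict x.2 x.1 == x.2) else true.

Definition face : Type :=
  {x : {set 'I_d} * option {ffun 'I_d -> 'I_k.+1} | valid x}.

HB.instance Definition _ := Finite.on face.
HB.instance Definition _ := SubType.on face.

Definition verts (x : face) : {set 'I_d} := (val x).1.
Definition map_of (x : face) : option {ffun 'I_d -> 'I_k.+1} := (val x).2.

Lemma face_eq (x y : face) : verts x = verts y -> map_of x = map_of y -> x = y.
Proof.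
rewrite /verts /map_of => xy1 xy2; apply: val_inj.
by rewrite [val x]surjective_pairing xy1 xy2 -surjective_pairing.
Qed.

Lemma ontoP h A : reflect (forall i, exists2 t, t \in A & h t = i) (onto h A).
Proof.
apply: (iffP forallP) => hA i; first by have /exists_inP[t tA /eqP] := hA i; exists t.
by have [t tA hi] := hA i; apply/exists_inP; exists t; rewrite ?hi.
Qed.

Lemma monoP h A :
  reflect (forall s t, s \in A -> t \in A -> (s <= t)%N -> (h s <= h t)%N) (mono h A).
Proof.
apply: (iffP forall_inP) => hA s; last first.
  by move=> sA; apply/forall_inP => t tA; apply/implyP; apply: hA.
by move=> t sA tA; have /forall_inP/(_ t tA)/implyP := hA s sA.
Qed.

Lemma mono_sub h A B : A \subset B -> mono h B -> mono h A.
Proof. by move=> /subsetP AB /monoP hB; apply/monoP => s t /AB ? /AB ?; apply: hB. Qed.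

Lemma onto_sub h A B : A \subset B -> onto h A -> onto h B.
Proof.
by move=> /subsetP AB /ontoP hA; apply/ontoP => i; have [t /AB] := hA i; exists t.
Qed.

Lemma eq_onto h f A : {in A, h =1 f} -> onto h A = onto f A.
Proof.
by move=> hf; apply/ontoP/ontoP => hA i; have [t tA] := hA i; exists t; rewrite // ?hf // -hf.
Qed.

Lemma eq_mono h f A : {in A, h =1 f} -> mono h A = mono f A.
Proof.
by move=> hf; apply/monoP/monoP => hA s t sA tA /(hA s t sA tA); rewrite !hf.
Qed.

Lemma eq_cut h f A : {in A, h =1 f} -> cut h A = cut f A.
Proof. by move=> hf; apply/ffunP => t; rewrite !ffunE; case: ifP => // /hf. Qed.

Lemma cut_in h A : {in A, cut h A =1 h}.
Proof. by move=> t tA; rewrite ffunE tA. Qed.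

Lemma eq_restrict h f A : {in A, h =1 f} -> restrict (Some h) A = restrict (Some f) A.
Proof. by move=> hf; rewrite /= (eq_onto hf) (eq_cut hf). Qed.

Lemma restrict_restrict o A B : A \subset B ->
  restrict (restrict o B) A = restrict o A.
Proof.
case: o => // h AB; rewrite {2}/restrict; case: ifP => hB; last first.
  by rewrite /restrict; case: ifP => // hA; rewrite (onto_sub AB hA) in hB.
by apply: eq_restrict => t tA; apply: cut_in; apply: (subsetP AB).
Qed.

Lemma valid_restrict o A B : omono o B -> A \subset B ->
  valid (A, restrict o A).
Proof.
move=> oB AB; have := @restrict_restrict o A A (subxx A); rewrite /valid.
case E: (restrict o A) => [f|//] /= ->; rewrite eqxx andbT.
case: o oB E => //= h hB; case: ifP => // _ [<-].
by rewrite (eq_mono (@cut_in _ _)) (mono_sub AB).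
Qed.

Lemma map_of_mono (x : face) h : map_of x = Some h -> mono h (verts x).
Proof.
by have := valP x; rewrite /valid -/(map_of x) => /[swap] -> /andP[].
Qed.

Lemma map_of_restrict (x : face) : restrict (map_of x) (verts x) = map_of x.
Proof.
have := valP x; rewrite /valid -/(map_of x) -/(verts x).
by case E: (map_of x) => [h|//] /andP[_ /eqP].
Qed.

Lemma map_of_onto (x : face) h : map_of x = Some h -> onto h (verts x).
Proof.
by move=> xh; have := map_of_restrict x; rewrite xh /=; case: ifP.
Qed.

Lemma bot_valid : valid (set0, None). Proof. by []. Qed.
Definition empty_face : face := exist _ (set0, None) bot_valid.

Definition res_face (y : face) A : face := insubd empty_face (A, restrict (map_of y) A).

Lemma res_faceP (y : face) A : A \subset verts y -> valid (A, restrict (map_of y) A).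
Proof.
apply: valid_restrict; case E: (map_of y) => [h|//]; exact: map_of_mono.
Qed.

Lemma verts_res (y : face) A : A \subset verts y -> verts (res_face y A) = A.
Proof. by move=> Ay; rewrite /verts insubdK //; apply: res_faceP. Qed.

Lemma map_of_res (y : face) A : A \subset verts y ->
  map_of (res_face y A) = restrict (map_of y) A.
Proof. by move=> Ay; rewrite /map_of insubdK //; apply: res_faceP. Qed.

Definition face_le (x y : face) : bool :=
  (verts x \subset verts y) && (restrict (map_of y) (verts x) == map_of x).

Fact face_le_refl : reflexive face_le.
Proof. by move=> x; rewrite /face_le subxx map_of_restrict eqxx. Qed.

Fact face_le_anti : antisymmetric face_le.
Proof.
move=> x y /andP[/andP[xy /eqP xyr] /andP[yx _]].
have vxy : verts x = verts y by apply/eqP; rewrite eqEsubset xy.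
by apply: face_eq => //; rewrite -xyr vxy map_of_restrict.
Qed.

Fact face_le_trans : transitive face_le.
Proof.
move=> y x z /andP[xy /eqP xyr] /andP[yz /eqP yzr].
by rewrite /face_le (subset_trans xy yz) -xyr -yzr restrict_restrict /=.
Qed.

Fact face_display : Order.disp_t. Proof. exact: (Order.Disp tt tt). Qed.

HB.instance Definition _ := Order.Le_isPOrder.Build face_display face
  face_le_refl face_le_anti face_le_trans.

Fact face_le0x (x : face) : (empty_face <= x)%O.
Proof.
rewrite /Order.le /= /face_le sub0set /= /restrict.
case: (map_of x) => // h; case: ifP => // /ontoP/(_ ord0)[t].
by rewrite inE.
Qed.

HB.instance Definition _ := Order.hasBottom.Build face_display face face_le0x.

Lemma face_leE (x y : face) :
  (x <= y)%O = (verts x \subset verts y) && (restrict (map_of y) (verts x) == map_of x).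
Proof. by []. Qed.

Lemma face_vertexed : vertexed verts res_face.
Proof.
split=> [x y|y A]; last exact: verts_res.
rewrite face_leE; case: (boolP (_ \subset _)) => //= xy.
apply/eqP/eqP => [xyr|<-]; last by rewrite map_of_res // verts_res.
by apply: face_eq; rewrite ?verts_res ?map_of_res.
Qed.

Lemma card_verts_le (x : face) : (#|verts x| <= d)%N.
Proof. by have := max_card (mem (verts x)); rewrite card_ord. Qed.

Lemma card_verts_eq (x : face) : (#|verts x| == d) = (verts x == setT).
Proof. by rewrite eqEcard subsetT cardsT card_ord eqn_leq card_verts_le. Qed.

Lemma face_facet (x : face) : exists2 t : face, (x <= t)%O & #|verts t| = d.
Proof.
suff [o om ox] : exists2 o, omono o setT &
    restrict o (verts x) = map_of x.
  have vo := valid_restrict om (subsetT setT).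
  exists (exist _ (setT, restrict o setT) vo : face).
    by rewrite face_leE subsetT restrict_restrict ?subsetT // ox /=.
  by apply/eqP; rewrite card_verts_eq.
case E: (map_of x) => [h|]; last by exists None.
have /monoP hm := map_of_mono E.
(* The order-preserving extension takes the largest value at an earlier vertex of [x], and 0 if
   there is none. *)
pose M (t : 'I_d) := (\max_(s in verts x | (s <= t)%N) h s)%N.
have Mk t : (M t <= k)%N by apply/bigmax_leqP => s _; rewrite -ltnS.
pose f : {ffun 'I_d -> 'I_k.+1} := [ffun t => inord (M t)].
have fE t : f t = M t :> nat by rewrite ffunE inordK // ltnS.
have fh : {in verts x, f =1 h}.
  move=> t tx; apply: val_inj; rewrite /= fE; apply/eqP; rewrite eqn_leq.
  apply/andP; split; first by apply/bigmax_leqP => s /andP[sx st]; apply: hm.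
  by apply: (@leq_bigmax_cond _ (fun s => (s \in verts x) && (s <= t)%N)
    (fun s => h s : nat)); rewrite tx leqnn.
exists (Some f); last by rewrite (eq_restrict fh) -E map_of_restrict.
apply/monoP => s t _ _ st; rewrite !fE; apply/bigmax_leqP => q /andP[qx qs].
by apply: (@leq_bigmax_cond _ (fun s => (s \in verts x) && (s <= t)%N)
  (fun s => h s : nat)); rewrite qx (leq_trans qs).
Qed.
End Faces.

(** * Facet orders of the stars *)

Section FacetOrder.
Variables (d k : nat) (v : 'I_d).
Implicit Types (h f g : {ffun 'I_d -> 'I_k.+1}) (A : {set 'I_d}).
Implicit Types (x y t u : face d k).

Definition between (r s : nat) : bool := (v <= s <= r)%N || (r <= s <= v)%N.

Definition gap (m n : nat) : nat := (m - n) + (n - m).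

(* The facets at v are shelled by increasing total distance from f v; the
   minimal new vertices are those where f changes its value away from v. *)
Definition weight t : nat :=
  if map_of t is Some f then (\sum_s gap (f s) (f v)).+1 else 0.

(** For the basepoint facet the choice [[set v]] makes every face through [v] new: its weight is 0,
    so it comes first in any star that contains it. *)
Definition new_vertices t : {set 'I_d} :=
  if map_of t is Some f then
    [set r : 'I_d | [forall s : 'I_d, between r s && (s != r) ==> (f s != f r)]]
  else [set v].

(** Among the vertices between [v] and [i] that share the value of [i], the one nearest to [v] meets
    only other values on its way to [v]. *)
Lemma first_of_block t f (i : 'I_d) : map_of t = Some f ->
  exists2 r, r \in new_vertices t & between i r && (f r == f i).
Proof.
move=> tf; have ii : between i i && (f i == f i).
  by rewrite eqxx andbT /between; lia.
have [r /andP[ir fr] rmin] := @arg_minnP _ i (fun r => between i r && (f r == f i))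
  (fun r => gap r v) ii.
exists r; rewrite ?ir // /new_vertices tf inE; apply/forall_inP => s /andP[rs sr].
apply/negP => /eqP fs; have := rmin s; rewrite fs fr andbT.
have -> : between i s by move: ir rs; rewrite /between; lia.
move=> /(_ isT); rewrite /gap; move: rs sr; rewrite /between -val_eqE /=; lia.
Qed.

Lemma new_vertices_v t : v \in new_vertices t.
Proof.
rewrite /new_vertices; case: (map_of t) => [f|]; rewrite inE //.
by apply/forall_inP => s; rewrite /between -val_eqE /=; lia.
Qed.

Lemma new_vertices_onto t f A : map_of t = Some f -> new_vertices t \subset A ->
  onto f A.
Proof.
move=> tf /subsetP tA; apply/ontoP => i.
have /ontoP/(_ i)[s _ fs] := map_of_onto tf.
have [r rt /andP[_ /eqP fr]] := first_of_block s tf.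
by exists r; [apply: tA|rewrite fr].
Qed.

(** The values at the new vertices force every order-preserving competitor to be at least as far
    from its value at [v], at every vertex. So [t] is the unique lightest facet over a face [y] that
    contains them. *)
Lemma weight_min t u y : verts t = setT -> verts u = setT ->
  (y <= t)%O -> (y <= u)%O -> new_vertices t \subset verts y ->
  (weight u <= weight t)%N -> u = t.
Proof.
move=> tT uT; rewrite !face_leE => /andP[_ /eqP yt] /andP[_ /eqP yu] ny.
rewrite /weight; case Et: (map_of t) => [f|]; case Eu: (map_of u) => [g|] //; last first.
  by move=> _; apply: face_eq; rewrite ?tT ?Et.
  rewrite -yu Et Eu /= (new_vertices_onto Et) // in yt.
rewrite ltnS => wt.
have fo := new_vertices_onto Et ny.
have fg : {in verts y, f =1 g}.
  move: yt; rewrite -yu Et Eu /= fo; case: ifP => // _ [/ffunP E] s sy.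
  by have := E s; rewrite !ffunE sy.
have /monoP fm := map_of_mono Et; have /monoP gm := map_of_mono Eu.
have vy : v \in verts y by apply: (subsetP ny); apply: new_vertices_v.
have fgv := fg v vy.
(* The nearest vertex [r] of the block of [s] lies in [y], so [f] and [g] agree there; from [r] on
   to [s], [g] can only move further from its value at [v]. *)
have le_gap s : (gap (f s) (f v) <= gap (g s) (g v))%N.
  have [r rt /andP[rs /eqP fr]] := first_of_block s Et.
  have fgr := fg r (subsetP ny r rt).
  rewrite -fr fgr -fgv.
  have := gm r s; have := gm s r; have := gm v r; have := gm r v.
  rewrite uT !inE => /(_ isT isT) h1 /(_ isT isT) h2 /(_ isT isT) h3 /(_ isT isT) h4.
  by move: rs; rewrite /between /gap fgv; lia.
have eq_gap s : gap (f s) (f v) = gap (g s) (g v).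
  apply/eqP; rewrite eqn_leq le_gap /= leqNgt; apply/negP => lt_s.
  move: wt; rewrite leqNgt => /negP; apply.
  rewrite (bigD1 s) //= [X in (_ < X)%N](bigD1 s) //= -addSn leq_add //.
  by apply: leq_sum => q _; apply: le_gap.
apply: face_eq; first by rewrite tT.
rewrite Et Eu; congr Some; apply/ffunP => s; apply: val_inj => /=.
have := eq_gap s; have := fm s v; have := fm v s; have := gm s v; have := gm v s.
rewrite tT uT !inE => /(_ isT isT) h1 /(_ isT isT) h2 /(_ isT isT) h3 /(_ isT isT) h4.
by rewrite /gap -fgv; rewrite -fgv in h1 h2; lia.
Qed.

(** A new vertex [r] outside [y] may take the value of its neighbour [p] on the side of [v]: the map
    stays order-preserving, is unchanged on [y], and moves closer to its value at [v]. *)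
Lemma weight_drop t y r : verts t = setT -> (y <= t)%O -> v \in verts y ->
  r \in new_vertices t -> r \notin verts y ->
  exists u, [/\ verts u = setT, (y <= u)%O & (weight u < weight t)%N].
Proof.
move=> tT yt vy; rewrite /new_vertices.
case Et: (map_of t) => [f|]; last by rewrite inE => /eqP-> /negP.
rewrite inE => /forall_inP rnew ry.
have rv : r != v by apply: contraNneq ry => ->.
have [p rp pr] : exists2 p : 'I_d, between r p & gap p r = 1%N.
  have [rltv|vltr|/val_inj rE] := ltngtP r v; last by rewrite rE eqxx in rv.
    have rd : (r.+1 < d)%N by apply: leq_ltn_trans rltv (ltn_ord v).
    by exists (Ordinal rd); rewrite /between /gap /=; lia.
  have rd : (r.-1 < d)%N by have := ltn_ord r; lia.
  by exists (Ordinal rd); rewrite /between /gap /=; lia.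
have prN : p != r by apply: contra_eqN pr => /eqP ->; rewrite /gap; lia.
have fpr : f p != f r by apply: rnew; rewrite rp.
have /monoP fm := map_of_mono Et; rewrite tT in fm.
have {}fm (s q : 'I_d) : (s <= q)%N -> (f s <= f q)%N by apply: fm; rewrite inE.
pose f' : {ffun 'I_d -> 'I_k.+1} := [ffun s => if s == r then f p else f s].
have f'm : mono f' setT.
  apply/monoP => s q _ _ sq; rewrite !ffunE.
  have h1 := fm s q sq; have h2 := fm s p; have h3 := fm p q.
  case: (eqVneq s r) => [sE|]; case: (eqVneq q r) => [qE|]; rewrite // -val_eqE /= => ?.
    by apply: h3; move: pr sq; rewrite sE /gap; lia.
  by apply: h2; move: pr sq; rewrite qE /gap; lia.
(* If [f'] misses a value, [restrict] yields the basepoint facet, of weight 0. *)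
have vu : valid (setT, restrict (Some f') setT).
  by apply: (@valid_restrict d k (Some f') setT setT).
exists (exist _ (setT, restrict (Some f') setT) vu : face d k); split=> //.
  rewrite face_leE subsetT restrict_restrict ?subsetT // andTb.
  move: yt; rewrite face_leE => /andP[_ /eqP <-]; rewrite Et; apply/eqP.
  apply: eq_restrict => s sy; rewrite ffunE.
  by case: eqVneq => // sr; rewrite -sr sy in ry.
rewrite /weight Et /map_of /=; case: ifP => // _; rewrite ltnS.
rewrite (bigD1 r) //= [X in (_ < X)%N](bigD1 r) //= -addSn leq_add //.
  rewrite !ffunE !inE eqxx eq_sym (negPf rv).
  have h1 := fm r v; have h2 := fm v r; have h3 := fm p v; have h4 := fm v p.
  have h5 := fm r p; have h6 := fm p r.
  by move: fpr rp pr; rewrite -val_eqE /between /gap /=; lia.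
apply: leq_sum => q qr; rewrite !ffunE !inE (negPf qr) (eq_sym v) (negPf rv).
exact: leqnn.
Qed.

(** [weight_min] shows that faces containing the new vertices lie in no earlier facet, ties in
    weight included; [weight_drop] shows that all others do. *)
Lemma face_facet_order_at (s : face d k) : v \in verts s ->
  exists w, facet_order (@verts d k) d s w.
Proof.
move=> vs; pose star := [pred t | (s <= t)%O & #|verts t| == d].
pose w := sort (relpre weight leq) (enum star).
have wE : w =i star by move=> t; rewrite mem_sort mem_enum.
have w_uniq : uniq w by rewrite sort_uniq enum_uniq.
have w_sorted i j : (i < size w)%N -> (j < size w)%N -> (i <= j)%N ->
    (weight (nth \bot%O w i) <= weight (nth \bot%O w j))%N.
  move=> iw jw; apply: (@sorted_leq_nth _ (relpre weight leq)); rewrite ?inE //.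
  - by move=> a b c /=; apply: leq_trans.
  - by move=> a /=.
  - by apply: sort_sorted => a b; apply: leq_total.
exists w; split=> // j jw; set t := nth _ _ _.
have tw : t \in w by apply: mem_nth.
move: (tw); rewrite wE inE card_verts_eq => /andP[st /eqP tT].
exists (new_vertices t); first by rewrite tT subsetT.
move=> y sy yt; have vy : v \in verts y.
  by apply: (subsetP (vert_le (face_vertexed d k) sy)).
apply/hasP/idP => [[u utake yu]|/subsetPn[r rt ry]].
  have uw := mem_take utake.
  move: (uw); rewrite wE inE card_verts_eq => /andP[_ /eqP uT].
  have iw : (index u w < size w)%N by rewrite index_mem.
  have ij : (index u w < j)%N by rewrite -in_take.
  apply/negP => ny; have uE : u = t.
    apply: weight_min ny _ => //.
    by rewrite -[u](nth_index \bot%O uw); apply: w_sorted; rewrite // ltnW.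
  by move: ij; rewrite uE index_uniq // ltnn.
have [u [uT yu wu]] := weight_drop tT yt vy rt ry.
have uw : u \in w by rewrite wE inE card_verts_eq uT eqxx (le_trans sy yu).
exists u => //; rewrite in_take // ltnNge; apply/negP => ju.
have := w_sorted j (index u w) jw; rewrite index_mem => /(_ uw ju).
by rewrite nth_index // leqNgt wu.
Qed.
End FacetOrder.

Lemma face_facet_order d k (s : face d k) : s != \bot%O ->
  exists w, facet_order (@verts d k) d s w.
Proof.
rewrite -(vert_eq0 (face_vertexed d k)) => /set0Pn[v vs].
exact: face_facet_order_at vs.
Qed.

(** * Oriented chains of a poset of faces *)

Section PosetHomology.
Variables (K : fieldType) (disp : Order.disp_t) (P : finBPOrderType disp).
Variables (V : finType) (vert : P -> {set V}) (res : P -> {set V} -> P).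
Hypothesis Pv : vertexed vert res.
Variable key : V -> nat.
Hypothesis key_inj : injective key.
Implicit Types (r s t : P) (a u : V) (b c z : P -> K).

Definition covers s t : bool := (t <= s)%O && (#|vert s| == #|vert t|.+1).

Lemma covers_vert s t : covers s t ->
  exists a, [/\ a \notin vert t, vert s = a |: vert t & t = res s (vert s :\ a)].
Proof.
case/andP=> ts /eqP st.
have /set0Pn[a] : vert s :\: vert t != set0.
  by rewrite setD_eq0; apply/negP => /subset_leq_card; rewrite st ltnn.
rewrite inE => /andP[at_ as_]; exists a.
have sE : vert s = a |: vert t.
  apply/eqP; rewrite eq_sym eqEcard subUset sub1set as_ (vert_le Pv) //=.
  by rewrite cardsU1 at_ st.
by split=> //; rewrite sE setU1K // (res_vert Pv ts).
Qed.

(** For a cover the product has a single factor; this form avoids choosing the added vertex. *)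
Definition cover_sign s t : K :=
  \prod_(a in vert s :\: vert t) vertex_sign K key (vert t) a.

Lemma cover_signE s t a : a \notin vert t -> vert s = a |: vert t ->
  cover_sign s t = vertex_sign K key (vert t) a.
Proof.
move=> at_ sE; rewrite /cover_sign sE (big_pred1 a) // => u.
rewrite !inE; case: (eqVneq u a) => [->|_] /=; first by rewrite at_.
by case: (u \in vert t).
Qed.

Lemma cover_sign_sqr s t : cover_sign s t * cover_sign s t = 1.
Proof. by rewrite -big_split big1 // => a _; apply: vertex_sign_sqr. Qed.

Definition poset_boundary c t : K := \sum_(s | covers s t) cover_sign s t * c s.

Local Notation pbd := poset_boundary.

Lemma eq_poset_boundary c c' t :
  (forall s, #|vert s| = #|vert t|.+1 -> c s = c' s) -> pbd c t = pbd c' t.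
Proof. by move=> cc; apply: eq_bigr => s /andP[_ /eqP/cc ->]. Qed.

Lemma poset_boundaryB c c' t : pbd (fun s => c s - c' s) t = pbd c t - pbd c' t.
Proof. by rewrite /pbd -sumrB; apply: eq_bigr => s _; rewrite mulrBr. Qed.

Lemma poset_boundaryD c c' t : pbd (fun s => c s + c' s) t = pbd c t + pbd c' t.
Proof. by rewrite /pbd -big_split; apply: eq_bigr => s _; rewrite mulrDr. Qed.

Lemma poset_boundaryZ l c t : pbd (fun s => l * c s) t = l * pbd c t.
Proof. by rewrite /pbd mulr_sumr; apply: eq_bigr => s _; rewrite mulrCA. Qed.

(** An interval of length two has exactly two middle faces, and their products of signs are
    opposite. *)
Lemma poset_boundary2 c t : pbd (pbd c) t = 0.
Proof.
rewrite /pbd; under eq_bigr do rewrite mulr_sumr.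
rewrite (exchange_big_dep predT) //= big1 // => r _.
have [s0 /andP[st0 rs0]|none] := pickP (fun s => covers s t && covers r s); last first.
  by rewrite big_pred0.
have [a [at_ s0E _]] := covers_vert st0; have [e [es0 rE _]] := covers_vert rs0.
have st : (t <= s0)%O by case/andP: st0.
have sr : (s0 <= r)%O by case/andP: rs0.
move: es0; rewrite s0E !inE negb_or => /andP[ea et].
have rE' : vert r = e |: (a |: vert t) by rewrite rE s0E.
have ar : a |: vert t \subset vert r by rewrite rE' subsetUr.
have er : e |: vert t \subset vert r by rewrite rE' setUCA subsetUr.
pose s1 := res r (e |: vert t).
have s1E : vert s1 = e |: vert t by apply: (vert_res Pv).
have tr : (t <= r)%O := le_trans st sr.
have cov1 : covers s1 t && covers r s1.
  rewrite /covers (le_resP Pv) // subsetUr (res_le Pv) // s1E rE' !cardsU1 !inE.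
  by rewrite !negb_or ea et at_ !eqxx.
have s10 : s1 != s0.
  apply/eqP => /(congr1 vert); rewrite s1E s0E => /setP/(_ e).
  by rewrite !inE eqxx (negPf ea) (negPf et).
rewrite (bigD1 s0) ?st0 //= (bigD1 s1) /=; last by rewrite cov1.
rewrite big1 ?addr0 => [|s /andP[/andP[/andP[cst crs] ss0] ss1]].
  rewrite (cover_signE at_ s0E) (cover_signE et s1E).
  rewrite (cover_signE (a := e) _ rE) ?s0E ?inE ?negb_or ?ea //.
  rewrite (cover_signE (a := a) (t := s1)); first last.
  - by rewrite s1E rE' setUCA.
  - by rewrite s1E !inE negb_or eq_sym ea.
  rewrite s1E !mulrA -mulrDl vertex_sign_anti ?addNr ?mul0r //.
have [u [ut sE _]] := covers_vert cst.
have sr' : (s <= r)%O by case/andP: crs.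
have : u \in vert r by apply: (subsetP (vert_le Pv sr')); rewrite sE setU11.
rewrite rE' !inE (negPf ut) orbF => /orP[] /eqP uE.
  by case/negP: ss1; apply/eqP/(vert_inj Pv sr' (res_le Pv er)); rewrite sE uE s1E.
by case/negP: ss0; apply/eqP/(vert_inj Pv sr' sr); rewrite sE uE s0E.
Qed.

(** The order in which [poset_inc] sees the vertices. It depends on [s]: several atoms may lie over
    the same vertex, as happens for [k = 0]. *)
Let ord_at s a : nat := enum_rank (res s [set a]).

Lemma res1_inj s : {in vert s &, injective (fun a => res s [set a])}.
Proof.
move=> a u as_ us /(congr1 vert); rewrite !(vert_res Pv) ?sub1set //.
by apply: set1_inj.
Qed.

Lemma atoms_belowE s : atoms_below s = [set res s [set a] | a in vert s].
Proof.
apply/setP => t; rewrite inE /atom (rk_vert Pv).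
apply/andP/imsetP => [[/cards1P[a tE] ts]|[a as_ ->]].
  exists a; first by rewrite -sub1set -tE (vert_le Pv).
  by rewrite -tE (res_vert Pv).
by rewrite (vert_res Pv) ?sub1set // cards1 (res_le Pv) // sub1set.
Qed.

Lemma poset_incE s t a : a \notin vert t -> vert s = a |: vert t -> (t <= s)%O ->
  poset_inc K s t = (-1) ^+ #|[set u in vert t | (ord_at s u < ord_at s a)%N]|.
Proof.
move=> at_ sE ts; have as_ : a \in vert s by rewrite sE setU11.
have us u : u \in vert t -> u \in vert s by rewrite sE; apply: setU1r.
have resE u : u \in vert t -> res t [set u] = res s [set u].
  move=> ut; rewrite -{1}(res_vert Pv ts) (res_res Pv) ?sub1set //.
  exact: (vert_le Pv).
have tE : atoms_below t = atoms_below s :\ res s [set a].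
  rewrite !atoms_belowE; apply/setP => x; rewrite inE in_set1.
  apply/imsetP/andP => [[u ut ->]|[xa /imsetP[u usE xE]]].
    rewrite resE // imset_f ?us //; split=> //.
    apply: contraNneq at_ => /res1_inj <- //; exact: us.
  move: usE; rewrite sE => /setU1P[ua|ut]; first by rewrite xE ua eqxx in xa.
  by exists u; rewrite ?resE.
have aA : res s [set a] \in atoms_below s by rewrite atoms_belowE imset_f.
rewrite /poset_inc ts /simplex_inc (big_pred1 (res s [set a])) => [|x /=].
  congr (_ ^+ _); rewrite -(card_in_imset (f := fun u => res s [set u])); last first.
    by move=> u w; rewrite !inE => /andP[/us ? _] /andP[/us ? _]; apply: res1_inj.
  apply: eq_card => x; rewrite inE atoms_belowE.
  apply/andP/imsetP => [[/imsetP[u us' ->] lt_ua]|[u]].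
    exists u; rewrite // inE lt_ua andbT; move: us'; rewrite sE => /setU1P[ua|//].
    by rewrite ua ltnn in lt_ua.
  by rewrite inE => /andP[ut lt_ua] ->; rewrite imset_f ?us.
apply/andP/eqP => [[xA /eqP E]|->]; last by rewrite aA tE eqxx.
move/setP/(_ x): E; rewrite tE !inE eqxx /= => /negbT.
by move: xA; rewrite inE => ->; rewrite andbT negbK => /eqP.
Qed.

Definition inversions s : nat :=
  \sum_(p in vert s) \sum_(q in vert s)
    ((key p < key q)%N && (ord_at s q < ord_at s p)%N).

Definition orientation s : K := (-1) ^+ inversions s.

Lemma orientation_sqr s : orientation s * orientation s = 1.
Proof. by rewrite -expr2 sqrr_sign. Qed.

Lemma sum_bool_card (A : {set V}) (p : pred V) :
  #|[set u in A | p u]| = (\sum_(u in A) p u)%N.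
Proof.
rewrite -sum1_card [LHS](eq_bigl (fun u => (u \in A) && p u)) => [|u].
  by rewrite big_mkcondr; apply: eq_bigr => u _; case: (p u).
by rewrite inE.
Qed.

(* Conjugating by the sign of the permutation that sorts the vertices of s
   replaces the enumeration order of the atoms by the order key. *)
Lemma poset_inc_cover s t : covers s t ->
  poset_inc K s t = orientation t * (cover_sign s t * orientation s).
Proof.
move=> st; have [a [at_ sE _]] := covers_vert st; have /andP[ts _] := st.
rewrite (poset_incE at_ sE ts) (cover_signE at_ sE) /vertex_sign /orientation.
rewrite -!exprD -[LHS]signr_odd -[RHS]signr_odd !sum_bool_card.
have us u : u \in vert t -> u \in vert s by rewrite sE; apply: setU1r.
have as_ : a \in vert s by rewrite sE setU11.
have ordE u : u \in vert t -> ord_at t u = ord_at s u.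
  move=> ut; rewrite /ord_at -{1}(res_vert Pv ts) (res_res Pv) ?sub1set //.
  exact: (vert_le Pv).
have ord_neq u : u \in vert t -> ord_at s u != ord_at s a.
  move=> ut; apply: contraNneq at_ => /val_inj/enum_rank_inj/res1_inj.
  by move=> /(_ (us u ut) as_) <-.
pose X1 := (\sum_(q in vert t) ((key a < key q)%N && (ord_at s q < ord_at s a)%N))%N.
pose X2 := (\sum_(p in vert t) ((key p < key a)%N && (ord_at s a < ord_at s p)%N))%N.
have invE : inversions s = (X1 + (X2 + inversions t))%N.
  rewrite /inversions sE big_setU1 //= big_setU1 //= ltnn /= add0n; congr (_ + _)%N.
  rewrite -big_split; apply: eq_bigr => p pt; rewrite big_setU1 //=; congr (_ + _)%N.
  by apply: eq_bigr => q qt; rewrite !ordE.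
set Y := (\sum_(u in vert t) (ord_at s u < _))%N.
set Z := (\sum_(u in vert t) (key u < _))%N.
(* Each [u] contributes 0 or 2: it forms an inversion with [a] exactly when its two comparisons with
   [a] disagree. *)
have even : ~~ odd (X1 + X2 + (Y + Z)).
  rewrite -!big_split /=.
  rewrite (eq_bigr (fun u => 2 * ((key u < key a)%N || (ord_at s u < ord_at s a)%N)%N)%N).
    by rewrite -big_distrr oddM.
  move=> u ut; have uka : key u != key a by apply: contraNneq at_ => /key_inj <-.
  move: uka (ord_neq u ut); case: (ltngtP (key u)) => // _ _.
    by case: ltngtP.
  by case: ltngtP.
congr ((-1) ^+ nat_of_bool _); rewrite invE; move: even; rewrite !oddD.
by case: (odd X1); case: (odd X2); case: (odd Y); case: (odd Z); case: (odd (inversions t)).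
Qed.

Lemma cellular_boundary_poset (i : int) c t : cell_dim t = i - 1 ->
  cellular_boundary [set: P] (@cell_dim disp P) (poset_inc K) i c t =
  orientation t * pbd (fun s => orientation s * c s) t.
Proof.
rewrite /cell_dim (rk_vert Pv) => ti; rewrite /cellular_boundary /pbd mulr_sumr.
rewrite (bigID (fun s => (t <= s)%O)) /= [X in _ + X]big1 ?addr0; last first.
  by move=> s /andP[_ /negPf ts]; rewrite /poset_inc ts mul0r.
apply: eq_big => [s|s /andP[/andP[_ /eqP si] ts]].
  rewrite inE andbC /covers /cell_dim (rk_vert Pv) /=; congr (_ && _).
  by apply/eqP/eqP => sE; lia.
rewrite poset_inc_cover; first by rewrite !mulrA.
by rewrite /covers ts; move: si ti; rewrite /cell_dim (rk_vert Pv); lia.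
Qed.

Lemma poset_betti_eq0 m :
  (forall c, (forall t, #|vert t|.+1 = m -> pbd c t = 0) ->
    exists b, forall t, #|vert t| = m -> pbd b t = c t) ->
  poset_betti P K (m%:Z - 1) = 0%N.
Proof.
move=> exact_m; apply: betti_eq0 => c c_cycle.
have [t tm|b bP] := exact_m (fun s => orientation s * c s).
  have := c_cycle t (in_setT t); rewrite cellular_boundary_poset.
    rewrite /cell_dim (rk_vert Pv) => /(_ ltac:(lia))/(congr1 ( *%R (orientation t))).
    by rewrite mulrA orientation_sqr mul1r mulr0.
  by rewrite /cell_dim (rk_vert Pv); lia.
exists (fun s => orientation s * b s) => t _; rewrite /cell_dim (rk_vert Pv) => tm.
rewrite cellular_boundary_poset; last by rewrite /cell_dim (rk_vert Pv); lia.
rewrite (eq_poset_boundary (c' := b)) => [|s _]; last first.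
  by rewrite mulrA orientation_sqr mul1r.
by rewrite bP ?mulrA ?orientation_sqr ?mul1r //; lia.
Qed.

Lemma poset_betti_eq1 m z :
  (forall t, #|vert t|.+1 = m -> pbd z t = 0) ->
  (forall c, (forall t, #|vert t|.+1 = m -> pbd c t = 0) ->
    exists b l, forall t, #|vert t| = m -> pbd b t = c t - l * z t) ->
  (forall b, ~ forall t, #|vert t| = m -> pbd b t = z t) ->
  poset_betti P K (m%:Z - 1) = 1%N.
Proof.
have oK t x : orientation t * (orientation t * x) = x :> K.
  by rewrite mulrA orientation_sqr mul1r.
have dimE t : cell_dim t = #|vert t|%:Z - 1 by rewrite /cell_dim (rk_vert Pv).
have bdE i c t : #|vert t|%:Z = i ->
    cellular_boundary [set: P] (@cell_dim disp P) (poset_inc K) i c t =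
    orientation t * pbd (fun s => orientation s * c s) t.
  by move=> ti; rewrite cellular_boundary_poset // dimE ti.
move=> z_cycle gen_m z_nbd.
apply: (betti_eq1 (z := fun t => orientation t * z t)).
- move=> t _; rewrite dimE => tm; rewrite bdE; last by lia.
  rewrite (eq_poset_boundary (c' := z)) => [|s _]; last exact: oK.
  by rewrite z_cycle ?mulr0 //; lia.
- move=> c c_cycle; have [t tm|b [l bl]] := gen_m (fun s => orientation s * c s).
    have := c_cycle t (in_setT t); rewrite bdE ?dimE; last by lia.
    by move=> /(_ ltac:(lia))/(congr1 ( *%R (orientation t))); rewrite oK mulr0.
  exists (fun s => orientation s * b s), l => t _; rewrite dimE => tm.
  rewrite bdE; last by lia.
  rewrite (eq_poset_boundary (c' := b)) => [|s _]; last exact: oK.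
  by rewrite bl; [rewrite mulrBr oK mulrCA|lia].
- move=> b bz; apply: (z_nbd (fun s => orientation s * b s)) => t tm.
  have := bz t (in_setT t); rewrite bdE ?dimE; last by lia.
  by move=> /(_ ltac:(lia))/(congr1 ( *%R (orientation t))); rewrite !oK.
move=> b t _; rewrite dimE => tm; rewrite bdE; last by lia.
rewrite (eq_poset_boundary (c' := pbd (fun s => orientation s * b s))).
  by rewrite poset_boundary2 mulr0.
by move=> s st; rewrite bdE ?oK //; lia.
Qed.

End PosetHomology.

(** * Homology of the poset of faces *)

Section Matching.
Variables (K : fieldType) (disp : Order.disp_t) (P : finBPOrderType disp).
Variables (V : finType) (vert : P -> {set V}) (res : P -> {set V} -> P).
Hypothesis Pv : vertexed vert res.
Variable key : V -> nat.
Hypothesis key_inj : injective key.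

Local Notation pbd := (poset_boundary (K := K) vert key).
Local Notation cov := (covers vert).

(* A discrete Morse matching of L with up @: L. *)
Lemma matching_step m (B A L A' : {set P}) (up : P -> P) (c : P -> K) :
  (forall s t, t \in B -> cov s t -> s \in B) -> A \subset B -> L \subset A ->
  {in L &, injective up} ->
  (forall y, y \in L -> [/\ up y \in A, up y \notin L & cov (up y) y]) ->
  (forall y z, y \in L -> z \in A -> z \notin L -> cov z y -> z = up y) ->
  (forall y x, y \in L -> x \in B -> cov (up y) x -> x \in A) ->
  (forall x, x \in A -> x \notin L -> x \notin A' -> exists2 y, y \in L & x = up y) ->
  (forall x, x \in B -> #|vert x| = m -> x \notin A -> c x = 0) ->
  (forall x, x \in B -> #|vert x|.+1 = m -> pbd c x = 0) ->
  exists b, (forall x, x \in B -> #|vert x| = m -> x \notin A' -> c x - pbd b x = 0) /\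
    (forall x, x \in B -> #|vert x|.+1 = m -> pbd (fun y => c y - pbd b y) x = 0).
Proof.
move=> Bup /subsetP AB /subsetP LA up_inj upP upE upA A'P cA c_cycle.
(* Supported on the partners and chosen to cancel [c] on [L]: over a given [y] in [L] only [up y]
   contributes. *)
pose b z := \sum_(y in L | up y == z) cover_sign K vert key z y * c y.
have b_up y : y \in L -> b (up y) = cover_sign K vert key (up y) y * c y.
  move=> yL; rewrite /b (big_pred1 y) // => x; rewrite /= andbC.
  by apply/andP/eqP => [[/eqP xy xL]|->]; [apply: up_inj|].
have b_supp z : (forall y, y \in L -> z = up y -> False) -> b z = 0.
  move=> zN; rewrite /b big_pred0 // => y; apply/negP => /andP[yL /eqP yz].
  exact: (zN y).
have cycle' x : x \in B -> #|vert x|.+1 = m -> pbd (fun y => c y - pbd b y) x = 0.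
  by move=> xB xm; rewrite poset_boundaryB (poset_boundary2 Pv key_inj) subr0 c_cycle.
have offA x : x \in B -> #|vert x| = m -> x \notin A -> c x - pbd b x = 0.
  move=> xB xm xA; rewrite cA // sub0r /poset_boundary big1 ?oppr0 // => z zx.
  rewrite b_supp ?mulr0 // => y yL zE; case/negP: xA.
  by apply: (upA y); rewrite -?zE.
have onL x : x \in L -> c x - pbd b x = 0.
  move=> xL; have [_ _ ux] := upP x xL.
  rewrite /poset_boundary (bigD1 (up x)) //= b_up // big1 ?addr0 => [|z /andP[zx zux]].
    by rewrite mulrA cover_sign_sqr mul1r subrr.
  rewrite b_supp ?mulr0 // => y yL zE; case/eqP: zux.
  by apply: upE => //; rewrite zE; have [] := upP y yL.
exists b; split=> // x xB xm xA'.
have [xA|] := boolP (x \in A); last exact: offA.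
have [xL|xL] := boolP (x \in L); first exact: onL.
(* In the cycle relation at [y], every cover other than [x = up y] lies in [L] or outside [A], where
   the corrected chain already vanishes; so it vanishes at [x]. *)
have [y yL xE] := A'P x xA xL xA'; have [_ _ uy] := upP y yL.
have yB := AB y (LA y yL).
have ym : #|vert y|.+1 = m by move: uy; rewrite -xE => /andP[_ /eqP <-].
have := cycle' y yB ym; rewrite {1}/poset_boundary (bigD1 (up y)) //= -xE.
rewrite big1 ?addr0 => [/(congr1 ( *%R (cover_sign K vert key x y)))|z /andP[zy zx]].
  by rewrite mulrA cover_sign_sqr mul1r mulr0.
have zB := Bup z y yB zy.
have zm : #|vert z| = m by case/andP: zy => _ /eqP ->.
have [zA|zA] := boolP (z \in A); last by rewrite offA ?mulr0.
have [zL|zL] := boolP (z \in L); first by rewrite onL ?mulr0.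
by rewrite (upE y z) // -xE eqxx in zx.
Qed.
End Matching.

(** * Matchings on the faces that carry an onto map *)

Section FaceHomology.
Variables (K : fieldType) (d k : nat).
Hypothesis k_lt_d : (k < d)%N.
Implicit Types (x y z : face d k) (f g h : {ffun 'I_d -> 'I_k.+1}) (A : {set 'I_d}).

Local Notation Fv := (face_vertexed d k).
Local Notation vert := (@verts d k).
Let key (i : 'I_d) : nat := i.
Let key_inj : injective key. Proof. exact: val_inj. Qed.
Local Notation pbd := (poset_boundary (K := K) vert key).
Local Notation cov := (covers vert).

Lemma onto_card h A : onto h A -> (k < #|A|)%N.
Proof.
move=> /ontoP hA; rewrite -[X in (X <= _)%N](card_ord k.+1) -cardsT.
apply: leq_trans (leq_imset_card h A); apply/subset_leq_card/subsetP => i _.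
by have [t tA <-] := hA i; apply: imset_f.
Qed.

Lemma map_of_out x h s : map_of x = Some h -> s \notin verts x -> h s = ord0.
Proof.
move=> xh sx; have := map_of_restrict x; rewrite xh /=; case: ifP => // _ [/ffunP/(_ s)].
by rewrite ffunE (negPf sx).
Qed.

Lemma map_of_le x y g : (x <= y)%O -> map_of x = Some g ->
  exists h, [/\ map_of y = Some h, onto h (verts x) & {in verts x, g =1 h}].
Proof.
rewrite face_leE => /andP[xy /eqP]; case: (map_of y) => [h|] /= <- //.
case: ifP => // hx [<-]; exists h; split=> // s sx.
by rewrite ffunE sx.
Qed.

Lemma face_some_eq x y g h : verts x = verts y -> map_of x = Some g ->
  map_of y = Some h -> {in verts x, g =1 h} -> x = y.
Proof.
move=> xy xg yh gh; apply: face_eq => //; rewrite xg yh; congr Some.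
apply/ffunP => s; have [/gh //|sx] := boolP (s \in verts x).
by rewrite (map_of_out xg) // (map_of_out yh) // -xy.
Qed.

Definition add_vertex (t : 'I_d) (i : 'I_k.+1) y : face d k :=
  insubd y (t |: verts y,
    if map_of y is Some h then Some [ffun s => if s == t then i else h s] else None).

(** The faces left after [j] matchings: each of the [j] largest values is taken once, at the
    corresponding one of the [j] last vertices. The shift [d - k.+1] carries the [k.+1] values to
    the last [k.+1] vertices. *)
Definition top_singletons (j : nat) : {set face d k} :=
  [set x | if map_of x is Some h then
     [forall s in verts x, (k < h s + j)%N || (d <= s + j)%N ==>
        (nat_of_ord s == h s + (d - k.+1))%N] else false].

Local Notation E := top_singletons.

Lemma top_singletonsP j x :
  reflect (exists2 h, map_of x = Some h & forall s, s \in verts x ->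
             (k < h s + j)%N || (d <= s + j)%N -> s = (h s + (d - k.+1))%N :> nat)
    (x \in E j).
Proof.
rewrite inE; case: (map_of x) => [h|]; last by right; case.
apply: (iffP forall_inP) => [hx|[_ [<-]] hx s sx].
  by exists h => // s sx; move/(_ s sx)/implyP: hx => hs /hs/eqP.
by apply/implyP => /(hx s sx) ->.
Qed.

Lemma top_singletons_le j x y : (x <= y)%O -> map_of x != None -> y \in E j -> x \in E j.
Proof.
move=> xy; case Ex: (map_of x) => [g|//] _ /top_singletonsP[h yh hy].
have [h' [yh' _ gh]] := map_of_le xy Ex.
have {yh'}[hE] : Some h' = Some h by rewrite -yh' -yh.
rewrite {h'}hE in gh.
apply/top_singletonsP; exists g => // s sx; rewrite gh //; apply: hy.
by apply: (subsetP (vert_le Fv xy)).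
Qed.

Section Step.
Variable j : nat.
Hypothesis j_le_k : (j <= k)%N.

Let t_lt_d : (d - j.+1 < d)%N. Proof. by lia. Qed.
(** The last vertex not yet reserved, to be matched with [i], the largest value not yet reserved;
    [t = i + (d - k.+1)]. *)
Let t : 'I_d := Ordinal t_lt_d.
Let i_lt_k : (k - j < k.+1)%N. Proof. by lia. Qed.
Let i : 'I_k.+1 := Ordinal i_lt_k.
Let L : {set face d k} := [set y in E j | t \notin verts y].

(** On [L] the default of [insubd] never occurs: vertices beyond [t] carry reserved values above
    [i], earlier ones values at most [i], so the extension is order-preserving. *)
Let up_some y h : y \in L -> map_of y = Some h ->
  verts (add_vertex t i y) = t |: verts y /\
  map_of (add_vertex t i y) = Some [ffun s => if s == t then i else h s].
Proof.
rewrite inE => /andP[/top_singletonsP[h' yh' hy] ty] yh.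
have {h' yh'}hy : forall s, s \in verts y ->
    (k < h s + j)%N || (d <= s + j)%N -> s = (h s + (d - k.+1))%N :> nat.
  by have [<-] : Some h' = Some h by rewrite -yh' -yh.
pose h' : {ffun 'I_d -> 'I_k.+1} := [ffun s => if s == t then i else h s].
have hh' : {in verts y, h' =1 h}.
  by move=> s sy; rewrite ffunE; case: eqVneq => // st; rewrite -st sy in ty.
have v' : valid (t |: verts y, Some h').
  rewrite /valid /= (onto_sub (subsetUr _ _) (A := verts y)); last first.
    by rewrite (eq_onto hh') (map_of_onto yh).
  apply/andP; split; last first.
    apply/eqP; congr Some; apply/ffunP => s; rewrite !ffunE !inE.
    case: eqVneq => //= _; case: ifP => // /negbT sy.
    by rewrite (map_of_out yh sy).
  have /monoP hm := map_of_mono yh.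
  apply/monoP => s q; rewrite !inE !ffunE.
  case: (eqVneq s t) => [->|st]; case: (eqVneq q t) => [->|qt] //= sy qy sq.
  - have := hy q qy; have : (q : nat) != t by rewrite val_eqE.
    by move: sq; rewrite /=; lia.
  - have := hy s sy; have : (s : nat) != t by rewrite val_eqE.
    by move: sq; rewrite /=; lia.
  - exact: hm.
by rewrite /verts /map_of /add_vertex yh insubdK.
Qed.

Let L_some y : y \in L -> exists h, map_of y = Some h.
Proof. by rewrite inE => /andP[/top_singletonsP[h yh _] _]; exists h. Qed.

Let up_covers y : y \in L -> cov (add_vertex t i y) y.
Proof.
move=> yL; have [h yh] := L_some yL; have [uv um] := up_some yL yh.
have ty : t \notin verts y by move: yL; rewrite inE => /andP[].
rewrite /covers uv cardsU1 ty eqxx andbT face_leE uv subsetUr um.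
rewrite (_ : restrict _ _ = restrict (Some h) (verts y)).
  by rewrite -yh map_of_restrict /=.
apply: eq_restrict => s sy; rewrite ffunE; case: eqVneq => // st.
by rewrite -st sy in ty.
Qed.

(* t lies above all blocks that are not yet singletons, so an order-preserving
   map can only take the value i at t. *)
Let value_at_t x A h : x \in E j -> map_of x = Some h -> t \in verts x ->
  A \subset verts x :\ t -> onto h A -> h t = i.
Proof.
move=> /top_singletonsP[h' xh' hx] xh tx.
have {xh'}[hE] : Some h' = Some h by rewrite -xh' -xh.
rewrite {h'}hE in hx.
rewrite subsetD1 => /andP[/subsetP Ax tA] /ontoP/(_ i)[s sA hs].
have /monoP/(_ s t (Ax s sA) tx) := map_of_mono xh.
have := hx t tx; have := hx s (Ax s sA); rewrite hs /=.
have : (s : nat) != t by rewrite val_eqE; apply: contraNneq tA => <-.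
by move=> st h1 h2 h3; apply: val_inj => /=; move: st h1 h2 h3; rewrite /=; lia.
Qed.

Let up_unique y z : y \in L -> z \in E j -> z \notin L -> cov z y ->
  z = add_vertex t i y.
Proof.
move=> yL zE zL zy; have [h yh] := L_some yL; have [uv um] := up_some yL yh.
have ty : t \notin verts y by move: yL; rewrite inE => /andP[].
have tz : t \in verts z by move: zL; rewrite inE zE negbK.
have [a [ay zv _]] := covers_vert Fv zy; have /andP[yz _] := zy.
have ta : t = a by move: tz; rewrite zv !inE (negPf ty) orbF => /eqP.
have [g [zg gy hg]] := map_of_le yz yh.
have gt : g t = i.
  by apply: (value_at_t zE zg tz) gy; rewrite subsetD1 ty (vert_le Fv).
apply: (face_some_eq _ zg um); first by rewrite uv zv -ta.
move=> s; rewrite zv -ta ffunE !inE; case: eqVneq => [->//|_] /= sy.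
by rewrite hg.
Qed.

Let up_in y : y \in L -> add_vertex t i y \in E j.
Proof.
move=> yL; have [h yh] := L_some yL; have [uv um] := up_some yL yh.
apply/top_singletonsP; eexists; first exact: um.
move: yL; rewrite inE => /andP[/top_singletonsP[h' yh' hy] ty].
have {yh'}[hE] : Some h' = Some h by rewrite -yh' -yh.
rewrite {h'}hE in hy.
move=> s; rewrite uv ffunE !inE; case: eqVneq => [->|_] /= sy; last exact: hy.
by lia.
Qed.

(** If [t] alone had value [i], then [x] would be in [E j.+1]. So some other vertex has value [i],
    monotonicity gives [t] the same value, and deleting [t] leaves the map onto. *)
Let up_onto x : x \in E j -> x \notin L -> x \notin E j.+1 ->
  exists2 y, y \in L & x = add_vertex t i y.
Proof.
move=> xE xL xE'; have /top_singletonsP[h xh hx] := xE.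
have tx : t \in verts x by move: xL; rewrite inE xE negbK.
have /monoP hm := map_of_mono xh; have /ontoP ho := map_of_onto xh.
have [q qx hq] := ho i.
have ht : (h t <= k - j)%N.
  by rewrite leqNgt; apply/negP => lt_h; have := hx t tx; rewrite /=; lia.
have onto_t : onto h (verts x :\ t).
  have [s [sx hs st]] : exists s, [/\ s \in verts x, h s = i & s != t].
    case: (eqVneq q t) => [qt|]; last by exists q.
    have [s /andP[sx /andP[hs st]]|none] := pickP [pred s in verts x | (h s == i) && (s != t)].
      by exists s; rewrite sx (eqP hs).
    case/negP: xE'; apply/top_singletonsP; exists h => // s sx s_top.
    have [old|] := boolP ((k < h s + j)%N || (d <= s + j)%N); first exact: hx.
    rewrite negb_or -!leqNgt -ltnNge => /andP[h1 h2].
    have := none s; rewrite /= sx /= => /negbT; rewrite negb_and negbK => /orP[his|/eqP ->].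
      have {}his : (h s : nat) != (k - j)%N by [].
      have sE : (s : nat) = t by move: s_top h1 h2 his; rewrite /=; lia.
      by move: his; rewrite (val_inj sE) -qt hq eqxx.
    by rewrite -qt hq qt /=; lia.
  apply/ontoP => l; have [r rx hr] := ho l.
  have [rt|rt] := eqVneq r t; last by exists r; rewrite // !inE rt.
  have [hti|hti] := eqVneq (h t) i.
    by exists s; rewrite ?inE ?st // -hr rt hti.
  exfalso; have {}hti : (h t : nat) != (k - j)%N by [].
  have s_t : (s : nat) != t by rewrite val_eqE.
  have := hx s sx; have := hm s t sx tx; rewrite hs /=.
  by move: hti ht s_t => /=; lia.
have sub : verts x :\ t \subset verts x by apply: subsetDl.
have yx := res_le Fv sub; set y := res_face _ _ in yx.
have yv : verts y = verts x :\ t by apply: (vert_res Fv).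
have yh : map_of y = Some (cut h (verts x :\ t)) by rewrite map_of_res // xh /= onto_t.
have yL : y \in L.
  by rewrite inE (top_singletons_le yx) ?yh // yv !inE eqxx.
exists y => //; apply: up_unique => //.
by rewrite /covers yx yv [X in X == _](cardsD1 t) tx add1n eqxx.
Qed.

Lemma top_singletons_step m c :
  (forall x, map_of x != None -> #|verts x| = m -> x \notin E j -> c x = 0) ->
  (forall x, map_of x != None -> #|verts x|.+1 = m -> pbd c x = 0) ->
  exists b,
    (forall x, map_of x != None -> #|verts x| = m -> x \notin E j.+1 -> c x - pbd b x = 0) /\
    (forall x, map_of x != None -> #|verts x|.+1 = m -> pbd (fun y => c y - pbd b y) x = 0).
Proof.
move=> cE c_cycle.
have BP x : (x \in [set x | map_of x != None]) = (map_of x != None) by rewrite inE.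
have [||||||||||b [b1 b2]] := @matching_step K _ _ _ _ _ Fv key key_inj m
    [set x | map_of x != None] (E j) L (E j.+1) (add_vertex t i) c.
- move=> s y; rewrite !inE; case Ey: (map_of y) => [h|//] _ /andP[ys _].
  by have [g [-> _ _]] := map_of_le ys Ey.
- by apply/subsetP => x /top_singletonsP[h xh _]; rewrite inE xh.
- by apply/subsetP => x; rewrite inE => /andP[].
- move=> y y' yL y'L uE; have := up_covers yL; have := up_covers y'L.
  rewrite uE => /andP[le' _] /andP[le _].
  apply: (vert_inj Fv le le').
  have [h yh] := L_some yL; have [h' yh'] := L_some y'L.
  have [uv _] := up_some yL yh; have [uv' _] := up_some y'L yh'.
  have ty : t \notin verts y by move: yL; rewrite inE => /andP[].
  have ty' : t \notin verts y' by move: y'L; rewrite inE => /andP[].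
  by rewrite -(setU1K ty) -(setU1K ty') -uv -uv' uE.
- move=> y yL; have [h yh] := L_some yL; have [uv um] := up_some yL yh.
  split; [exact: up_in|by rewrite inE uv setU11 andbF|exact: up_covers].
- exact: up_unique.
- move=> y x yL; rewrite BP => xB /andP[xu _]; exact: top_singletons_le xu xB (up_in yL).
- exact: up_onto.
- by move=> x; rewrite BP; apply: cE.
- by move=> x; rewrite BP; apply: c_cycle.
by exists b; split=> x xB; [apply: b1|apply: b2]; rewrite BP.
Qed.
End Step.
End FaceHomology.

(** For values of an order-preserving map: [e] and [a] share the value [n], and [w], having another
    value, lies on the same side of both. *)
Lemma same_side (m n w e a : nat) : m != n -> w != a -> w != e ->
  ((w <= e)%N -> (m <= n)%N) -> ((e <= w)%N -> (n <= m)%N) ->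
  ((w <= a)%N -> (m <= n)%N) -> ((a <= w)%N -> (n <= m)%N) ->
  (w < e)%N = (w < a)%N.
Proof. by lia. Qed.

(** * The fundamental k-cycle and the Betti numbers *)

Section FaceBetti.
Variables (K : fieldType) (d k : nat).
Hypothesis k_lt_d : (k < d)%N.
Implicit Types (x y z : face d k) (f g h : {ffun 'I_d -> 'I_k.+1}) (A : {set 'I_d}).

Local Notation Fv := (face_vertexed d k).
Local Notation vert := (@verts d k).
Let key (i : 'I_d) : nat := i.
Let key_inj : injective key. Proof. exact: val_inj. Qed.
Local Notation pbd := (poset_boundary (K := K) vert key).
Local Notation cov := (covers vert).
Local Notation E := (@top_singletons d k).

Lemma top_singletons_reduce j m (c : face d k -> K) : (j <= k.+1)%N ->
  (forall x, map_of x != None -> #|verts x|.+1 = m -> pbd c x = 0) ->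
  exists b,
    (forall x, map_of x != None -> #|verts x| = m -> x \notin E j -> c x - pbd b x = 0) /\
    (forall x, map_of x != None -> #|verts x|.+1 = m -> pbd (fun y => c y - pbd b y) x = 0).
Proof.
elim: j => [_|j IHj jk] c_cycle.
  have pbd0 x : pbd (fun=> 0) x = 0 by rewrite /poset_boundary big1 // => z; rewrite mulr0.
  exists (fun=> 0); split=> x xs xm; last first.
    rewrite -[RHS](c_cycle x xs xm); apply: eq_poset_boundary => y _.
    by rewrite pbd0 subr0.
  case/top_singletonsP; case Ex: (map_of x) xs => [h|//] _.
  by exists h => // s _; have := ltn_ord s; have := ltn_ord (h s); lia.
have [b1 [b1s b1c]] := IHj (ltnW jk) c_cycle.
have [b2 [b2s b2c]] := top_singletons_step k_lt_d jk b1s b1c.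
have bE x : c x - pbd (fun y => b1 y + b2 y) x = c x - pbd b1 x - pbd b2 x.
  by rewrite poset_boundaryD opprD addrA.
exists (fun y => b1 y + b2 y); split=> x xs xm; first by rewrite bE; apply: b2s.
by rewrite -[RHS](b2c x xs xm); apply: eq_poset_boundary => y _; apply: bE.
Qed.

Let last_block : {set 'I_d} := [set s : 'I_d | d - k.+1 <= s]%N.
Let last_map : {ffun 'I_d -> 'I_k.+1} :=
  [ffun s : 'I_d => if s \in last_block then inord (s - (d - k.+1)) else ord0].

Let last_mapE (s : 'I_d) : last_map s = (s - (d - k.+1))%N :> nat.
Proof.
rewrite ffunE inE; case: leqP => sd /=; last by lia.
by rewrite inordK //; have := ltn_ord s; lia.
Qed.

Let last_onto : onto last_map last_block.
Proof.
apply/ontoP => i; have ltd : (i + (d - k.+1) < d)%N by have := ltn_ord i; lia.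
exists (Ordinal ltd); first by rewrite inE /=; lia.
by apply: val_inj; rewrite /= last_mapE /=; lia.
Qed.

Let crit_valid : valid (last_block, Some last_map).
Proof.
rewrite /valid /= last_onto; apply/andP; split.
  by apply/monoP => s t _ _ st; rewrite !last_mapE leq_sub2r.
apply/eqP; congr Some; apply/ffunP => s; rewrite [LHS]ffunE.
by case: ifP => // /negbT sl; rewrite ffunE (negPf sl).
Qed.

Let crit : face d k := exist _ (last_block, Some last_map) crit_valid.
Let crit_star_valid : valid (last_block, None : option {ffun 'I_d -> 'I_k.+1}).
Proof. by []. Qed.
Let crit_star : face d k := exist _ (last_block, None) crit_star_valid.

Let card_last : #|last_block| = k.+1.
Proof.
apply/eqP; rewrite eqn_leq (onto_card last_onto) andbT.
rewrite -[k.+1]card_ord -(card_in_imset (f := last_map)) ?max_card //.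
move=> s t; rewrite !inE => sl tl /(congr1 (@nat_of_ord _)); rewrite !last_mapE => st.
by apply: val_inj => /=; lia.
Qed.

Let top_singletons_crit x : (x \in E k.+1) -> x = crit.
Proof.
case/top_singletonsP => h xh hx.
have hE s : s \in verts x -> s = (h s + (d - k.+1))%N :> nat.
  by move=> sx; apply: hx => //; rewrite addnS ltnS leq_addl.
apply: (face_some_eq _ xh (erefl : map_of crit = Some last_map)) => [|s sx]; last first.
  by apply: val_inj; rewrite /= last_mapE [X in (X - _)%N]hE // addnK.
apply/setP => s; rewrite [RHS]inE; apply/idP/idP => [/hE ->|sl]; first exact: leq_addl.
have lt_k : (s - (d - k.+1) < k.+1)%N by have := ltn_ord s; lia.
have /ontoP/(_ (Ordinal lt_k))[t tx ht] := map_of_onto xh.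
suff -> : s = t by [].
by apply: val_inj => /=; rewrite (hE t tx) ht /= subnK.
Qed.

(* The difference of the two faces with vertex set last_block, a k-sphere. *)
Let sphere x : K := (x == crit)%:R - (x == crit_star)%:R.

(** With fewer than [k.+1] vertices no map is onto, so [crit] and [crit_star] have the same
    boundary. *)
Let sphere_cycle x : pbd sphere x = 0.
Proof.
have covE : cov crit x = cov crit_star x.
  have c1 : #|verts crit| = k.+1 := card_last.
  have c2 : #|verts crit_star| = k.+1 := card_last.
  rewrite /covers !face_leE c1 ?c2; case: (eqVneq k.+1 #|verts x|.+1) => [kx|]; last by rewrite !andbF.
  congr ((_ && (_ == _)) && _); rewrite /restrict /=.
  by case: ifP => // /onto_card; rewrite -ltnS -kx ltnn.
rewrite poset_boundaryB /poset_boundary.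
have pick_sum y : \sum_(s | cov s x) cover_sign K vert key s x * (s == y)%:R =
    if cov y x then cover_sign K vert key y x else 0.
  case: ifP => yx; last first.
    rewrite big1 // => s sx; case: eqVneq => [sy|]; last by rewrite mulr0.
    by rewrite -sy sx in yx.
  rewrite (bigD1 y) //= eqxx mulr1 big1 ?addr0 // => s /andP[_ /negPf ->].
  by rewrite mulr0.
by rewrite !pick_sum covE; case: ifP; rewrite ?subrr.
Qed.

(** The cycle lies in the full simplex of basepoint faces, which is matched completely by adding
    vertex 0. *)
Let star_step m (c : face d k -> K) :
  (forall x, map_of x != None -> #|verts x| = m -> c x = 0) ->
  (forall x, #|verts x|.+1 = m -> pbd c x = 0) ->
  exists b, forall x, #|verts x| = m -> c x - pbd b x = 0.
Proof.
move=> cs c_cycle; have d_gt0 : (0 < d)%N by lia.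
pose t : 'I_d := Ordinal d_gt0.
pose S : {set face d k} := [set x | map_of x == None].
pose L : {set face d k} := [set x in S | t \notin verts x].
pose up x : face d k := exist _ (t |: verts x, None) isT.
have up_eq y x : map_of x = None -> verts x = t |: verts y -> x = up y.
  by move=> xs xv; apply: face_eq.
have upS y : up y \in S by rewrite inE.
have up_cov y : y \in L -> cov (up y) y.
  rewrite !inE => /andP[/eqP ys ty]; rewrite /covers /= [#|_ |: _|]cardsU1 ty eqxx andbT.
  by rewrite face_leE ys subsetUr.
have S_le x y : (x <= y)%O -> y \in S -> x \in S.
  by rewrite !inE face_leE => /andP[_ /eqP <-] /eqP ->.
have [||||||||||b [bP _]] := @matching_step K _ _ _ _ _ Fv key key_inj m
    setT S L set0 up c.
- by [].
- exact: subsetT.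
- by apply/subsetP => x; rewrite inE => /andP[].
- move=> x y; rewrite !inE => /andP[/eqP xs tx] /andP[/eqP ys ty].
  move=> /(congr1 vert) uE; apply: face_eq; last by rewrite xs ys.
  by rewrite -(setU1K tx) -(setU1K ty); congr (_ :\ t).
- by move=> y yL; split; [|rewrite inE setU11 andbF|apply: up_cov].
- move=> y z yL; rewrite !inE => /eqP zs; rewrite zs /= negbK => tz zy.
  have [a [ay zv _]] := covers_vert Fv zy.
  have ty : t \notin verts y by move: yL; rewrite inE => /andP[].
  apply: up_eq => //; rewrite zv; congr (_ |: _).
  by move: tz; rewrite zv !inE (negPf ty) orbF => /eqP.
- by move=> y x yL _ /andP[xu _]; apply: S_le xu (upS y).
- move=> x xS xL _; have tx : t \in verts x by move: xL; rewrite inE xS negbK.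
  have sub : verts x :\ t \subset verts x by apply: subsetDl.
  exists (res_face x (verts x :\ t)).
    by rewrite inE (S_le _ x) ?(res_le Fv) //= verts_res // !inE eqxx.
  apply: up_eq; first by move: xS; rewrite inE => /eqP.
  by rewrite verts_res // setD1K.
- by move=> x _ xm; rewrite inE => xs; apply: cs.
- by move=> x _; apply: c_cycle.
by exists b => x xm; apply: bP; rewrite ?inE.
Qed.

(** [m] is arbitrary: [sphere] lives on faces with [k.+1] vertices, so this gives exactness in every
    other degree and a generator in degree [k]. *)
Lemma face_cycle m (c : face d k -> K) :
  (forall x, #|verts x|.+1 = m -> pbd c x = 0) ->
  exists b l, forall x, #|verts x| = m -> pbd b x = c x - l * sphere x.
Proof.
move=> c_cycle.
have [|b1 [b1s _]] := @top_singletons_reduce k.+1 m c (leqnn _).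
  by move=> x _; apply: c_cycle.
(* After reduction [crit] is the only face with a map that may carry a coefficient; subtracting [l]
   times [sphere] moves it to [crit_star], inside the simplex. *)
pose l := c crit - pbd b1 crit.
pose c2 x := c x - pbd b1 x - l * sphere x.
have crit_star_s x : map_of x != None -> x != crit_star by apply: contraNneq => ->.
have [x xs xm|x xm|b2 b2P] := @star_step m c2.
- rewrite /c2 /sphere (negPf (crit_star_s x xs)) subr0.
  have [->|xc] := eqVneq x crit; first by rewrite mulr1 subrr.
  rewrite mulr0 subr0 b1s //; apply: contra xc => /top_singletons_crit ->.
  by [].
- rewrite !poset_boundaryB poset_boundaryZ sphere_cycle mulr0 subr0.
  by rewrite c_cycle // (poset_boundary2 Fv key_inj) subr0.
exists (fun x => b1 x + b2 x), l => x xm; rewrite poset_boundaryD.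
have /eqP := b2P x xm; rewrite subr_eq0 => /eqP <-.
by rewrite /c2 addrC -addrA [X in _ + X]addrC addrA subrK.
Qed.

(** The degree over the sphere: on [k.+1] vertices an order-preserving onto map is a bijection, so
    such a face covers the top cell once, with sign +1. *)
Let face_sum (c : face d k -> K) : K :=
  \sum_(x | (map_of x != None) && (#|verts x| == k.+1)) c x.

(* A map onto k+1 points from k+2 points has exactly two injective
   restrictions, obtained by dropping one of two consecutive vertices. *)
Let face_sum_boundary b : face_sum (pbd b) = 0.
Proof.
rewrite /face_sum /poset_boundary (exchange_big_dep predT) //= big1 // => s _.
pose Q x := (map_of x != None) && (#|verts x| == k.+1) && cov s x.
rewrite -mulr_suml -[X in X * _]/(\sum_(x | Q x) cover_sign K vert key s x).
have [x0 Qx0|none] := pickP Q; last by rewrite big_pred0 // mul0r.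
have /andP[/andP[x0s /eqP x0k] cx0] : Q x0 := Qx0.
suff -> : \sum_(x | Q x) cover_sign K vert key s x = 0 by rewrite mul0r.
have [a [ax0 sv x0E]] := covers_vert Fv cx0.
have x0le : (x0 <= s)%O by case/andP: cx0.
case Ex0: (map_of x0) x0s => [g|//] _.
have [f [sf f0 gf]] := map_of_le x0le Ex0.
have /monoP fm := map_of_mono sf.
have f_inj : {in verts x0 &, injective f}.
  apply/imset_injP; rewrite eqn_leq leq_imset_card x0k /=.
  rewrite -[X in (X <= _)%N](card_ord k.+1) -cardsT; apply/subset_leq_card/subsetP => i _.
  by move/ontoP: f0 => /(_ i)[q qx0 <-]; apply: imset_f.
(* [a] and [e] are the two vertices with a common value; dropping [e] instead of [a] gives the
   second face, [x1]. *)
have /ontoP/(_ (f a))[e ex0 fe] := f0.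
have ea : e != a by apply: contraNneq ax0 => <-.
have [G eG x0v] : exists2 G : {set 'I_d}, e \notin G & verts x0 = e |: G.
  by exists (verts x0 :\ e); rewrite ?setD1K // !inE eqxx.
have aG : a \notin G by apply: contra ax0; rewrite x0v; apply: setU1r.
have sub1 : a |: G \subset verts s by rewrite sv x0v setUCA subsetUr.
pose x1 := res_face s (a |: G).
have x1v : verts x1 = a |: G by apply: verts_res.
have x1s : map_of x1 != None.
  rewrite map_of_res // sf /= (_ : onto f _) //; apply/ontoP => i.
  have /ontoP/(_ i)[q qx0 fq] := f0.
  have [qe|qe] := eqVneq q e; first by exists a; rewrite ?setU11 // -fe -qe.
  by exists q; rewrite //; move: qx0; rewrite x0v !inE (negPf qe) /= => ->; rewrite orbT.
have cx1 : cov s x1.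
  by rewrite /covers (res_le Fv) // x1v sv x0v !cardsU1 !inE !negb_or [a == e]eq_sym ea aG eG /= eqxx.
have card1 : #|verts x1| = k.+1 by rewrite x1v cardsU1 aG -x0k x0v cardsU1 eG.
have x10 : x1 != x0.
  apply: contraNneq ax0 => <-; rewrite x1v setU11 //.
have Qx1 : Q x1 by rewrite /Q x1s card1 eqxx cx1.
rewrite (bigD1 x0) //= (bigD1 x1) /=; last by rewrite Qx1.
rewrite big1 ?addr0 => [|x /andP[/andP[/andP[/andP[xs /eqP xk] cx] xx0] xx1]].
  rewrite (cover_signE K key ax0 sv) x0v.
  rewrite (cover_signE K key (a := e) (t := x1)); first last.
  - by rewrite x1v sv x0v setUCA.
  - by rewrite x1v !inE negb_or ea eG.
  rewrite x1v /vertex_sign !card_before_setU1 //.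
  (* No vertex lies between [a] and [e], as their value is taken nowhere else; so the two signs
     differ only by the comparison of [a] with [e]. *)
  have -> : [set w in G | (key w < key e)%N] = [set w in G | (key w < key a)%N].
    apply/setP => w; rewrite [LHS]inE [RHS]inE; apply: andb_id2l => wG.
    have wx0 : w \in verts x0 by rewrite x0v setU1r.
    have ws : w \in verts s by rewrite sv setU1r.
    have es : e \in verts s by rewrite sv setU1r.
    have as_ : a \in verts s by rewrite sv setU11.
    have wa : w != a by apply: contraNneq aG => <-.
    have we : w != e by apply: contraNneq eG => <-.
    have fwe : f w != f e by apply: contraNneq we => /(f_inj w e wx0 ex0) ->.
    apply: (@same_side (f w) (f e)) => //; last by rewrite fe; apply: fm.
    - exact: fm.
    - exact: fm.
    - by rewrite fe; apply: fm.
  have : key e != key a by rewrite (inj_eq key_inj).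
  by rewrite !exprD; case: ltngtP => //= _ _; ring.
have [u [ux sv' xE]] := covers_vert Fv cx.
have xle : (x <= s)%O by case/andP: cx.
have us : u \in verts s by rewrite sv' setU11.
have [g' [sf' fx _]] : exists h, [/\ map_of s = Some h, onto h (verts x) & True].
  case Ex: (map_of x) xs => [g'|//] _.
  by have [h [sh hx _]] := map_of_le xle Ex; exists h.
have {sf'}[gE] : Some g' = Some f by rewrite -sf' -sf.
rewrite {g'}gE in fx.
(* A third face would drop some [u] whose value recurs at another vertex [w], but only [a] and [e]
   share a value. *)
have /ontoP/(_ (f u))[w wx fw] := fx.
have wu : w != u by apply: contraNneq ux => <-.
have ws : w \in verts s by apply: (subsetP (vert_le Fv xle)).
exfalso.
have [ua|ua] := eqVneq u a.
  case/negP: xx0; rewrite xE x0E ua; exact: eqxx.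
have [ue|ue] := eqVneq u e.
  case/negP: xx1; apply/eqP; rewrite xE ue sv x0v; congr res_face.
  by rewrite setUCA setU1K // !inE negb_or ea eG.
have ux0 : u \in verts x0 by move: us; rewrite sv !inE (negPf ua).
have [wa|wa] := eqVneq w a.
  case/negP: ue; apply/eqP/f_inj => //; rewrite fe -wa; exact/esym.
have wx0 : w \in verts x0 by move: ws; rewrite sv !inE (negPf wa).
by case/negP: wu; apply/eqP/f_inj.
Qed.

Lemma sphere_not_boundary b : ~ forall x, #|verts x| = k.+1 -> pbd b x = sphere x.
Proof.
move=> bz; have := face_sum_boundary b; rewrite /face_sum.
rewrite (eq_bigr sphere) => [|x /andP[_ /eqP /bz //]].
rewrite (bigD1 crit) /=; last by rewrite [#|_|]card_last eqxx.
rewrite big1 ?addr0 => [|x /andP[/andP[xs _] /negPf xc]].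
  rewrite /sphere eqxx (_ : crit == crit_star = false) ?subr0.
    by move/eqP; rewrite oner_eq0.
  by apply/eqP => /(congr1 (@map_of d k)).
by rewrite /sphere xc; case: (eqVneq x crit_star) xs => [->//|_ _]; rewrite ?subrr.
Qed.

Lemma face_betti m : poset_betti (face d k) K (m%:Z - 1) = (m == k.+1).
Proof.
have [->|mk] := eqVneq m k.+1.
  apply: (poset_betti_eq1 Fv key_inj (z := sphere)).
  - by move=> t _; apply: sphere_cycle.
  - by move=> c; apply: face_cycle.
  - exact: sphere_not_boundary.
apply: (poset_betti_eq0 Fv key_inj) => c /face_cycle[b [l bl]].
exists b => t tm; rewrite bl // /sphere.
have tN y : #|verts y| = k.+1 -> (t == y) = false.
  by move=> yk; apply: contra_neqF mk => /eqP tE; rewrite -tm tE.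
by rewrite !tN ?subrr ?mulr0 ?subr0 //; apply: card_last.
Qed.
End FaceBetti.

(** * Face numbers *)

(** The [j]-th forward difference of [p] at 0. *)
Definition difference (j : nat) (p : nat -> nat) : int :=
  \sum_(i < j.+1) (-1) ^+ (j - i) * ('C(j, i) * p i)%:Z.

Lemma eq_difference j p q : p =1 q -> difference j p = difference j q.
Proof. by move=> pq; apply: eq_bigr => i _; rewrite pq. Qed.

Lemma differenceD j p q :
  difference j (fun i => p i + q i)%N = difference j p + difference j q.
Proof. by rewrite -big_split; apply: eq_bigr => i _; rewrite mulnDr PoszD mulrDr. Qed.

Lemma differenceS j p :
  difference j.+1 p = difference j (fun i => p i.+1) - difference j p.
Proof.
rewrite /difference -sumrN big_ord_recl [X in _ + X](eq_bigr (fun i : 'I_j.+1 =>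
  (-1) ^+ (j - i) * ('C(j, i) * p i.+1)%:Z +
  (-1) ^+ (j - i) * ('C(j, i.+1) * p i.+1)%:Z)); last first.
  by move=> i _; rewrite lift0 subSS binS mulnDl PoszD mulrDr addrC.
rewrite big_split /= addrCA; congr (_ + _).
rewrite [X in _ + X]big_ord_recr /= (@bin_small j j.+1) // mul0n mulr0 addr0.
rewrite [RHS]big_ord_recl /= !subn0 !bin0 exprS mulN1r mulNr; congr (_ + _).
apply: eq_bigr => i _; rewrite /bump /= -mulNr; congr (_ * _).
by rewrite add1n subnS -[RHS]mulN1r -exprS prednK // subn_gt0.
Qed.

Lemma difference_bin j k : difference j (fun i => 'C(i, k)) = (j == k).
Proof.
elim: j k => [|j IHj] [|k].
- by rewrite /difference big_ord1.
- by rewrite /difference big_ord1.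
- by rewrite differenceS (@eq_difference j (fun i => 'C(i.+1, 0)) (fun i => 'C(i, 0))) ?subrr // => i; rewrite !bin0.
- by rewrite differenceS (@eq_difference _ _ (fun i => 'C(i, k.+1) + 'C(i, k))%N) // differenceD IHj addrAC subrr add0r IHj.
Qed.

(** The shifted sequence is C(i,k), so [differenceS] gives the recursion D(j+1) = [j = k] - D(j).
    The explicit 0 matters for [k = 0], where [i.-1] at 0 would give 1. *)
Lemma difference_bin_pred j k :
  difference j (fun i => if i == 0%N then 0%N else 'C(i.-1, k)) =
  if (k < j)%N then (-1) ^+ (j - k.+1) else 0.
Proof.
elim: j => [|j IHj]; first by rewrite /difference big_ord1 mulr0.
rewrite differenceS IHj (@eq_difference j _ (fun i => 'C(i, k))) // difference_bin subSS ltnS.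
case: ltngtP => [kj|jk|->]; rewrite ?subrr ?subr0 ?subnn //.
by rewrite sub0r subnS -[LHS]mulN1r -exprS prednK // subn_gt0.
Qed.

Lemma mul_bin_trinomial n j i : (i <= j)%N -> (j <= n)%N ->
  ('C(n - i, n - j) * 'C(n, i) = 'C(n, j) * 'C(j, i))%N.
Proof.
move=> ij jn; apply/eqP.
have f0 m : (0 < m`!)%N := fact_gt0 m.
rewrite -(eqn_pmul2r (f0 i)) -(eqn_pmul2r (f0 (j - i)%N)) -(eqn_pmul2r (f0 (n - j)%N)).
have e1 := bin_fact (leq_trans ij jn); have e2 := bin_fact jn; have e3 := bin_fact ij.
have e4 : ('C(n - i, n - j) * ((n - j)`! * (j - i)`!) = (n - i)`!)%N.
  by rewrite -(@bin_fact (n - i) (n - j)) ?leq_sub2l //; congr (_ * (_ * _`!))%N; lia.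
apply/eqP; nia.
Qed.

(** The trinomial identity takes C(n,j) out of the sum; this is the source of the binomial factor in
    all the h-numbers. *)
Lemma alternating_sum_difference n j (p : nat -> nat) : (j <= n)%N ->
  \sum_(i < j.+1) (-1) ^+ (j - i) * ('C(n - i, n - j) * ('C(n, i) * p i))%:Z =
  'C(n, j)%:Z * difference j p.
Proof.
move=> jn; rewrite /difference mulr_sumr; apply: eq_bigr => i _.
have ij : (i <= j)%N by rewrite -ltnS.
by rewrite mulnA mul_bin_trinomial // -mulnA PoszM mulrCA.
Qed.

Lemma card_ord_interval n k : (n <= k)%N -> #|[set i : 'I_k.+1 | 0 < i <= n]%N| = n.
Proof.
elim: n => [_|n IHn nk].
  by apply/eqP; rewrite cards_eq0; apply/eqP/setP => i; rewrite !inE; case: (val i).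
rewrite (_ : [set _ | _] = inord n.+1 |: [set i : 'I_k.+1 | 0 < i <= n]%N).
  by rewrite cardsU1 IHn ?(ltnW nk) // inE inordK // ltnn.
apply/setP => i; rewrite !inE -val_eqE /= inordK //.
by case: ltngtP; lia.
Qed.

(** * The number of faces on a given vertex set *)

Section Count.
Variables (d k : nat).
Implicit Types (x y : face d k) (A D : {set 'I_d}) (h : {ffun 'I_d -> 'I_k.+1}).

(** The first vertices of the blocks of [h]. The block of 0 always starts at the minimum [a0], so
    only the other [k] carry information. *)
Definition starts (a0 : 'I_d) h A : {set 'I_d} :=
  [set s in A :\ a0 | [forall q in A, (q < s)%N ==> (h q < h s)%N]].

Let in_starts a0 h A s : s \in starts a0 h A -> forall q, q \in A -> (q < s)%N -> (h q < h s)%N.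
Proof.
by rewrite inE => /andP[_ /forall_inP hs] q qA; apply/implyP/hs.
Qed.

Let starts_inj a0 h A : {in starts a0 h A &, injective h}.
Proof.
move=> s q sD qD hE.
have sA : s \in A by move: sD; rewrite !inE => /andP[/andP[]].
have qA : q \in A by move: qD; rewrite !inE => /andP[/andP[]].
case: (ltngtP s q) => [lt|lt|/val_inj //].
  by have := in_starts qD sA lt; rewrite hE ltnn.
by have := in_starts sD qA lt; rewrite hE ltnn.
Qed.

(** [h] is injective on the starts and carries those up to [t] onto 1, ..., [h t]; so [h] is
    recovered from its starts. *)
Lemma count_starts a0 h A t : a0 \in A -> (forall s, s \in A -> (a0 <= s)%N) ->
  mono h A -> onto h A -> t \in A ->
  h t = #|[set b in starts a0 h A | (b <= t)%N]| :> nat.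
Proof.
move=> a0A a0min /monoP hm /ontoP ho tA.
have ha0 : h a0 = ord0.
  have [s sA hs] := ho ord0; apply: val_inj; apply/eqP.
  by have := hm a0 s a0A sA (a0min s sA); rewrite hs leqn0.
rewrite -(card_in_imset (f := h)); last first.
  by move=> s q /setIdP[sD _] /setIdP[qD _]; apply: starts_inj sD qD.
have -> : h @: [set b in starts a0 h A | (b <= t)%N] = [set i : 'I_k.+1 | 0 < i <= h t]%N.
  apply/setP => i; rewrite inE; apply/imsetP/andP => [[s]|[i_gt0 it]].
    rewrite inE => /andP[sD st] ->; split.
      apply: leq_ltn_trans (in_starts sD a0A _) => //.
      move: sD; rewrite !inE => /andP[/andP[sa0 sA] _].
      by rewrite ltn_neqAle a0min // andbT eq_sym.
    by apply: hm => //; move: sD; rewrite !inE => /andP[/andP[]].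
  have [s0 s0A hs0] := ho i.
  have [s /andP[sA /eqP hs] smin] := @arg_minnP _ s0 (fun s => (s \in A) && (h s == i))
    (@nat_of_ord d) (introT andP (conj s0A (introT eqP hs0))).
  exists s => //; rewrite !inE sA andbT; apply/andP; split.
    apply/andP; split; first by apply: contraTneq i_gt0 => sa; rewrite -hs sa ha0.
    apply/forall_inP => q qA; apply/implyP => qs.
    rewrite ltn_neqAle hm ?(ltnW qs) // andbT.
    apply/negP => /eqP hq; have := smin q; rewrite qA -hs -val_eqE /= hq eqxx => /(_ isT).
    by rewrite leqNgt qs.
  rewrite leqNgt; apply/negP => ts; have := hm t s tA sA (ltnW ts).
  rewrite hs => ti; have := smin t; rewrite tA -val_eqE /= eqn_leq ti it => /(_ isT).
  by rewrite leqNgt ts.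
by rewrite card_ord_interval // -ltnS.
Qed.

Lemma card_starts a0 h A : a0 \in A -> (forall s, s \in A -> (a0 <= s)%N) ->
  mono h A -> onto h A -> #|starts a0 h A| = k.
Proof.
move=> a0A a0min hm ho.
have [t tA tmax] := @arg_maxnP _ a0 (fun s => s \in A) (@nat_of_ord d) a0A.
have ht : h t = k :> nat.
  have /ontoP/(_ ord_max)[s sA hs] := ho.
  apply/eqP; rewrite eqn_leq -ltnS ltn_ord /=.
  by have /monoP/(_ s t sA tA (tmax s sA)) := hm; rewrite hs.
rewrite -[RHS]ht (count_starts a0A a0min hm ho tA); apply: eq_card => b.
rewrite [RHS]inE; case: (boolP (b \in _)) => //= bD.
by apply/esym/tmax; move: bD; rewrite !inE => /andP[/andP[]].
Qed.

(** The inverse construction: the value at [t] is the number of elements of [D] up to [t]. *)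
Lemma starts_onto a0 A D : a0 \in A -> (forall s, s \in A -> (a0 <= s)%N) ->
  D \subset A :\ a0 -> #|D| = k ->
  exists h, [/\ mono h A, onto h A & starts a0 h A = D].
Proof.
move=> a0A a0min DA Dk.
pose n (t : 'I_d) := #|[set b in D | (b <= t)%N]|.
have nk t : (n t < k.+1)%N.
  by rewrite ltnS -Dk subset_leq_card //; apply/subsetP => b; rewrite inE => /andP[].
pose h : {ffun 'I_d -> 'I_k.+1} := [ffun t => inord (n t)].
have hE t : h t = n t :> nat by rewrite ffunE inordK.
have n_mono (s t : 'I_d) : (s <= t)%N -> (n s <= n t)%N.
  move=> st; apply/subset_leq_card/subsetP => b; rewrite !inE => /andP[-> bs].
  exact: leq_trans st.
have n_jump (s t : 'I_d) : t \in D -> (s < t)%N -> (n s < n t)%N.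
  move=> tD st; apply: proper_card; apply/properP; split.
    by apply/subsetP => b; rewrite !inE => /andP[-> bs]; apply: leq_trans (ltnW st).
  by exists t; rewrite !inE tD ?leqnn // -ltnNge.
have D_A s : s \in D -> s \in A /\ s != a0.
  by move=> /(subsetP DA); rewrite !inE => /andP[].
have hm : mono h A by apply/monoP => s t _ _ st; rewrite !hE n_mono.
have startsD : starts a0 h A = D.
  apply/setP => s; rewrite !inE; apply/andP/idP => [[/andP[sa0 sA] /forall_inP hs]|sD].
    have a0s : (a0 < s)%N by rewrite ltn_neqAle a0min // andbT eq_sym.
    have [q /andP[qA qs] qmax] := @arg_maxnP _ a0 (fun q => (q \in A) && (q < s)%N)
      (@nat_of_ord d) (introT andP (conj a0A a0s)).
    have := hs q qA; rewrite qs /= !hE; apply: contraTT => sD; rewrite -leqNgt.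
    apply/subset_leq_card/subsetP => b; rewrite !inE => /andP[bD bs]; rewrite bD /=.
    apply: qmax; have [-> _] := D_A b bD; rewrite ltn_neqAle bs andbT.
    by apply: contraNneq sD => /val_inj <-.
  have [sA sa0] := D_A s sD; rewrite sA sa0; split=> //.
  by apply/forall_inP => q _; apply/implyP => qs; rewrite !hE n_jump.
exists h; split=> //; apply/ontoP => i.
have [->|i0] := eqVneq i ord0.
  exists a0 => //; apply: val_inj; rewrite /= hE; apply/eqP; rewrite cards_eq0.
  apply/eqP/setP => b; rewrite !inE; apply/negP => /andP[bD ba].
  have [bA /negP] := D_A b bD; apply; apply/eqP/val_inj/eqP.
  by rewrite /= eqn_leq ba a0min.
have n_gt0 s : s \in D -> (0 < n s)%N.
  by move=> sD; apply/card_gt0P; exists s; rewrite inE sD leqnn.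
have h_inj : {in D &, injective h}.
  move=> s t sD tD /(congr1 (@nat_of_ord _)); rewrite !hE => st.
  case: (ltngtP s t) => [lt|lt|/val_inj //].
    by have := n_jump s t tD lt; rewrite st ltnn.
  by have := n_jump t s sD lt; rewrite st ltnn.
have /setP/(_ i) : h @: D = [set~ ord0].
  apply/eqP; rewrite eqEcard card_in_imset // Dk cardsC1 card_ord leqnn andbT.
  apply/subsetP => _ /imsetP[s sD ->]; rewrite !inE -val_eqE /= hE.
  by rewrite -lt0n n_gt0.
rewrite !inE i0 => /imsetP[s sD ->]; exists s => //.
by have [] := D_A s sD.
Qed.

Lemma card_faces_on A : A != set0 ->
  #|[set x : face d k | verts x == A]| = ('C(#|A|.-1, k)).+1.
Proof.
case/set0Pn => a aA.
have [a0 a0A a0min] := @arg_minnP _ a (fun s => s \in A) (@nat_of_ord d) aA.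
pose star : face d k := exist _ (A, None) isT.
pose big := [set x : face d k | (verts x == A) && (map_of x != None)].
have -> : [set x : face d k | verts x == A] = star |: big.
  apply/setP => x; rewrite !inE.
  case: (eqVneq (verts x) A) => [xA|xA] /=.
    case Ex: (map_of x) => [h|]; rewrite ?orbT // orbF.
    by apply/esym/eqP/face_eq.
  by rewrite orbF; apply/esym/negbTE; apply: contraNneq xA => ->.
rewrite cardsU1 !inE eqxx andbF add1n; congr _.+1.
pose S (x : face d k) := if map_of x is Some h then starts a0 h A else set0.
have SP x : x \in big -> exists h, [/\ map_of x = Some h, mono h A, onto h A & verts x = A].
  rewrite inE => /andP[/eqP xA]; case Ex: (map_of x) => [h|//] _; exists h.
  by rewrite -xA (map_of_mono Ex) (map_of_onto Ex).
rewrite -(card_in_imset (f := S)); last first.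
  move=> x y /SP[h [xh hm ho xA]] /SP[g [yg gm go yA]]; rewrite /S xh yg => hg.
  apply: (face_some_eq _ xh yg); rewrite ?xA ?yA // => t tA; apply: val_inj => /=.
  by rewrite (count_starts a0A a0min hm ho tA) hg -(count_starts a0A a0min gm go tA).
have cA : #|A|.-1 = #|A :\ a0| by rewrite (cardsD1 a0 A) a0A.
rewrite cA -cards_draws; apply: eq_card => D; rewrite [RHS]inE.
apply/imsetP/andP => [[x /SP[h [xh hm ho _]] ->]|[DA /eqP Dk]].
  rewrite /S xh card_starts //; split=> //.
  by apply/subsetP => s; rewrite inE => /andP[].
have [h [hm ho <-]] := starts_onto a0A a0min DA Dk.
have v : valid (A, restrict (Some h) A) by apply: (@valid_restrict _ _ (Some h) A A).
have cE : restrict (Some h) A = Some (cut h A) by rewrite /= ho.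
pose x : face d k := exist _ (A, restrict (Some h) A) v.
have xE : map_of x = Some (cut h A) by rewrite -cE.
exists x; first by rewrite inE xE eqxx.
rewrite /S xE; apply/setP => s; rewrite !inE.
case: (boolP (s \in A)) => sA; rewrite ?andbF //= ?andbT; congr (_ && _).
by apply: eq_forallb_in => q qA; rewrite !ffunE sA qA.
Qed.

End Count.

Lemma h_number_vert disp (P : finBPOrderType disp) (V : finType) (vert : P -> {set V})
    res d j (p : nat -> nat) : vertexed vert res -> rank P = d -> (j <= d)%N ->
  (forall i, (i <= j)%N -> #|[set x : P | #|vert x| == i]| = ('C(d, i) * p i)%N) ->
  h_number P j = 'C(d, j)%:Z * difference j p.
Proof.
move=> Pv Pd jd Pp; rewrite -alternating_sum_difference // /h_number Pd.
apply: eq_bigr => i _; have ij : (i <= j)%N by rewrite -ltnS.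
rewrite -Pp //; congr (_ * (_ * _)%N%:Z).
apply: eq_card => x; rewrite !inE /cell_dim (rk_vert Pv).
by apply/eqP/eqP; lia.
Qed.

(** * The h'-numbers of the poset and the h-numbers of the links of its atoms *)

Section Numbers.
Variables (d k : nat).
Hypothesis k_lt_d : (k < d)%N.
Implicit Types (x y : face d k) (A : {set 'I_d}).

Local Notation Fv := (face_vertexed d k).
Local Notation vert := (@verts d k).

Lemma face_rank : rank (face d k) = d.
Proof.
apply: (rank_vert Fv) => [x|]; first exact: card_verts_le.
by have [t _ td] := face_facet (empty_face d k); exists t.
Qed.

Lemma card_by_vertices (Q : pred (face d k)) (R : pred {set 'I_d}) n m :
  (forall A, R A -> #|[set x | Q x && (verts x == A)]| = n) ->
  #|[set A | R A]| = m ->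
  #|[set x | Q x && R (verts x)]| = (m * n)%N.
Proof.
move=> Rn Rm; rewrite -sum1_card (partition_big vert R) /=; last first.
  by move=> x; rewrite inE => /andP[].
rewrite -Rm -sum_nat_const [RHS](eq_bigl R) => [|A]; last by rewrite inE.
apply: eq_bigr => A RA; rewrite -(Rn A RA) sum1dep_card; apply: eq_card => x.
by rewrite !inE; case: eqVneq => [->|_]; rewrite ?andbF // RA !andbT.
Qed.

Lemma card_faces i : #|[set x : face d k | #|verts x| == i]| =
  ('C(d, i) * (1 + if i == 0 then 0 else 'C(i.-1, k)))%N.
Proof.
rewrite (_ : [set x : face d k | _] =
  [set x | xpredT x && ((fun A => #|A| == i) (verts x))]) //.
apply: (card_by_vertices (Q := xpredT) (R := fun A => #|A| == i)) => [A /eqP Ai|]; last by rewrite card_draws card_ord.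
have [i0|i_gt0] := posnP i; last first.
  by rewrite add1n -[in RHS]Ai card_faces_on // -card_gt0 Ai.
rewrite (_ : [set x | _] = [set \bot%O]) ?cards1 //; apply/setP => x; rewrite !inE /=.
have /cards0_eq -> : #|A| = 0%N by rewrite Ai.
exact: (vert_eq0 Fv).
Qed.

Lemma face_h_number j : (j <= d)%N -> h_number (face d k) j =
  'C(d, j)%:Z * ((j == 0%N)%:Z + if (k < j)%N then (-1) ^+ (j - k.+1) else 0).
Proof.
move=> jd; rewrite (h_number_vert Fv face_rank jd (fun i _ => card_faces i)).
rewrite differenceD difference_bin_pred; congr (_ * (_ + _)).
by rewrite (@eq_difference _ _ (fun i => 'C(i, 0))) ?difference_bin // => i; rewrite bin0.
Qed.

(** The tail of the h-number and the single Betti term have exponents differing by one and cancel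
    for [j > k.+1]. At [j = k.+1] the Betti sum does not yet reach its nonzero term. *)
Lemma face_h'_number (K : fieldType) j : (j <= d)%N -> h'_number (face d k) K j =
  if (j == 0%N) || (j == k.+1) then 'C(d, j)%:Z else 0.
Proof.
move=> jd; rewrite /h'_number face_rank face_h_number // -mulrDr.
have -> : \sum_(i < j) (-1) ^+ (j - i - 1) * (poset_betti (face d k) K (i%:Z - 1))%:Z =
    if (k.+1 < j)%N then (-1) ^+ (j - k.+1 - 1) else 0 :> int.
  case: ltnP => [kj|jk]; last first.
    rewrite big1 // => i _; rewrite face_betti // ltn_eqF ?mulr0 //.
    exact: leq_trans (ltn_ord i) jk.
  rewrite (bigD1 (Ordinal kj)) //= face_betti // eqxx mulr1 big1 ?addr0 // => i ik.
  by rewrite face_betti // (_ : _ == _ = false) ?mulr0 //; apply: negbTE.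
have [->|j_gt0] := posnP j; first by rewrite mulr1.
rewrite add0r /=.
case: (ltngtP j k.+1) => [jk|kj|->].
- by rewrite addr0 mulr0.
- have [n ->] : exists n, (j - k.+1 = n.+1)%N by exists (j - k.+2)%N; lia.
  by rewrite subn1 exprS mulN1r addNr mulr0.
by rewrite subnn addr0 mulr1.
Qed.

Section LinkOfAtom.
Variables (v : face d k) (v0 : 'I_d).
Hypothesis v_v0 : verts v = [set v0].

Lemma card_sets_containing i :
  #|[set A : {set 'I_d} | (v0 \in A) && (#|A| == i.+1)]| = 'C(d - 1, i).
Proof.
have subC1 (B : {set 'I_d}) : (B \subset [set~ v0]) = (v0 \notin B).
  by rewrite -disjoints_subset disjoint_sym disjoints1.
have <- : #|[set B : {set 'I_d} | B \subset [set~ v0] & #|B| == i]| = 'C(d - 1, i).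
  by rewrite cards_draws cardsC1 card_ord subn1.
rewrite -[RHS](card_in_imset (f := fun B => v0 |: B)) => [|B C]; last first.
  rewrite in_set subC1 => /andP[vB _]; rewrite in_set subC1 => /andP[vC _] E.
  by rewrite -(setU1K vB) -(setU1K vC) E.
apply: eq_card => A; rewrite inE; apply/andP/imsetP => [[vA Ai]|[B]].
  exists (A :\ v0); last by rewrite setD1K.
  by rewrite in_set subC1 setD11 /= -eqSS -(eqP Ai) [X in _ == X](cardsD1 v0) vA.
rewrite in_set subC1 => /andP[vB /eqP <-] ->.
by rewrite setU11 cardsU1 vB.
Qed.

(** For [k > 0] an atom is a basepoint face and lies below every face containing [v0]. For [k = 0]
    two atoms lie over [v0], and above each there is one face on [A]. *)
Lemma card_faces_above A i : v0 \in A -> #|A| = i.+1 ->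
  #|[set x : face d k | (v <= x)%O && (verts x == A)]| =
  (1 + if (0 < k)%N then 'C(i, k) else 0)%N.
Proof.
move=> vA Ai; have A0 : A != set0 by apply/set0Pn; exists v0.
case: ifP => [k_gt0|/negbT].
  rewrite (_ : [set x | _] = [set x | verts x == A]) ?card_faces_on ?Ai //.
  apply/setP => x; rewrite !inE; apply: andb_idl => /eqP xA.
  have small (h : {ffun 'I_d -> 'I_k.+1}) : onto h [set v0] = false.
    by apply/negbTE/negP => /onto_card; rewrite cards1; lia.
  rewrite face_leE xA v_v0 sub1set vA /=; apply/eqP.
  case Ev: (map_of v) => [h|].
    by have := map_of_onto Ev; rewrite v_v0 small.
  by case: (map_of x) => // h; rewrite /= small.
rewrite -eqn0Ngt => /eqP k0; rewrite addn0.
have one (i1 i2 : 'I_k.+1) : i1 = i2.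
  by apply: val_inj => /=; have := ltn_ord i1; have := ltn_ord i2; lia.
have ontoT (h : {ffun 'I_d -> 'I_k.+1}) (B : {set 'I_d}) : B != set0 -> onto h B.
  by case/set0Pn => b bB; apply/ontoP => l; exists b.
pose f0 : {ffun 'I_d -> 'I_k.+1} := [ffun=> ord0].
have ov : valid (A, if map_of v is Some _ then restrict (Some f0) A else None).
  case: (map_of v) => [_|//]; apply: (@valid_restrict _ _ (Some f0) A A) => //.
  by apply/monoP => s t _ _ _; rewrite !ffunE.
pose x0 : face d k := exist _ (A, if map_of v is Some _ then restrict (Some f0) A else None) ov.
have x0E : map_of x0 = if map_of v is Some _ then restrict (Some f0) A else None by [].
have x0v : verts x0 = A by [].
apply/eqP/cards1P; exists x0; apply/setP => x; rewrite !inE.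
have v0n : [set v0] != set0 by apply/set0Pn; exists v0; rewrite inE.
apply/andP/eqP => [[vx /eqP xA]|->]; last first.
  rewrite x0v eqxx face_leE x0v v_v0 sub1set vA x0E andTb; split=> //; apply/eqP.
  case Ev: (map_of v) => [h|//]; rewrite restrict_restrict ?sub1set //= ontoT //.
  by congr Some; apply/ffunP => s; apply: one.
apply: face_eq; rewrite ?xA // x0E.
move: vx; rewrite face_leE v_v0 => /andP[_ /eqP <-].
case: (map_of x) => [h|//] /=; rewrite !ontoT //.
by congr Some; apply/ffunP => s; apply: one.
Qed.

Lemma link_h_number j : (j <= d - 1)%N -> h_number (link v) j =
  if (j == 0%N) || (j == k) then 'C(d - 1, j)%:Z else 0.
Proof.
move=> jd; have v1 : #|verts v| = 1%N by rewrite v_v0 cards1.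
have rankL : rank (link v) = (d - 1)%N.
  by rewrite (rank_link Fv v (@face_facet d k)) ?v1 // => x; apply: card_verts_le.
have linkv := link_vertexed Fv v.
rewrite (h_number_vert linkv rankL jd (p := fun i => 1 + if (0 < k)%N then 'C(i, k) else 0)%N).
  rewrite differenceD (@eq_difference _ (fun=> 1%N) (fun i => 'C(i, 0))) => [|i]; last first.
    by rewrite bin0.
  (* For [k = 0] the indices 0 and [k] coincide and must count once. *)
  rewrite difference_bin; case: posnP => [k0|k_gt0].
    rewrite (_ : difference j _ = 0) ?addr0 ?k0 ?orbb; last first.
      by rewrite /difference big1 // => i _; rewrite muln0 mulr0.
    by case: eqP; rewrite ?mulr1 ?mulr0.
  rewrite difference_bin; case: (eqVneq j 0%N) => [->|_] /=.
    by rewrite (ltn_eqF k_gt0) addr0 mulr1.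
  by case: eqP; rewrite add0r ?mulr1 ?mulr0.
move=> i ij.
rewrite -(card_in_imset (f := val)) => [|x y _ _]; last exact: val_inj.
rewrite -(card_by_vertices (Q := fun x => (v <= x)%O)
   (R := fun A => (v0 \in A) && (#|A| == i.+1)) _ (card_sets_containing i)); last first.
  by move=> A /andP[vA /eqP Ai]; apply: card_faces_above.
apply: eq_card => x; rewrite inE; apply/imsetP/and3P => [[y]|[vx v0x /eqP xi]].
  rewrite inE (card_link_vert Fv) v1 => /eqP yi ->.
  have vy := vert_le Fv (valP y); rewrite v_v0 sub1set in vy.
  split=> //; first exact: (valP y).
  have : (0 < #|verts (val y)|)%N by apply/card_gt0P; exists v0.
  by rewrite -yi subn1 => /prednK ->.
exists (exist _ x vx : link v) => //.
by rewrite inE (card_link_vert Fv) v1 /= xi subn1.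
Qed.
End LinkOfAtom.
End Numbers.

Theorem theorem2p8 (K : fieldType) (d k : nat)
    (hd : (2 <= d)%N) (hk : (k <= d - 1)%N) :
  exists (disp : Order.disp_t) (X : finBPOrderType disp),
    [/\ simplicial_poset X, rank X = d & buchsbaum_poset X K] /\
    [/\ (forall i : nat, (i <= d - 1)%N ->
           poset_betti X K i%:Z = (if i == k then 1%N else 0%N)) /\
        (forall j : nat, (j <= d)%N ->
           h'_number X K j =
             if (j == 0%N) || (j == k.+1) then 'C(d, j)%:Z else 0),
        forall v : X, atom v -> shellable (link v) &
        forall v : X, atom v -> forall j : nat, (j <= d - 1)%N ->
          h_number (link v) j =
            if (j == 0%N) || (j == k) then 'C(d - 1, j)%:Z else 0].
Proof.
have k_lt_d : (k < d)%N by lia.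
have Fv := face_vertexed d k.
exists face_display, (face d k); split; split.
- exact: vertexed_simplicial Fv.
- exact: face_rank.
- apply: (vertexed_buchsbaum K Fv (d := d)); first by lia.
  + exact: face_facet.
  + exact: card_verts_le.
  + exact: face_facet_order.
- split=> [i _|j]; last exact: face_h'_number.
  have -> : i%:Z = i.+1%:Z - 1 by lia.
  by rewrite face_betti // eqSS; case: eqP.
- move=> v; rewrite /atom (rk_vert Fv) => /eqP v1.
  have [|w wv] := @face_facet_order d k v; first by rewrite -(card_vert_gt0 Fv) v1.
  by apply: (link_shellable Fv (@face_facet d k) (@card_verts_le d k) _ wv); rewrite v1.
move=> v; rewrite /atom (rk_vert Fv) => /cards1P[v0 v_v0] j.
exact: (link_h_number k_lt_d v_v0).
Qed.
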